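(* A connected Lagrangian surface in $\mathbb{H}^2\times\mathbb{H}^2$ is totally geodesic if and only if it is one of the following: (a) a product of geodesics in $\mathbb{H}^2$; (b) a surface which is, up to a holomorphic or anti-holomorphic isometry of $\mathbb{H}^2\times\mathbb{H}^2$, equal to an open part of the diagonal surface.
   Context: All manifolds, maps and curves are smooth. $\mathbb{R}^3_1$ is $\mathbb{R}^3$ with the metric $\langle a,b\rangle=-a_1b_1+a_2b_2+a_3b_3$, and $a\boxtimes b=(a_3b_2-a_2b_3,\ a_3b_1-a_1b_3,\ a_1b_2-a_2b_1)$ is the Lorentzian cross product. For $c<0$, $\mathbb{H}^2(c)=\{x\in\mathbb{R}^3_1\mid\langle x,x\rangle=1/c,\ x_1>0\}$ with the induced Riemannian metric (of constant Gaussian curvature $c$) and complex structure $(J_{\mathbb{H}^2(c)})_xv=\sqrt{-c}\,x\boxtimes v$. Write $\mathbb{H}^2=\mathbb{H}^2(-1)$. The product $\mathbb{H}^2\times\mathbb{H}^2\subset\mathbb{R}^3_1\times\mathbb{R}^3_1$ carries the Riemannian product metric and the complex structure $J=(J_{\mathbb{H}^2},-J_{\mathbb{H}^2})$. A holomorphic (respectively, anti-holomorphic) isometry is an isometry whose differential preserves $J$ (respectively, takes $J$ to $-J$). A Lagrangian surface is a surface $\Sigma$ with an immersion $\Phi:\Sigma\to\mathbb{H}^2\times\mathbb{H}^2$ such that $J$ maps each tangent plane of the surface to its orthogonal complement. It is totally geodesic if its second fundamental form vanishes identically. A product of geodesics is the surface given by an immersion $I_1\times I_2\subseteq\mathbb{R}^2\to\mathbb{H}^2\times\mathbb{H}^2:(s_1,s_2)\mapsto(\beta_1(s_1),\beta_2(s_2))$,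 where $I_1,I_2\subseteq\mathbb{R}$ are open intervals and $\beta_1:I_1\to\mathbb{H}^2$, $\beta_2:I_2\to\mathbb{H}^2$ are geodesics parametrized by arc length. The diagonal surface is the image of the immersion $\mathbb{H}^2(-1/2)\to\mathbb{H}^2\times\mathbb{H}^2:x\mapsto\tfrac{1}{\sqrt2}(x,x)$.
   Formalization: In (a), ''a product of geodesics'' is taken to mean an open part of a product of geodesics, since for instance a disc in the product of two complete geodesics is a connected totally geodesic Lagrangian surface that is not a full product of intervals. *)

(* Defs.v *)
From HB Require Import structures.
From mathcomp Require Import all_boot all_order all_algebra.
From mathcomp Require Import all_classical all_reals all_analysis.
Set Implicit Arguments.
Unset Strict Implicit.
Unset Printing Implicit Defensive.
Import Order.TTheory GRing.Theory Num.Theory.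
Import numFieldNormedType.Exports.
Local Open Scope classical_set_scope.
Local Open Scope ring_scope.

Section Smoothness.
Context {R : realType}.

(* Only meaningful for U open: f and all its iterated directional derivatives
   up to order k exist and are continuous on U. *)
Fixpoint Ck_on {V W : normedModType R} (U : set V) (k : nat) (f : V -> W) :
    Prop :=
  (forall x, U x -> {for x, continuous f}) /\
  match k with
  | 0%N => True
  | k'.+1 => forall v, (forall x, U x -> derivable f x v) /\
                       Ck_on U k' (fun x => 'D_v f x)
  end.

Definition smooth_on {V W : normedModType R} (U : set V) (f : V -> W) : Prop :=
  forall k, Ck_on U k f.

(* Smoothness along a closed embedded submanifold S: the values of f off S are
   irrelevant except that they provide a smooth extension near S. *)
Definition smooth_near {V W : normedModType R} (S : set V) (f : V -> W) : Prop :=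
  exists U : set V, [/\ open U, S `<=` U & smooth_on U f].

End Smoothness.

(* An open part of B: a subset open in the subspace topology of B. *)
Definition open_part {T : topologicalType} (A B : set T) : Prop :=
  exists2 U : set T, open U & A = B `&` U.

Section AbstractSurfaces.
Context {R : realType}.

(* chart_map matters only on chart_dom, and chart_inv only on chart_cod. *)
Record chart (M : topologicalType) := Chart {
  chart_dom : set M;
  chart_map : M -> 'rV[R]_2;
  chart_inv : 'rV[R]_2 -> M }.

Definition chart_cod {M : topologicalType} (c : chart M) : set 'rV[R]_2 :=
  chart_map c @` chart_dom c.

Definition is_chart {M : topologicalType} (c : chart M) : Prop :=
  [/\ open (chart_dom c), open (chart_cod c),
      forall m, chart_dom c m -> chart_inv c (chart_map c m) = m,
      forall m, chart_dom c m -> {for m, continuous (chart_map c)} &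
      forall x, chart_cod c x -> {for x, continuous (chart_inv c)}].

Definition compatible {M : topologicalType} (c d : chart M) : Prop :=
  smooth_on (chart_cod c `&` (chart_inv c @^-1` chart_dom d))
            (chart_map d \o chart_inv c).

End AbstractSurfaces.

Record smooth_surface (R : realType) := SmoothSurface {
  surface_sort :> topologicalType;
  surface_hausdorff : hausdorff_space surface_sort;
  surface_countable : @second_countable surface_sort;
  atlas : set (@chart R surface_sort);
  atlas_chart : forall c, atlas c -> is_chart c;
  atlas_cover : forall m, exists2 c, atlas c & chart_dom c m;
  atlas_compat : forall c d, atlas c -> atlas d -> compatible c d }.

Section HyperbolicPlanes.
Context {R : realType}.
Implicit Types (a b x v : 'rV[R]_3) (c : R).

Definition mink a b : R :=
  - (a 0 0 * b 0 0) + a 0 1 * b 0 1 + a 0 2%:R * b 0 2%:R.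

Definition lcross a b : 'rV[R]_3 :=
  \row_(j < 3) [:: a 0 2%:R * b 0 1 - a 0 1 * b 0 2%:R;
                   a 0 2%:R * b 0 0 - a 0 0 * b 0 2%:R;
                   a 0 0 * b 0 1 - a 0 1 * b 0 0]`_j.

(* H^2(c), for c < 0. *)
Definition hyp c : set 'rV[R]_3 :=
  [set x | mink x x = c^-1 /\ 0 < x 0 0].

Definition hyp_tangent x : set 'rV[R]_3 := [set v | mink x v = 0].

Definition hyp_J c x v : 'rV[R]_3 := Num.sqrt (- c) *: lcross x v.

(* Orthogonal projection of R^3_1 onto the tangent plane of H^2(c) at x, where
   <x,x> = 1/c.  The Levi-Civita connection of H^2(c) is the projection of the
   flat derivative. *)
Definition hyp_proj c x a : 'rV[R]_3 := a - (c * mink a x) *: x.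

(* Unit-speed geodesics of H^2 = H^2(-1) on an open interval I; the values of
   beta outside I are irrelevant. *)
Definition unit_geodesic (I : set R) (beta : R -> 'rV[R]_3) : Prop :=
  [/\ [/\ open I, is_interval I & I !=set0],
      smooth_on (I : set R^o) (beta : R^o -> 'rV[R]_3),
      forall t, I t -> hyp (-1) (beta t),
      forall t, I t -> mink (derive1 beta t) (derive1 beta t) = 1 &
      forall t, I t -> hyp_proj (-1) (beta t) (derive1 (derive1 beta) t) = 0].

End HyperbolicPlanes.

Section ProductGeometry.
Context {R : realType}.
Local Notation E := ('rV[R]_3 * 'rV[R]_3)%type.
Implicit Types (p a b v : E).

Definition ip a b : R := mink a.1 b.1 + mink a.2 b.2.

Definition HH : set E := [set p | hyp (-1) p.1 /\ hyp (-1) p.2].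

Definition HH_tangent p : set E :=
  [set v | hyp_tangent p.1 v.1 /\ hyp_tangent p.2 v.2].

Definition HH_J p v : E := (hyp_J (-1) p.1 v.1, - hyp_J (-1) p.2 v.2).

Definition HH_proj p a : E := (hyp_proj (-1) p.1 a.1, hyp_proj (-1) p.2 a.2).

(* The differential of F at p in HH on tangent vectors of HH depends only on
   the restriction of F to HH. *)
Definition HH_isometry (F : E -> E) : Prop :=
  [/\ smooth_near HH F,
      exists G : E -> E,
        [/\ smooth_near HH G,
            forall p, HH p -> HH (F p),
            forall p, HH p -> HH (G p),
            forall p, HH p -> G (F p) = p &
            forall p, HH p -> F (G p) = p] &
      forall p v w, HH p -> HH_tangent p v -> HH_tangent p w ->
        ip ('D_v F p) ('D_w F p) = ip v w].

Definition holomorphic_isometry (F : E -> E) : Prop :=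
  HH_isometry F /\
  forall p v, HH p -> HH_tangent p v ->
    'D_(HH_J p v) F p = HH_J (F p) ('D_v F p).

Definition antiholomorphic_isometry (F : E -> E) : Prop :=
  HH_isometry F /\
  forall p v, HH p -> HH_tangent p v ->
    'D_(HH_J p v) F p = - HH_J (F p) ('D_v F p).

Definition geodesic_product (I1 I2 : set R) (beta1 beta2 : R -> 'rV[R]_3) :
    set E :=
  [set (beta1 s.1, beta2 s.2) | s in I1 `*` I2].

Definition diagonal_surface : set E :=
  [set ((Num.sqrt 2)^-1 *: x, (Num.sqrt 2)^-1 *: x) | x in hyp (- 2^-1)].

(* Local geometry of a parametrization f : R^2 -> HH near x. *)

Definition tangent_plane (f : 'rV[R]_2 -> E) (x : 'rV[R]_2) : set E :=
  range (fun v : 'rV[R]_2 => 'D_v f x).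

Definition normal_plane (f : 'rV[R]_2 -> E) (x : 'rV[R]_2) : set E :=
  [set n | HH_tangent (f x) n /\
           forall t, tangent_plane f x t -> ip n t = 0].

Definition coord_frame (f : 'rV[R]_2 -> E) (x : 'rV[R]_2) (i : 'I_2) : E :=
  'D_(delta_mx 0 i) f x.

Definition first_form (f : 'rV[R]_2 -> E) (x : 'rV[R]_2) : 'M[R]_2 :=
  \matrix_(i, j) ip (coord_frame f x i) (coord_frame f x j).

Definition tangent_part (f : 'rV[R]_2 -> E) (x : 'rV[R]_2) a : E :=
  \sum_i \sum_j (invmx (first_form f x) i j * ip a (coord_frame f x i))
                *: coord_frame f x j.

(* The ambient covariant derivative, in direction v, of the constant
   coordinate field w pushed forward by f. *)
Definition HH_nabla (f : 'rV[R]_2 -> E) (x v w : 'rV[R]_2) : E :=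
  HH_proj (f x) ('D_v (fun y => 'D_w f y) x).

Definition second_form (f : 'rV[R]_2 -> E) (x v w : 'rV[R]_2) : E :=
  HH_nabla f x v w - tangent_part f x (HH_nabla f x v w).

End ProductGeometry.

Section SurfacesInHH.
Context {R : realType} {S : smooth_surface R}.
Context (Phi : S -> 'rV[R]_3 * 'rV[R]_3).

Definition is_immersion : Prop :=
  (forall m, HH (Phi m)) /\
  forall c, atlas c ->
    smooth_on (chart_cod c) (Phi \o chart_inv c) /\
    forall x, chart_cod c x ->
      injective (fun v : 'rV[R]_2 => 'D_v (Phi \o chart_inv c) x).

Definition is_lagrangian : Prop :=
  is_immersion /\
  forall c x, atlas c -> chart_cod c x ->
    HH_J (Phi (chart_inv c x)) @` tangent_plane (Phi \o chart_inv c) x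
    = normal_plane (Phi \o chart_inv c) x.

Definition totally_geodesic : Prop :=
  forall c x v w, atlas c -> chart_cod c x ->
    second_form (Phi \o chart_inv c) x v w = 0.

(* A connected immersed surface inside a product of geodesics need not be
   parametrized by a full product of intervals (take a disc in the product of
   two complete geodesics), so surfaces are compared up to open parts. *)
Definition is_geodesic_product : Prop :=
  exists (I1 I2 : set R) (beta1 beta2 : R -> 'rV[R]_3),
    [/\ unit_geodesic I1 beta1, unit_geodesic I2 beta2 &
        open_part (range Phi) (geodesic_product I1 I2 beta1 beta2)].

Definition is_diagonal_up_to_isometry : Prop :=
  exists F : 'rV[R]_3 * 'rV[R]_3 -> 'rV[R]_3 * 'rV[R]_3,
    (holomorphic_isometry F \/ antiholomorphic_isometry F) /\
    open_part (F @` range Phi) diagonal_surface.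

End SurfacesInHH.

(* Main.v *)
Require Import Defs.
From HB Require Import structures.
From mathcomp Require Import all_boot all_order all_algebra.
From mathcomp Require Import all_classical all_reals all_analysis.
From mathcomp Require Import ring lra.
Set Implicit Arguments.
Unset Strict Implicit.
Unset Printing Implicit Defensive.
Import Order.TTheory GRing.Theory Num.Theory.
Import numFieldNormedType.Exports.
Local Open Scope classical_set_scope.
Local Open Scope ring_scope.

(** A chart expression of the immersion is a map f = (g1, g2) from an open set
    of the plane to a pair of hyperboloids, and everything is done with flat
    derivatives in R^3_1.

    From totally geodesic to the two models.  Since J = (J, -J), the surface is
    Lagrangian exactly when g1 and g2 pull the two area forms back to the same
    2-form [area], that is, when the pairing of D_u f with J D_v f vanishes.
    Total geodesy says that, up to multiples of the position vectors, D_v D_w f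
    is again some D_y f; hence it pairs to zero with J D_z f.  Differentiating
    this along u and antisymmetrizing in u and v, where the third derivatives
    cancel, leaves the identity [codazzi]
      h(v, w) area(u, z) = h(u, w) area(v, z),
    with h the difference of the two pulled-back metrics.  As area is
    alternating on a plane, at each point h = 0 or area = 0
    ([codazzi_isometric]).
    - If area vanishes near a point, each g_i has rank one and the normal
      g_i x D_w g_i moves along itself only, so that g_i stays in a plane
      through the origin ([rank1_planar]), whose trace on the hyperboloid is a
      geodesic.
    - If area does not vanish, then h = 0 nearby: g1 and g2 have the same
      metric and the same orientation.  The linear map carrying the moving
      frame (g1, D_w g1, g1 x D_w g1) to that of g2 has zero derivative
      ([transport_constant]), so g2 = T g1 for a fixed Lorentz transformation T.
    Near every point the surface thus lies in one of the sets of [model], a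
    product of two planes or the graph of some T; the set is determined by any
    piece of the surface ([model_unique]), so connectedness makes it global
    ([global_model]).  Two linear functionals are coordinates on the model, so
    the surface has open image in it ([range_open_part]).  A product of planes
    meets the pair of hyperboloids in a product of complete geodesics
    ([range_planes]), and (T, id) is a holomorphic isometry that sends the graph
    to the diagonal ([range_graph]).

    Conversely, in a product of geodesics the tangent plane of the surface is the
    product of the two tangent lines, and each covariant derivative stays in the
    planes of the geodesics, which leaves no room for a normal component
    ([planar_totally_geodesic]).  For the diagonal, an isometry F has no intrinsic
    second derivative: paired with the differential of F it gives a trilinear
    form that is symmetric in one pair of arguments and skew in another, hence
    zero ([hessian_pairing0]).
    Therefore F transports the covariant derivatives of f to those of F o f.
    The latter are tangent to the diagonal because all derivatives of F o f are
    diagonal vectors, and a dimension count identifies the diagonal tangent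
    vectors with the derivatives of F o f ([diagonal_nabla]). *)

(** * Directional derivatives and C^1 maps *)

Section DirectionalDerivatives.
Context {R : realType}.
Implicit Types (V W : normedModType R).

(** Chain rule with a differentiable outer map and an inner map that is only known
    to have one directional derivative: the inner map is restricted to the line
    through x, where derivability and differentiability agree. *)
Lemma is_derive_comp_diff V W W' (g : W -> W') (f : V -> W) x v df :
  differentiable g (f x) -> is_derive x v f df ->
  is_derive x v (fun y => g (f y)) ('D_df g (f x)).
Proof.
move=> dg [/derivable1P df1 dfE].
have dk : differentiable (fun h : R => f (h *: v + x)) 0.
  exact/derivable1_diffP.
have dgk : differentiable (fun h : R => g (f (h *: v + x))) 0.
  by apply: differentiable_comp => //; rewrite scale0r add0r.
have dE : forall (U : normedModType R) (k : V -> U),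
    'D_v k x = 'D_1 (fun h : R => k (h *: v + x)) 0.
  move=> U k; rewrite /derive; congr (lim (_ @ 0^')); apply/funext => h /=.
  by rewrite addr0 scale0r add0r [_%:A]mulr1.
apply: DeriveDef; first by apply/derivable1P/derivable1_diffP.
rewrite dE deriveE //.
have -> : (fun h : R => g (f (h *: v + x))) = g \o (fun h : R => f (h *: v + x)).
  by [].
rewrite diff_comp ?scale0r ?add0r//= -!deriveE// ?scale0r ?add0r//.
by rewrite -dE dfE.
Qed.

Lemma is_derive_linear V W W' (L : {linear W -> W'}) (f : V -> W) x v df :
  continuous L -> is_derive x v f df -> is_derive x v (fun y => L (f y)) (L df).
Proof.
move=> cL fd.
have dL : differentiable L (f x) by apply: linear_differentiable.
apply: is_derive_eq (is_derive_comp_diff dL fd) _.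
by rewrite deriveE// diff_lin.
Qed.

Lemma is_derive_fst V W W' (f : V -> W * W') x v df :
  is_derive x v f df -> is_derive x v (fun y => (f y).1) df.1.
Proof.
move=> fd; apply: (@is_derive_linear _ _ _ (@fst W W')) => // -[a b].
exact: cvg_fst.
Qed.

Lemma is_derive_snd V W W' (f : V -> W * W') x v df :
  is_derive x v f df -> is_derive x v (fun y => (f y).2) df.2.
Proof.
move=> fd; apply: (@is_derive_linear _ _ _ (@snd W W')) => // -[a b].
exact: cvg_snd.
Qed.

Lemma is_derive_coord V m n (f : V -> 'M[R]_(m, n)) x v df i j :
  is_derive x v f df -> is_derive x v (fun y => f y i j) (df i j).
Proof.
move=> fd.
have lin : linear (fun M : 'M[R]_(m, n) => M i j : R^o).
  by move=> a M N; rewrite !mxE.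
pose LM := GRing.isLinear.Build _ _ _ _ _ lin.
pose L : {linear 'M[R]_(m, n) -> R^o} := HB.pack (fun M : 'M[R]_(m, n) => M i j : R^o) LM.
exact: (@is_derive_linear _ _ _ L _ _ _ _ (@coord_continuous _ _ _ i j)).
Qed.

Lemma is_derive_pair V W W' (f : V -> W * W') x v df :
  is_derive x v (fun y => (f y).1) df.1 ->
  is_derive x v (fun y => (f y).2) df.2 -> is_derive x v f df.
Proof.
move=> [c1 e1] [c2 e2].
have c : (fun h => h^-1 *: ((f \o shift x) (h *: v) - f x)) @ 0^' --> df.
  have h1 : (fun h => h^-1 *: (((fun y => (f y).1) \o shift x) (h *: v) - (f x).1)) @ 0^' --> df.1.
    by rewrite -e1; exact: c1.
  have h2 : (fun h => h^-1 *: (((fun y => (f y).2) \o shift x) (h *: v) - (f x).2)) @ 0^' --> df.2.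
    by rewrite -e2; exact: c2.
  case: df e1 e2 h1 h2 => d1 d2 /= e1 e2 h1 h2.
  apply: cvg_trans (cvg_pair h1 h2).
  by apply: near_eq_cvg; near=> h => /=; case: (f _) => ? ?; case: (f _).
by split; [apply/cvg_ex; exists df | exact: cvg_lim].
Unshelve. all: by end_near. Qed.

Lemma is_derive_line V W (g : V -> W) x v t :
  derivable g (x + t *: v) v ->
  is_derive t 1 (fun s : R => g (x + s *: v)) ('D_v g (x + t *: v)).
Proof.
move=> dg.
have E : (fun h : R => h^-1 *: (((fun s : R => g (x + s *: v)) \o shift t) (h *: 1)
             - g (x + t *: v))) =
         (fun h : R => h^-1 *: ((g \o shift (x + t *: v)) (h *: v) - g (x + t *: v))).
  apply/funext => h /=; congr (_ *: (g _ - _)).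
  by rewrite [_%:A]mulr1 scalerDl addrCA.
by apply: DeriveDef; rewrite /derivable /derive E.
Qed.

Lemma mean_value V (g : V -> R) x v :
  (forall t : R, 0 <= t <= 1 -> derivable g (x + t *: v) v) ->
  exists2 t : R, 0 <= t <= 1 & g (x + v) - g x = 'D_v g (x + t *: v).
Proof.
move=> dg.
have dl (t : R) : 0 <= t <= 1 ->
    is_derive t 1 (fun s : R => g (x + s *: v)) ('D_v g (x + t *: v)).
  by move=> /dg; exact: is_derive_line.
have [t|t|t] := @MVT_segment R (fun s => g (x + s *: v))
  (fun s => 'D_v g (x + s *: v)) 0 1 ler01.
- by rewrite in_itv/= => /andP[? ?]; apply: dl; rewrite !ltW.
- move: t; apply: derivable_within_continuous => t; rewrite in_itv/= => t01.
  by case: (dl t t01).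
- by rewrite in_itv/= scale1r scale0r addr0 subr0 mulr1 => ? ?; exists t.
Qed.

Lemma deriveZdir V W (g : V -> W) x v (a : R) :
  derivable g x v -> is_derive x (a *: v) g (a *: 'D_v g x).
Proof.
move=> dg.
have df : differentiable (fun s : R => g (x + s *: v)) 0.
  apply/derivable1_diffP; have := @is_derive_line _ _ g x v 0.
  by rewrite scale0r addr0 => /(_ dg) [].
have d0 : is_derive (0 : R^o) (1 : R^o) (a \*: (id : R^o -> R^o)) (a *: (1 : R^o)).
  exact: is_deriveZ.
have := @is_derive_comp_diff R^o R^o _ (fun s : R => g (x + s *: v)) _ 0 1 _ _ d0.
rewrite /= scaler0 => /(_ df) h.
have E : (fun h : R => h^-1 *: ((g \o shift x) (h *: (a *: v)) - g x)) =
   (fun h : R => h^-1 *: (((fun y : R => g (x + (a *: y) *: v)) \o shift 0) (h *: 1) - g (x + (a *: 0) *: v))).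
  apply/funext => k /=; rewrite scaler0 scale0r !addr0; congr (_ *: (g _ - _)).
  by rewrite addrC scalerA [k%:A]mulr1 mulrC.
have [h1 h2] : is_derive x (a *: v) g ('D_(a *: 1) (fun s : R => g (x + s *: v)) 0).
  by apply: DeriveDef; [rewrite /derivable E; case: h|rewrite /derive E; case: h].
apply: DeriveDef => //.
rewrite h2 deriveE// linearZ/= -deriveE//; congr (_ *: _).
have := @is_derive_line _ _ g x v 0.
by rewrite scale0r addr0 => /(_ dg) [].
Qed.

(** The mean value theorem along e turns continuity of D_e g at x into an estimate
    that is uniform in the base point x + y. *)
Lemma partial_strict V (g : V -> R) x e :
  (\forall y \near x, derivable g y e) -> {for x, continuous (fun y => 'D_e g y)} ->
  forall eps : R, 0 < eps -> exists2 d : R, 0 < d & forall y (t : R),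
  `|y| < d -> `|t| < d ->
  `|g (x + y + t *: e) - g (x + y) - t * 'D_e g x| <= eps * `|t|.
Proof.
move=> dg cg eps eps0.
have /nbhs_ballP[r /= r0 rP] : \forall y \near x,
    derivable g y e /\ `|'D_e g x - 'D_e g y| <= eps.
  near=> y; split; near: y => //.
  by move/cvgrPdist_le : cg; exact.
(* Keeps x + y + s (t e) in the ball for 0 <= s <= 1. *)
pose d := r / (2 + `|e|).
have e2 : 0 < 2 + `|e| by rewrite ltr_wpDr.
have d0 : 0 < d by rewrite divr_gt0.
exists d => // y t yd td.
have B (s : R) : 0 <= s <= 1 -> ball x r (x + y + s *: (t *: e)).
  move=> /andP[s0 s1]; rewrite -ball_normE /ball_ /= -addrA opprD addNKr normrN.
  rewrite (le_lt_trans (ler_normD _ _))// !normrZ (ger0_norm s0).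
  have : d * (1 + `|e|) < r.
    rewrite /d mulrAC ltr_pdivrMr// ltr_pM2l// ltrD2r; exact: ltr1n.
  apply: le_lt_trans; rewrite mulrDr mulr1 lerD//; first exact: ltW.
  rewrite mulrA ler_wpM2r// (le_trans _ (ltW td))//.
  by rewrite ler_piMl.
have [|s s01 ->] := @mean_value _ g (x + y) (t *: e).
  move=> s s01; have [h _] := rP _ (B s s01).
  by case: (deriveZdir t h).
have [h1 h2] := rP _ (B s s01).
rewrite (@derive_val _ _ _ _ _ _ _ (deriveZdir t h1)) -mulrBr normrM mulrC.
by rewrite ler_wpM2r// distrC.
Unshelve. all: by end_near. Qed.

(** Moving from x to x + h one coordinate at a time; each move costs one use of
    [partial_strict].  The coordinates c i and the directions e i stay abstract so
    that the result serves both row vectors and pairs of row vectors. *)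
Lemma C1_increment V (I : Type) (e : I -> V) (c : I -> V -> R) (g : V -> R) x (s : seq I) :
  (forall i h, `|c i h| <= `|h|) ->
  (forall i, \forall y \near x, derivable g y (e i)) ->
  (forall i, {for x, continuous (fun y => 'D_(e i) g y)}) ->
  forall eps : R, 0 < eps -> \forall h \near (0 : V),
  `|g (x + \sum_(i <- s) c i h *: e i) - g x - \sum_(i <- s) c i h * 'D_(e i) g x|
  <= eps * `|h|.
Proof.
move=> cb dg cg; elim: s => [|a s IH] eps eps0.
  near=> h; by rewrite !big_nil addr0 !subrr normr0 mulr_ge0// ltW.
have eps2 : 0 < eps / 2 by rewrite divr_gt0.
have [d d0 dP] := partial_strict (dg a) (cg a) eps2.
pose M := \sum_(i <- s) `|e i|.
have M0 : 0 <= M by rewrite /M sumr_ge0.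
have Mb h : `|\sum_(i <- s) c i h *: e i| <= M * `|h|.
  rewrite /M mulr_suml (le_trans (ler_norm_sum _ _ _))//.
  by apply: ler_sum => i _; rewrite normrZ mulrC ler_wpM2l.
have dM : 0 < d / (M + 1) by rewrite divr_gt0// ltr_wpDl.
near=> h.
rewrite !big_cons.
have hd : `|h| < d by near: h; exact: nbhs0_lt.
have hM : `|h| < d / (M + 1) by near: h; exact: nbhs0_lt.
have yd : `|\sum_(i <- s) c i h *: e i| < d.
  rewrite (le_lt_trans (Mb h))//.
  rewrite ltr_pdivlMr ?ltr_wpDl// in hM; rewrite (le_lt_trans _ hM)//.
  by rewrite mulrC ler_wpM2l// lerDl.
have := dP _ (c a h) yd (le_lt_trans (cb _ _) hd).
have IHh : `|g (x + \sum_(i <- s) c i h *: e i) - g x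
   - \sum_(i <- s) c i h * 'D_(e i) g x| <= eps / 2 * `|h|.
  by near: h; exact: IH.
rewrite [_ *: _ + _]addrC addrA => H.
rewrite [eps]splitr mulrDl.
have H' := le_trans H (ler_wpM2l (ltW eps2) (cb a h)).
apply: le_trans (lerD H' IHh); apply: le_trans (ler_normD _ _).
by rewrite le_eqVlt; apply/orP; left; apply/eqP; congr `|_|; ring.
Unshelve. all: by end_near. Qed.

(** Continuous partial derivatives give Frechet differentiability.  The
    conditions on c say that the c i are the coordinates in the basis e. *)
Lemma C1_differentiable V (I : finType) (e : I -> V) (c : I -> {linear V -> R^o})
    (g : V -> R) x :
  (forall i h, `|c i h| <= `|h|) -> (forall h, h = \sum_i c i h *: e i) ->
  (forall i, \forall y \near x, derivable g y (e i)) ->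
  (forall i, {for x, continuous (fun y => 'D_(e i) g y)}) ->
  differentiable g x.
Proof.
move=> cb ce dg cg.
pose D (h : V) : R^o := \sum_i c i h * 'D_(e i) g x.
have lin : linear D.
  move=> a u v; rewrite /D scaler_sumr -big_split/=; apply: eq_bigr => i _.
  by rewrite linearP/= mulrDl /GRing.scale/= mulrA.
pose LM := GRing.isLinear.Build _ _ _ _ _ lin.
pose L : {linear V -> R^o} := HB.pack D LM.
have cL : continuous L.
  move=> y; apply/cvgrPdist_le => eps eps0.
  pose M := \sum_i `|'D_(e i) g x|.
  have M0 : 0 <= M by rewrite /M sumr_ge0.
  near=> z.
  rewrite -linearB; apply: (@le_trans _ _ (M * `|y - z|)).
    rewrite /L /= /D /M mulr_suml (le_trans (ler_norm_sum _ _ _))//.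
    by apply: ler_sum => i _; rewrite normrM mulrC ler_wpM2l.
  have : `|y - z| <= eps / (M + 1).
    by near: z; apply: cvgr_dist_le => //; rewrite divr_gt0// ltr_wpDl.
  rewrite ler_pdivlMr ?ltr_wpDl// => /(le_trans _); apply.
  by rewrite mulrC ler_wpM2l// lerDl.
have o : g \o shift x = cst (g x) + L +o_ (0 : V) id.
  apply/eqaddoP => eps eps0.
  have := @C1_increment V I e c g x (index_enum I) cb dg cg eps eps0.
  apply: filter_app; near=> h.
  by rewrite /= /cst !fctE /= -(ce h) opprD addrA [h + x]addrC.
by apply/diff_locallyP; rewrite (diff_unique cL o); split.
Unshelve. all: by end_near. Qed.

Lemma is_derive_translate V W (g : V -> W) c y u :
  derivable g (y + c) u -> is_derive y u (fun z => g (z + c)) ('D_u g (y + c)).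
Proof.
move=> dg.
have E : (fun h : R => h^-1 *: (((fun z => g (z + c)) \o shift y) (h *: u) - g (y + c))) =
         (fun h : R => h^-1 *: ((g \o shift (y + c)) (h *: u) - g (y + c))).
  by apply/funext => h /=; rewrite addrA.
by apply: DeriveDef; rewrite /derivable /derive E.
Qed.

(** The function y |-> g (y + s v) - g y has mean value points along u, and its
    derivative D_u has mean value points along v. *)
Lemma second_difference V (g : V -> R) x u v (r s : R) :
  (forall y, `|y - x| < r -> derivable g y u) ->
  (forall y, `|y - x| < r -> derivable (fun z => 'D_u g z) y v) ->
  `|s| * (`|u| + `|v|) < r ->
  exists2 z, `|z - x| <= `|s| * (`|u| + `|v|) &
    g (x + s *: u + s *: v) - g (x + s *: u) - (g (x + s *: v) - g x)
    = s ^+ 2 * 'D_v (fun z => 'D_u g z) z.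
Proof.
move=> du dvu sr.
have B (t t' : R) : 0 <= t <= 1 -> 0 <= t' <= 1 ->
    `|x + t *: (s *: u) + t' *: (s *: v) - x| <= `|s| * (`|u| + `|v|).
  move=> /andP[t0 t1] /andP[t'0 t'1].
  rewrite -(addrA x) [x + _]addrC addrK (le_trans (ler_normD _ _))// mulrDr.
  rewrite !normrZ (ger0_norm t0) (ger0_norm t'0).
  by rewrite lerD// ler_piMl// mulr_ge0.
pose phi z := g (z + s *: v) - g z.
have dphi (t : R) : 0 <= t <= 1 -> is_derive (x + t *: (s *: u)) u phi
    ('D_u g (x + t *: (s *: u) + s *: v) - 'D_u g (x + t *: (s *: u))).
  move=> t01; apply: is_deriveB.
    apply: is_derive_translate; apply: du; apply: le_lt_trans sr.
    by have := B t 1 t01; rewrite scale1r; apply; rewrite ler01 lexx.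
  apply: derivableP; apply: du; apply: le_lt_trans sr.
  by have := B t 0 t01; rewrite scale0r addr0; apply; rewrite ler01 lexx.
have [|t t01 tE] := @mean_value _ phi x (s *: u).
  move=> t t01; case: (dphi t t01) => h _.
  by case: (deriveZdir s h).
have [|t' t'01 t'E] := @mean_value _ (fun z => 'D_u g z) (x + t *: (s *: u)) (s *: v).
  move=> t' t'01; have h : derivable (fun z => 'D_u g z)
     (x + t *: (s *: u) + t' *: (s *: v)) v.
    by apply: dvu; apply: le_lt_trans sr; exact: B.
  by case: (deriveZdir s h).
exists (x + t *: (s *: u) + t' *: (s *: v)); first exact: B.
rewrite -/(phi (x + s *: u)) opprB addrC.
rewrite [LHS](_ : _ = phi (x + s *: u) - phi x); last by rewrite /phi; ring.
rewrite tE; case: (dphi t t01) => h hE.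
rewrite (@derive_val _ _ _ _ _ _ _ (deriveZdir s h)) hE t'E.
have h' : derivable (fun z => 'D_u g z) (x + t *: (s *: u) + t' *: (s *: v)) v.
  by apply: dvu; apply: le_lt_trans sr; exact: B.
by rewrite (@derive_val _ _ _ _ _ _ _ (deriveZdir s h')) /GRing.scale/= mulrA expr2.
Qed.

(** Schwarz: the second difference of g over a small parallelogram is symmetric in
    u and v, and equals either mixed derivative at a nearby point. *)
Lemma mixed_derivatives_commute V (g : V -> R) x u v :
  (\forall y \near x, [/\ derivable g y u, derivable g y v,
     derivable (fun z => 'D_u g z) y v & derivable (fun z => 'D_v g z) y u]) ->
  {for x, continuous (fun y => 'D_v (fun z => 'D_u g z) y)} ->
  {for x, continuous (fun y => 'D_u (fun z => 'D_v g z) y)} ->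
  'D_v (fun z => 'D_u g z) x = 'D_u (fun z => 'D_v g z) x.
Proof.
move=> dg c1 c2; apply/eqP; rewrite -subr_eq0 -normr_le0.
apply/ler_addgt0Pr => eps eps0; rewrite add0r.
have /nbhs_ballP[r /= r0 rP] : \forall y \near x, [/\ derivable g y u, derivable g y v,
     derivable (fun z => 'D_u g z) y v & derivable (fun z => 'D_v g z) y u] /\
   `|'D_v (fun z => 'D_u g z) x - 'D_v (fun z => 'D_u g z) y| <= eps / 2 /\
   `|'D_u (fun z => 'D_v g z) x - 'D_u (fun z => 'D_v g z) y| <= eps / 2.
  have eps2 : 0 < eps / 2 by rewrite divr_gt0.
  move/cvgrPdist_le : c1 => /(_ _ eps2) c1; move/cvgrPdist_le : c2 => /(_ _ eps2) c2.
  exact: filterI dg (filterI c1 c2).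
have {}rP y : `|y - x| < r -> [/\ derivable g y u, derivable g y v,
     derivable (fun z => 'D_u g z) y v & derivable (fun z => 'D_v g z) y u] /\
   `|'D_v (fun z => 'D_u g z) x - 'D_v (fun z => 'D_u g z) y| <= eps / 2 /\
   `|'D_u (fun z => 'D_v g z) x - 'D_u (fun z => 'D_v g z) y| <= eps / 2.
  by move=> yr; apply: rP; rewrite -ball_normE /ball_/= distrC.
pose M := `|u| + `|v|.
have M0 : 0 <= M by rewrite addr_ge0.
pose s := r / (M + 1).
have s0 : 0 < s by rewrite divr_gt0// ltr_wpDl.
have sr : `|s| * M < r.
  by rewrite gtr0_norm// /s mulrAC ltr_pdivrMr ?ltr_wpDl// ltr_pM2l// ltrDl.
have [||//|z1 z1B z1E] := @second_difference V g x u v r s.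
- by move=> y /rP [[]].
- by move=> y /rP [[]].
have [|||z2 z2B z2E] := @second_difference V g x v u r s.
- by move=> y /rP [[]].
- by move=> y /rP [[]].
- by rewrite [`|v| + _]addrC.
rewrite [`|v| + _]addrC in z2B.
have E : 'D_v (fun z => 'D_u g z) z1 = 'D_u (fun z => 'D_v g z) z2.
  have s2 : s ^+ 2 != 0 by rewrite expf_neq0// gt_eqF.
  apply: (mulfI s2); apply: etrans (esym z1E) (etrans _ z2E).
  by rewrite [x + s *: v + _]addrAC; ring.
have [_ [b1 _]] := rP _ (le_lt_trans z1B sr).
have [_ [_ b2]] := rP _ (le_lt_trans z2B sr).
rewrite (splitr eps); apply: le_trans (lerD b1 b2).
rewrite [X in _ <= _ + X]distrC -E; apply: le_trans (ler_normD _ _).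
by rewrite addrA subrK.
Qed.

Lemma mx_norm_coord m n (v : 'M[R]_(m, n)) i j : `|v i j| <= `|v|.
Proof.
by rewrite [leRHS]/Num.Def.normr/= mx_normrE; exact: (le_bigmax _ _ (i, j)).
Qed.

Lemma mx_norm_le m n (v : 'M[R]_(m, n)) (C : R) :
  0 <= C -> (forall i j, `|v i j| <= C) -> `|v| <= C.
Proof.
by move=> C0 vC; rewrite /Num.Def.normr/= mx_normrE bigmax_le// => -[i j] _.
Qed.

Definition row2 (s t : R) : 'rV[R]_2 := \row_(j < 2) [:: s; t]`_j.

Lemma row2E (v : 'rV[R]_2) : v = row2 (v 0 0) (v 0 1).
Proof.
apply/rowP => j; rewrite mxE.
by case: j => -[|[|//]] i /=; congr (v _ _); apply/val_inj.
Qed.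

Lemma row2_basis s t : row2 s t = s *: row2 1 0 + t *: row2 0 1.
Proof.
apply/rowP => j; rewrite !mxE.
by case: j => -[|[|//]] i /=; rewrite !(mulr0, mulr1, addr0, add0r).
Qed.

Definition plane_form (A : 'rV[R]_2 -> R) :=
  forall s t, A (row2 s t) = s * A (row2 1 0) + t * A (row2 0 1).

Lemma row2_eq0 s t : row2 s t = 0 -> s = 0 /\ t = 0.
Proof.
by move=> /rowP e; split; [have := e 0|have := e 1]; rewrite !mxE.
Qed.

Lemma plane_det_neq0 (A B : 'rV[R]_2 -> R) :
  plane_form A -> plane_form B ->
  (forall v, A v = 0 -> B v = 0 -> v = 0) ->
  A (row2 1 0) * B (row2 0 1) - A (row2 0 1) * B (row2 1 0) != 0.
Proof.
move=> lA lB inj; apply/negP => /eqP d0.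
have [] := row2_eq0 (inj (row2 (A (row2 0 1)) (- A (row2 1 0))) _ _).
- by rewrite lA; ring.
- by rewrite lB; lra.
move=> A1 /eqP; rewrite oppr_eq0 => /eqP A0.
have [] := row2_eq0 (inj (row2 (B (row2 0 1)) (- B (row2 1 0))) _ _).
- by rewrite lA A0 A1; ring.
- by rewrite lB; ring.
move=> B1 /eqP; rewrite oppr_eq0 => /eqP B0.
by have [/eqP] := row2_eq0 (inj (row2 1 0) A0 B0); rewrite oner_eq0.
Qed.

Lemma plane_inj_surj (A B : 'rV[R]_2 -> R) :
  plane_form A -> plane_form B ->
  (forall v, A v = 0 -> B v = 0 -> v = 0) ->
  forall s t, exists v, A v = s /\ B v = t.
Proof.
move=> lA lB /(plane_det_neq0 lA lB); set d := _ - _ => d0 s t.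
exists (row2 ((s * B (row2 0 1) - t * A (row2 0 1)) / d)
             ((t * A (row2 1 0) - s * B (row2 1 0)) / d)).
have cramer (a0 a1 b0 b1 : R) : a0 * b1 - a1 * b0 != 0 ->
    (s * b1 - t * a1) / (a0 * b1 - a1 * b0) * a0 +
    (t * a0 - s * b0) / (a0 * b1 - a1 * b0) * a1 = s /\
    (s * b1 - t * a1) / (a0 * b1 - a1 * b0) * b0 +
    (t * a0 - s * b0) / (a0 * b1 - a1 * b0) * b1 = t.
  by move=> dn0; split; field.
by rewrite [A (row2 (_ / _) _)]lA [B (row2 (_ / _) _)]lB; exact: cramer.
Qed.

Lemma plane_inj_bound (A B : 'rV[R]_2 -> R) :
  plane_form A -> plane_form B ->
  (forall v, A v = 0 -> B v = 0 -> v = 0) ->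
  exists2 K : R, 0 < K & forall v, `|v| <= K * (`|A v| + `|B v|).
Proof.
move=> lA lB /(plane_det_neq0 lA lB); set d := _ - _ => d0.
pose M : R := `|A (row2 1 0)| + `|A (row2 0 1)| + `|B (row2 1 0)| + `|B (row2 0 1)| + 1.
have M0 : 0 < M by rewrite ltr_wpDl// !addr_ge0.
have [a0 a1 b0 b1] : [/\ `|A (row2 1 0)| <= M, `|A (row2 0 1)| <= M,
    `|B (row2 1 0)| <= M & `|B (row2 0 1)| <= M].
  have := normr_ge0 (A (row2 1 0)); have := normr_ge0 (A (row2 0 1)).
  have := normr_ge0 (B (row2 1 0)); have := normr_ge0 (B (row2 0 1)).
  by rewrite /M; split; lra.
have d_gt0 : 0 < `|d| by rewrite normr_gt0.
exists (M / `|d|) => [|v]; first by rewrite divr_gt0.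
rewrite mulrAC; apply: mx_norm_le => [|i j].
  by rewrite divr_ge0 ?mulr_ge0 ?addr_ge0// ltW.
rewrite ler_pdivlMr// -normrM (ord1 i).
have [-> | ->] : j = 0 \/ j = 1.
  by case: j => -[|[|//]] k; [left|right]; apply/val_inj.
- rewrite [_ * d](_ : _ = B (row2 0 1) * A v - A (row2 0 1) * B v); last first.
    by rewrite {2 3}[v]row2E [A (row2 (v _ _) _)]lA [B (row2 (v _ _) _)]lB /d; ring.
  by rewrite (le_trans (ler_normB _ _))// mulrDr !normrM lerD// ler_wpM2r.
- rewrite [_ * d](_ : _ = A (row2 1 0) * B v - B (row2 1 0) * A v); last first.
    by rewrite {2 3}[v]row2E [A (row2 (v _ _) _)]lA [B (row2 (v _ _) _)]lB /d; ring.
  by rewrite (le_trans (ler_normB _ _))// mulrDr addrC !normrM lerD// ler_wpM2r.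
Qed.

Lemma sum_sqr_ge (A B d : R) : 0 <= d -> 2 * d <= A + B ->
  2 * d ^+ 2 <= A ^+ 2 + B ^+ 2.
Proof.
move=> d0 dAB; have : (2 * d) ^+ 2 <= (A + B) ^+ 2.
  by rewrite ler_pXn2r ?nnegrE ?(le_trans _ dAB) ?mulr_ge0.
have := sqr_ge0 (A - B); rewrite !expr2; lra.
Qed.

Lemma sum_sqr_lt (A B d : R) : 0 <= A -> 0 <= B -> A < d -> B < d ->
  A ^+ 2 + B ^+ 2 < 2 * d ^+ 2.
Proof.
move=> A0 B0 Ad Bd; rewrite mulr_natl mulr2n ltrD// ltr_pXn2r ?nnegrE//.
  exact: le_trans (ltW Ad).
exact: le_trans (ltW Bd).
Qed.

Lemma diff_plane_form (a : 'rV[R]_2 -> R) x :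
  differentiable a x -> plane_form (fun v => 'D_v a x).
Proof.
move=> da s t; rewrite !deriveE// row2_basis linearD !linearZ/=.
by [].
Qed.

(** Local surjectivity of (a, b), from first derivatives without an inverse
    function theorem: for (s, t) near (a x, b x) the minimum of
    (a - s)^2 + (b - t)^2 over a small closed disc is interior, and at an interior
    critical point the invertibility of (D a, D b) forces the value 0. *)
Lemma open_image (a b : 'rV[R]_2 -> R) (U : set 'rV[R]_2) x :
  open U -> U x ->
  (forall y, U y -> differentiable a y /\ differentiable b y) ->
  (forall y, U y -> forall v, 'D_v a y = 0 -> 'D_v b y = 0 -> v = 0) ->
  exists2 e : R, 0 < e & forall s t, `|s - a x| < e -> `|t - b x| < e ->
    exists y, [/\ U y, a y = s & b y = t].
Proof.
move=> oU Ux dU inj.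
have [da db] := dU _ Ux.
have [K K0 KP] := plane_inj_bound (diff_plane_form da) (diff_plane_form db) (inj _ Ux).
(* The factor 4 leaves room for both linearization errors, for e on each side,
   and for the reciprocal of K in the lower bound on the sphere. *)
pose c : R := (4 * K)^-1.
have c0 : 0 < c by rewrite invr_gt0 mulr_gt0.
have incr (g : 'rV[R]_2 -> R) : differentiable g x ->
    \forall h \near (0 : 'rV[R]_2), `|g (x + h) - g x - 'D_h g x| <= c * `|h|.
  move=> dg; have /diff_locally/eqaddoP/(_ c c0) := dg.
  apply: filter_app; near=> h; rewrite /= /cst !fctE/= deriveE//.
  by rewrite opprD addrA [h + x]addrC.
have /nbhs_ballP[r0 /= r00 r0P] : nbhs x U by exact: open_nbhs_nbhs.
have : \forall h \near (0 : 'rV[R]_2), [/\ `|a (x + h) - a x - 'D_h a x| <= c * `|h|,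
    `|b (x + h) - b x - 'D_h b x| <= c * `|h| & U (x + h)].
  have small : \forall h \near (0 : 'rV[R]_2), U (x + h).
    apply/nbhs_ballP; exists r0 => //= h; rewrite -ball_normE /ball_/= sub0r normrN => hr.
    by apply: r0P; rewrite -ball_normE /ball_/= opprD addrA subrr sub0r normrN.
  by have := incr _ db; have := incr _ da; move: small; apply: filterS3.
move=> /nbhs_ballP[r /= r_gt0 rP].
pose rho := r / 2; have rho0 : 0 < rho by rewrite divr_gt0.
have {}rP y : `|x - y| <= rho ->
    [/\ `|a y - a x - 'D_(y - x) a x| <= c * `|x - y|,
        `|b y - b x - 'D_(y - x) b x| <= c * `|x - y| & U y].
  move=> hr; have := rP (y - x); rewrite [x + (y - x)]addrC subrK (distrC y x).
  apply; rewrite -ball_normE /ball_/= sub0r normrN distrC (le_lt_trans hr)//.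
  by rewrite /rho ltr_pdivrMr// mulr_natr mulr2n ltrDl.
pose e := c * rho / 2; have e0 : 0 < e by rewrite divr_gt0// mulr_gt0.
exists e => // s t se te.
pose A1 : 'rV[R]_2 -> R := a - cst s.
pose B1 : 'rV[R]_2 -> R := b - cst t.
pose q : 'rV[R]_2 -> R := A1 * A1 + B1 * B1.
pose D := closed_ball_ (fun z : 'rV[R]_2 => `|z|) x rho.
have DU y : D y -> U y.
  by move=> /rP[].
have dq y : U y -> differentiable q y.
  move=> /dU[dya dyb]; rewrite /q.
  by apply: differentiableD; apply: differentiableM; apply: differentiableB.
have cD : compact D.
  apply: bounded_closed_compact; last exact: closed_closed_ball_.
  exists (`|x| + rho); split; first exact: num_real.
  move=> M HM y Dy /=; apply: le_trans (ltW HM).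
  by rewrite -[y](subKr x) (le_trans (ler_normB _ _))// lerD2l.
have [y0 y0D y0min] : exists2 y0, y0 \in D & forall y, y \in D -> q y0 <= q y.
  apply: EVT_min_rV => //; first by exists x; rewrite /D /closed_ball_/= subrr normr0 ltW.
  apply: continuous_in_subspaceT => y; rewrite inE => /DU/dq.
  exact: differentiable_continuous.
rewrite inE in y0D.
have qE y : q y = (a y - s) ^+ 2 + (b y - t) ^+ 2 by rewrite /q !expr2.
have sphere y : `|x - y| = rho -> 2 * e ^+ 2 <= q y.
  move=> yr; have := rP y; rewrite yr lexx.
  move=> /(_ isT)[ha hb _].
  have hK := KP (y - x); rewrite distrC yr in hK.
  have hK' : 4 * c * rho <= `|'D_(y - x) a x| + `|'D_(y - x) b x|.
    have cK : 4 * c * K = 1 by rewrite /c; field; rewrite gt_eqF.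
    have c4 : 0 <= 4 * c by rewrite mulr_ge0// ltW.
    by have := ler_wpM2l c4 hK; rewrite [X in _ <= X]mulrA cK mul1r.
  have h1 : `|'D_(y - x) a x| <= `|a y - s| + e + c * rho.
    have -> : 'D_(y - x) a x = (a y - s) + (s - a x) - (a y - a x - 'D_(y - x) a x) by ring.
    rewrite (le_trans (ler_normB _ _))// lerD// (le_trans (ler_normD _ _))// lerD//.
    exact: ltW.
  have h2 : `|'D_(y - x) b x| <= `|b y - t| + e + c * rho.
    have -> : 'D_(y - x) b x = (b y - t) + (t - b x) - (b y - b x - 'D_(y - x) b x) by ring.
    rewrite (le_trans (ler_normB _ _))// lerD// (le_trans (ler_normD _ _))// lerD//.
    exact: ltW.
  have h3 : 2 * e <= `|a y - s| + `|b y - t| by move: hK' h1 h2; rewrite /e; lra.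
  rewrite qE -(real_normK (num_real (a y - s))) -(real_normK (num_real (b y - t))).
  exact: sum_sqr_ge (ltW e0) h3.
have qx : q x < 2 * e ^+ 2.
  rewrite qE -(real_normK (num_real (a x - s))) -(real_normK (num_real (b x - t))).
  by apply: sum_sqr_lt; rewrite // distrC.
have qy0 : q y0 <= q x.
  by apply: y0min; rewrite inE /D /closed_ball_/= subrr normr0 ltW.
have y0r : `|x - y0| < rho.
  rewrite lt_neqAle; apply/andP; split => //; apply/eqP => /sphere.
  by move=> h; have := le_lt_trans (le_trans h qy0) qx; rewrite ltxx.
have y0U := DU _ y0D.
have [da0 db0] := dU _ y0U.
have crit v : 'D_v q y0 = 0.
  pose d := (rho - `|x - y0|) / (`|v| + 1).
  have d0 : 0 < d by rewrite divr_gt0 ?subr_gt0// ltr_wpDl.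
  have inD (tt : R) : tt \in `]-d, d[ -> D (y0 + tt *: v).
    rewrite in_itv/= -ltr_norml => ttd.
    rewrite /D /closed_ball_/=.
    rewrite opprD addrA (le_trans (ler_normB _ _))// -lerBrDl normrZ.
    have v1 : 0 < `|v| + 1 by rewrite ltr_wpDl.
    have ttd' : `|tt| * (`|v| + 1) < rho - `|x - y0| by rewrite -ltr_pdivlMr.
    by rewrite (le_trans _ (ltW ttd'))// ler_wpM2l// lerDl.
  have := @derive1_at_min R (fun tt : R => q (y0 + tt *: v)) (-d) d 0.
  have dl (tt : R) : tt \in `]-d, d[ -> is_derive tt 1 (fun tt : R => q (y0 + tt *: v))
      ('D_v q (y0 + tt *: v)).
    by move=> /inD/DU/dq/diff_derivable h; apply: is_derive_line.
  have z0 : 0 \in `]-d, d[ by rewrite in_itv/= oppr_lt0 d0.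
  move=> /(_ _ _ z0) [|||_].
  - by rewrite ge0_cp// ltW.
  - by move=> tt /dl[].
  - by move=> tt /inD h; rewrite scale0r addr0; apply: y0min; rewrite inE.
  by case: (dl _ z0) => _ ->; rewrite scale0r addr0.
have [v [va vb]] := plane_inj_surj (diff_plane_form da0) (diff_plane_form db0)
   (inj _ y0U) (a y0 - s) (b y0 - t).
have := crit v; have iA (f : 'rV[R]_2 -> R) k : differentiable f y0 ->
    is_derive y0 v (f - cst k) ('D_v f y0).
  move=> df; rewrite -[X in is_derive _ _ _ X]subr0; apply: is_deriveB.
  by apply: derivableP; exact: diff_derivable.
have dA := iA a s da0; have dB := iA b t db0.
have dqE : is_derive y0 v q _ := is_deriveD (is_deriveM dA dA) (is_deriveM dB dB).
rewrite (@derive_val _ _ _ _ _ _ _ dqE) va vb /A1 /B1 /GRing.scale/= -!expr2.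
rewrite -[(a - cst s) y0]/(a y0 - s) -[(b - cst t) y0]/(b y0 - t) => S.
have a2 := sqr_ge0 (a y0 - s); have b2 := sqr_ge0 (b y0 - t).
by exists y0; split => //; apply/eqP; rewrite -subr_eq0 -sqrf_eq0; apply/eqP; lra.
Unshelve. all: by end_near. Qed.

End DirectionalDerivatives.

(** * The Minkowski form and the Lorentzian cross product *)

Section MinkowskiAlgebra.
Context {R : realType}.
Implicit Types (a b c d x v e f : 'rV[R]_3).

Lemma row3P a b : a 0 0 = b 0 0 -> a 0 1 = b 0 1 -> a 0 2%:R = b 0 2%:R -> a = b.
Proof.
move=> h0 h1 h2; apply/rowP => -[[|[|[|//]]] i].
- by rewrite (_ : Ordinal i = 0)//; apply/val_inj.
- by rewrite (_ : Ordinal i = 1)//; apply/val_inj.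
- by rewrite (_ : Ordinal i = 2%:R)//; apply/val_inj.
Qed.

Lemma lcross0 a b : lcross a b 0 0 = a 0 2%:R * b 0 1 - a 0 1 * b 0 2%:R.
Proof. by rewrite mxE. Qed.
Lemma lcross1 a b : lcross a b 0 1 = a 0 2%:R * b 0 0 - a 0 0 * b 0 2%:R.
Proof. by rewrite mxE. Qed.
Lemma lcross2 a b : lcross a b 0 2%:R = a 0 0 * b 0 1 - a 0 1 * b 0 0.
Proof. by rewrite mxE. Qed.
Definition lcrossE := (lcross0, lcross1, lcross2).

Lemma minkC a b : mink a b = mink b a.
Proof. by rewrite /mink; ring. Qed.

Lemma minkDl a b c : mink (a + b) c = mink a c + mink b c.
Proof. by rewrite /mink !mxE; ring. Qed.

Lemma minkZl (k : R) a b : mink (k *: a) b = k * mink a b.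
Proof. by rewrite /mink !mxE; ring. Qed.

Lemma minkNl a b : mink (- a) b = - mink a b.
Proof. by rewrite /mink !mxE; ring. Qed.

Lemma minkDr a b c : mink c (a + b) = mink c a + mink c b.
Proof. by rewrite /mink !mxE; ring. Qed.

Lemma minkZr (k : R) a b : mink b (k *: a) = k * mink b a.
Proof. by rewrite /mink !mxE; ring. Qed.

Lemma minkNr a b : mink b (- a) = - mink b a.
Proof. by rewrite /mink !mxE; ring. Qed.

Lemma mink0l a : mink 0 a = 0.
Proof. by rewrite /mink !mxE; ring. Qed.

Lemma mink0r a : mink a 0 = 0.
Proof. by rewrite /mink !mxE; ring. Qed.

Definition minkE := (minkDl, minkZl, minkNl, minkDr, minkZr, minkNr, mink0l, mink0r).

Lemma lcrossDl a b c : lcross (a + b) c = lcross a c + lcross b c.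
Proof. by apply: row3P; rewrite !(mxE, lcrossE) /=; ring. Qed.

Lemma lcrossDr a b c : lcross c (a + b) = lcross c a + lcross c b.
Proof. by apply: row3P; rewrite !(mxE, lcrossE) /=; ring. Qed.

Lemma lcrossZl (k : R) a b : lcross (k *: a) b = k *: lcross a b.
Proof. by apply: row3P; rewrite !(mxE, lcrossE) /=; ring. Qed.

Lemma lcrossZr (k : R) a b : lcross a (k *: b) = k *: lcross a b.
Proof. by apply: row3P; rewrite !(mxE, lcrossE) /=; ring. Qed.

Lemma lcrossC a b : lcross a b = - lcross b a.
Proof. by apply: row3P; rewrite !(mxE, lcrossE) /=; ring. Qed.

Lemma lcrossvv a : lcross a a = 0.
Proof. by apply: row3P; rewrite !(mxE, lcrossE) /=; ring. Qed.

Lemma mink_lcrossl a b : mink a (lcross a b) = 0.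
Proof. by rewrite /mink !lcrossE; ring. Qed.

Lemma mink_lcrossr a b : mink b (lcross a b) = 0.
Proof. by rewrite /mink !lcrossE; ring. Qed.

Lemma mink_lcross_rot a b c : mink a (lcross b c) = mink b (lcross c a).
Proof. by rewrite /mink !lcrossE; ring. Qed.

Lemma mink_lcross_lcross a b c d :
  mink (lcross a b) (lcross c d) = mink a d * mink b c - mink a c * mink b d.
Proof. by rewrite /mink !lcrossE; ring. Qed.

Lemma lcross_lcross a b c :
  lcross a (lcross b c) = mink a b *: c - mink a c *: b.
Proof. by apply: row3P; rewrite !(mxE, lcrossE) /= /mink; ring. Qed.

(** The vectors x, e and x * e are orthogonal, with squares -1, <e,e> and <e,e>;
    multiplying by <e,e> avoids any division. *)
Lemma frame_decomposition x e v : mink x x = -1 -> mink x e = 0 ->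
  mink e e *: v = mink e v *: e + mink (lcross x e) v *: lcross x e
                  - (mink e e * mink x v) *: x.
Proof.
move=> xx xe; set G := lcross x e.
have GG : mink G G = mink e e by rewrite mink_lcross_lcross xx xe; ring.
have Gx : lcross G x = e.
  by rewrite lcrossC lcross_lcross xx xe scale0r scaleN1r subr0 opprK.
have Ge : lcross G e = mink e e *: x.
  by rewrite lcrossC lcross_lcross (minkC e x) xe scale0r sub0r opprK.
have Gv : lcross G v = mink e v *: x - mink x v *: e.
  by rewrite lcrossC lcross_lcross opprB (minkC v x) (minkC v e).
have := lcross_lcross G G v.
rewrite Gv lcrossDr -scaleNr !lcrossZr Gx Ge GG => /eqP.
rewrite eq_sym subr_eq => /eqP ->.
by rewrite scalerA mulNr scaleNr [_ * mink e e]mulrC addrAC.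
Qed.

Lemma hyp_self x : hyp (-1) x -> mink x x = -1.
Proof. by move=> [-> _]; rewrite invrN invr1. Qed.

(** The induced metric is Riemannian: after clearing the factor x_0^2, the square of
    a tangent vector is a sum of three squares. *)
Lemma hyp_tangent_pos x v : hyp (-1) x -> mink x v = 0 ->
  0 <= mink v v /\ (mink v v = 0 -> v = 0).
Proof.
move=> hx xv; have xx := hyp_self hx; case: hx => _ x0.
have E : x 0 0 ^+ 2 * mink v v =
    v 0 1 ^+ 2 + v 0 2%:R ^+ 2 + (x 0 1 * v 0 2%:R - x 0 2%:R * v 0 1) ^+ 2.
  have e1 : x 0 0 * v 0 0 = x 0 1 * v 0 1 + x 0 2%:R * v 0 2%:R.
    by move: xv; rewrite /mink; lra.
  have e2 : x 0 0 ^+ 2 = 1 + x 0 1 ^+ 2 + x 0 2%:R ^+ 2.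
    by move: xx; rewrite /mink -!expr2; lra.
  rewrite [LHS](_ : _ = - (x 0 0 * v 0 0) ^+ 2 + x 0 0 ^+ 2 * (v 0 1 ^+ 2 + v 0 2%:R ^+ 2)).
    by rewrite e1 e2; ring.
  by rewrite /mink; ring.
have x2 : 0 < x 0 0 ^+ 2 by rewrite exprn_gt0.
split.
  rewrite -(pmulr_rge0 _ x2) E.
  by rewrite !addr_ge0// sqr_ge0.
move=> v0; move: E; rewrite v0 mulr0 => E.
have s1 := sqr_ge0 (v 0 1); have s2 := sqr_ge0 (v 0 2%:R).
have s3 := sqr_ge0 (x 0 1 * v 0 2%:R - x 0 2%:R * v 0 1).
have v1 : v 0 1 = 0 by apply/eqP; rewrite -sqrf_eq0; apply/eqP; lra.
have v2 : v 0 2%:R = 0 by apply/eqP; rewrite -sqrf_eq0; apply/eqP; lra.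
apply: row3P; rewrite !mxE//.
move: xv; rewrite /mink v1 v2 !mulr0 !addr0 => /eqP.
by rewrite oppr_eq0 mulf_eq0 gt_eqF//= => /eqP.
Qed.

Lemma hyp_tangent_gt0 x v : hyp (-1) x -> mink x v = 0 -> v != 0 -> 0 < mink v v.
Proof.
move=> hx xv v0; have [ge0 eq0] := hyp_tangent_pos hx xv.
by rewrite lt_neqAle ge0 eq_sym andbT; apply: contra v0 => /eqP/eq0/eqP.
Qed.

(** Reversed Cauchy-Schwarz for two future-pointing unit timelike vectors. *)
Lemma hyp_mink_neg x y : hyp (-1) x -> hyp (-1) y -> mink x y < 0.
Proof.
move=> hx hy; have xx := hyp_self hx; have yy := hyp_self hy.
case: hx hy => _ x0 [_ y0].
have ex : x 0 0 ^+ 2 = 1 + x 0 1 ^+ 2 + x 0 2%:R ^+ 2.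
  by move: xx; rewrite /mink -!expr2; lra.
have ey : y 0 0 ^+ 2 = 1 + y 0 1 ^+ 2 + y 0 2%:R ^+ 2.
  by move: yy; rewrite /mink -!expr2; lra.
have xy0 : 0 < x 0 0 * y 0 0 by rewrite mulr_gt0.
set c := x 0 1 * y 0 1 + x 0 2%:R * y 0 2%:R.
have c2 : c ^+ 2 < (x 0 0 * y 0 0) ^+ 2.
  rewrite exprMn ex ey /c.
  have := sqr_ge0 (x 0 1 * y 0 2%:R - x 0 2%:R * y 0 1).
  have := sqr_ge0 (x 0 1); have := sqr_ge0 (y 0 1).
  have := sqr_ge0 (x 0 2%:R); have := sqr_ge0 (y 0 2%:R).
  rewrite !expr2; lra.
have : c < x 0 0 * y 0 0.
  rewrite ltNge; apply/negP => h; move: c2.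
  by rewrite ltNge ler_pXn2r ?nnegrE ?h// ltW// (lt_le_trans xy0).
by rewrite /mink /c; lra.
Qed.

(** One negative product with a point of the upper sheet excludes the lower sheet. *)
Lemma hyp_of_mink_neg x v : hyp (-1) x -> mink v v = -1 -> mink x v < 0 ->
  hyp (-1) v.
Proof.
move=> hx vv xv; split; first by rewrite invrN invr1.
rewrite ltNge le_eqVlt; apply/negP => /orP[/eqP v0|v0].
  have := sqr_ge0 (v 0 1); have := sqr_ge0 (v 0 2%:R).
  by move: vv; rewrite /mink v0 mul0r oppr0 add0r -!expr2; lra.
have : hyp (-1) (- v).
  by split; [rewrite !minkE opprK invrN invr1|rewrite mxE oppr_gt0].
by move=> /(hyp_mink_neg hx); rewrite minkE; lra.
Qed.

End MinkowskiAlgebra.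

Section VectorCalculus.
Context {R : realType}.
Implicit Types (V : normedModType R).

Lemma is_derive_mul V (f g : V -> R) x v (df dg : R) :
  is_derive x v f df -> is_derive x v g dg ->
  is_derive x v (fun y => f y * g y) (df * g x + f x * dg).
Proof.
move=> hf hg; apply: is_derive_eq (is_deriveM hf hg) _.
by rewrite addrC /GRing.scale/= [g x * _]mulrC.
Qed.

Lemma is_derive_row V n (f : V -> 'rV[R]_n) x v (df : 'rV[R]_n) :
  (forall j, is_derive x v (fun y => f y 0 j) (df 0 j)) -> is_derive x v f df.
Proof.
move=> h.
have D : derivable f x v.
  by apply/derivable_mxP => i j; rewrite (ord1 i); case: (h j).
apply: DeriveDef => //; rewrite derive_mx//; apply/rowP => j.
by rewrite mxE; case: (h j).
Qed.

Lemma is_derive_mink V (f g : V -> 'rV[R]_3) x v df dg :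
  is_derive x v f df -> is_derive x v g dg ->
  is_derive x v (fun y => mink (f y) (g y)) (mink df (g x) + mink (f x) dg).
Proof.
move=> hf hg.
have m j : is_derive x v (fun y => f y 0 j * g y 0 j) (df 0 j * g x 0 j + f x 0 j * dg 0 j).
  by apply: is_derive_mul; exact: is_derive_coord.
apply: is_derive_eq (is_deriveD (is_deriveD (is_deriveN (m 0)) (m 1)) (m 2%:R)) _.
by rewrite /mink; ring.
Qed.

Lemma is_derive_lcross V (f g : V -> 'rV[R]_3) x v df dg :
  is_derive x v f df -> is_derive x v g dg ->
  is_derive x v (fun y => lcross (f y) (g y)) (lcross df (g x) + lcross (f x) dg).
Proof.
move=> hf hg.
have m i j : is_derive x v (fun y => f y 0 i * g y 0 j) (df 0 i * g x 0 j + f x 0 i * dg 0 j).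
  by apply: is_derive_mul; exact: is_derive_coord.
have m2 i j k l : is_derive x v (fun y => f y 0 i * g y 0 j - f y 0 k * g y 0 l)
   (df 0 i * g x 0 j + f x 0 i * dg 0 j - (df 0 k * g x 0 l + f x 0 k * dg 0 l)).
  exact: is_deriveB.
apply: is_derive_row => -[[|[|[|//]]] i].
- rewrite (_ : Ordinal i = 0); last exact/val_inj.
  rewrite (_ : (fun y => lcross (f y) (g y) 0 0) = fun y => f y 0 2%:R * g y 0 1 - f y 0 1 * g y 0 2%:R).
    by apply: is_derive_eq (m2 2%:R 1 1 2%:R) _; rewrite !mxE /=; ring.
  by apply/funext => y; rewrite lcross0.
- rewrite (_ : Ordinal i = 1); last exact/val_inj.
  rewrite (_ : (fun y => lcross (f y) (g y) 0 1) = fun y => f y 0 2%:R * g y 0 0 - f y 0 0 * g y 0 2%:R).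
    by apply: is_derive_eq (m2 2%:R 0 0 2%:R) _; rewrite !mxE /=; ring.
  by apply/funext => y; rewrite lcross1.
- rewrite (_ : Ordinal i = 2%:R); last exact/val_inj.
  rewrite (_ : (fun y => lcross (f y) (g y) 0 2%:R) = fun y => f y 0 0 * g y 0 1 - f y 0 1 * g y 0 0).
    by apply: is_derive_eq (m2 0 1 1 0) _; rewrite !mxE /=; ring.
  by apply/funext => y; rewrite lcross2.
Qed.

Lemma is_derive_scalev V n (s : V -> R) (g : V -> 'rV[R]_n) x v ds dg :
  is_derive x v s ds -> is_derive x v g dg ->
  is_derive x v (fun y => s y *: g y) (ds *: g x + s x *: dg).
Proof.
move=> hs hg; apply: is_derive_row => j.
rewrite (_ : (fun y => (s y *: g y) 0 j) = fun y => s y * g y 0 j).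
  rewrite !mxE; apply: is_derive_mul => //; exact: is_derive_coord.
by apply/funext => y; rewrite mxE.
Qed.

Lemma is_derive_inv V (f : V -> R) x v df : f x != 0 ->
  is_derive x v f df -> is_derive x v (fun y => (f y)^-1) (- df / f x ^+ 2).
Proof.
move=> fx hf; case: (hf) => h1 h2.
apply: DeriveDef; first exact: derivableV.
by rewrite deriveV// h2 /GRing.scale/= mulNr mulrC mulNr.
Qed.

End VectorCalculus.

(** * Smooth maps between normed spaces *)

Section SmoothFunctions.
Context {R : realType}.
Implicit Types (V W : normedModType R).

Lemma Ck_on_eq V W (U : set V) k (f g : V -> W) :
  open U -> (forall x, U x -> f x = g x) -> Ck_on U k f -> Ck_on U k g.
Proof.
move=> oU; elim: k f g => [|k IH] f g fg [cf df].
  split=> // x Ux; rewrite /prop_for /continuous_at -(fg _ Ux).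
  apply: cvg_trans (cf x Ux); apply: near_eq_cvg.
  have : nbhs x U by exact: open_nbhs_nbhs.
  by apply: filterS => y /fg ->.
have nfg x : U x -> \forall y \near x, f y = g y.
  move=> Ux; have : nbhs x U by exact: open_nbhs_nbhs.
  by apply: filterS => y /fg.
split=> [x Ux|v].
  rewrite /prop_for /continuous_at -(fg _ Ux).
  by apply: cvg_trans (cf x Ux); apply: near_eq_cvg; apply: filterS (nfg _ Ux).
have [d1 d2] := df v; split=> [x Ux|].
  exact: near_eq_derivable (nfg x Ux) (d1 x Ux).
apply: IH d2 => x Ux; exact: near_eq_derive (nfg x Ux).
Qed.

Lemma smooth_derive V W (U : set V) (f : V -> W) v :
  smooth_on U f -> smooth_on U (fun x => 'D_v f x).
Proof. by move=> sf k; have [_ /(_ v)[]] := sf k.+1. Qed.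

Lemma smooth_is_derive V W (U : set V) (f : V -> W) v x :
  smooth_on U f -> U x -> is_derive x v f ('D_v f x).
Proof. by move=> sf Ux; have [_ /(_ v)[h _]] := sf 1%N; exact/derivableP/h. Qed.

Lemma smooth_continuous V W (U : set V) (f : V -> W) x :
  smooth_on U f -> U x -> {for x, continuous f}.
Proof. by move=> sf Ux; have [h _] := sf 0%N; exact: h. Qed.

Lemma smooth_subset V W (U U' : set V) (f : V -> W) :
  U' `<=` U -> smooth_on U f -> smooth_on U' f.
Proof.
move=> sU sf k; have := sf k; elim: k f {sf} => [|k IH] f [cf df].
  by split=> // x /sU/cf.
by split=> [x /sU/cf//|v]; have [h1 h2] := df v; split=> [x /sU/h1//|]; exact: IH.
Qed.

Lemma smooth_linear V W W' (L : {linear W -> W'}) (U : set V) (f : V -> W) :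
  open U -> continuous L -> smooth_on U f -> smooth_on U (fun y => L (f y)).
Proof.
move=> oU cL sf k; have := sf k; elim: k f {sf} => [|k IH] f [cf df].
  split=> // x Ux; apply: continuous_comp; [exact: cf|exact: cL].
split=> [x Ux|v]; first by apply: continuous_comp; [exact: cf|exact: cL].
have [d1 d2] := df v.
have dL x : U x -> is_derive x v (fun y => L (f y)) (L ('D_v f x)).
  by move=> Ux; apply: is_derive_linear => //; exact/derivableP/d1.
split=> [x /dL[]//|].
by apply: Ck_on_eq (IH _ d2) => // x /dL[].
Qed.

Lemma smooth_fst V W W' (U : set V) (f : V -> W * W') :
  open U -> smooth_on U f -> smooth_on U (fun y => (f y).1).
Proof.
move=> oU sf; apply: (@smooth_linear _ _ _ (@fst W W')) => // -[a b].
exact: cvg_fst.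
Qed.

Lemma smooth_snd V W W' (U : set V) (f : V -> W * W') :
  open U -> smooth_on U f -> smooth_on U (fun y => (f y).2).
Proof.
move=> oU sf; apply: (@smooth_linear _ _ _ (@snd W W')) => // -[a b].
exact: cvg_snd.
Qed.

Definition mx_entry m n i j (M : 'M[R]_(m, n)) : R^o := M i j.

Lemma mx_entry_is_linear m n i j : linear (@mx_entry m n i j).
Proof. by move=> a M N; rewrite /mx_entry !mxE. Qed.

HB.instance Definition _ m n i j :=
  GRing.isLinear.Build R 'M[R]_(m, n) R^o *:%R (@mx_entry m n i j)
    (@mx_entry_is_linear m n i j).

Lemma smooth_coord V m n (U : set V) (f : V -> 'M[R]_(m, n)) i j :
  open U -> smooth_on U f -> smooth_on U (fun y => f y i j : R^o).
Proof.
move=> oU sf.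
exact: (@smooth_linear _ _ _ (@mx_entry m n i j) _ _ oU (@coord_continuous _ _ _ i j)).
Qed.

Lemma smooth_derive_comm V n (U : set V) (f : V -> 'rV[R]_n) x u v :
  open U -> smooth_on U f -> U x ->
  'D_v (fun y => 'D_u f y) x = 'D_u (fun y => 'D_v f y) x.
Proof.
move=> oU sf Ux; apply/rowP => j.
have nU : \forall y \near x, U y by exact: open_nbhs_nbhs.
pose g : V -> R := fun y => f y 0 j.
have sg : smooth_on U (g : V -> R^o) by exact: smooth_coord.
have E a b : ('D_a (fun y => 'D_b f y) x) 0 j = 'D_a (fun y => 'D_b g y) x.
  have h := is_derive_coord 0 j (smooth_is_derive a (smooth_derive b sf) Ux).
  case: h => _ <-; apply: near_eq_derive; apply: filterS nU => y Uy.
  by case: (is_derive_coord 0 j (smooth_is_derive b sf Uy)).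
apply: (etrans (E v u)); apply: esym; apply: (etrans (E u v)); apply: esym.
apply: (@mixed_derivatives_commute R V g x u v).
- apply: filterS nU => y Uy; split.
  + by case: (smooth_is_derive u sg Uy).
  + by case: (smooth_is_derive v sg Uy).
  + by case: (smooth_is_derive v (smooth_derive u sg) Uy).
  + by case: (smooth_is_derive u (smooth_derive v sg) Uy).
- exact: (smooth_continuous (smooth_derive v (smooth_derive u sg)) Ux).
- exact: (smooth_continuous (smooth_derive u (smooth_derive v sg)) Ux).
Qed.

Lemma smooth_differentiable V (I : finType) (e : I -> V) (c : I -> {linear V -> R^o})
    (U : set V) (g : V -> R^o) x :
  (forall i h, `|c i h| <= `|h|) -> (forall h, h = \sum_i c i h *: e i) ->
  open U -> smooth_on U g -> U x -> differentiable g x.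
Proof.
move=> cb ce oU sg Ux.
have nU : \forall y \near x, U y by exact: open_nbhs_nbhs.
apply: (@C1_differentiable _ _ I e c g x cb ce) => i.
  by apply: filterS nU => y Uy; case: (smooth_is_derive (e i) sg Uy).
exact: (smooth_continuous (smooth_derive (e i) sg) Ux).
Qed.

Lemma smooth_differentiable_rV n (U : set 'rV[R]_n) (g : 'rV[R]_n -> R^o) x :
  open U -> smooth_on U g -> U x -> differentiable g x.
Proof.
apply: (@smooth_differentiable _ _ (fun i : 'I_n => delta_mx 0 i) (fun i => @mx_entry 1 n 0 i)).
  by move=> i h; exact: mx_norm_coord.
by move=> h; rewrite [LHS]row_sum_delta.
Qed.

Notation E := ('rV[R]_3 * 'rV[R]_3)%type.

Definition pair_entry (i : bool * 'I_3) (p : E) : R^o :=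
  if i.1 then p.1 0 i.2 else p.2 0 i.2.

Lemma pair_entry_is_linear i : linear (@pair_entry i).
Proof. by move=> a M N; rewrite /pair_entry; case: ifP => _; rewrite !mxE. Qed.

HB.instance Definition _ i :=
  GRing.isLinear.Build R E R^o *:%R (@pair_entry i) (@pair_entry_is_linear i).

Definition pair_basis (i : bool * 'I_3) : E :=
  if i.1 then (delta_mx 0 i.2, 0) else (0, delta_mx 0 i.2).

Lemma pair_entry_sum (h : E) : h = \sum_i pair_entry i h *: pair_basis i.
Proof.
case: h => h1 h2; rewrite -(pair_bigA _ (fun b i =>
   pair_entry (b, i) (h1, h2) *: pair_basis (b, i)))/= big_bool/= /pair_basis/=.
have s1 : \sum_(j < 3) pair_entry (true, j) (h1, h2) *: (('e_j, 0) : E) = (h1, 0).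
  rewrite {2}[h1]row_sum_delta.
  apply: (big_ind2 (fun (a : E) b => a = (b, 0))) => // [a b a' b' -> ->|i _].
    by rewrite -[LHS]/(_, _)/= addr0.
  by rewrite -[LHS]/(_, _)/= scaler0.
have s2 : \sum_(j < 3) pair_entry (false, j) (h1, h2) *: ((0, 'e_j) : E) = (0, h2).
  rewrite {2}[h2]row_sum_delta.
  apply: (big_ind2 (fun (a : E) b => a = (0, b))) => // [a b a' b' -> ->|i _].
    by rewrite -[LHS]/(_, _)/= addr0.
  by rewrite -[LHS]/(_, _)/= scaler0.
by rewrite s1 s2 -[RHS]/(_, _)/= addr0 add0r.
Qed.

Lemma smooth_differentiable_pair (U : set E) (g : E -> R^o) x :
  open U -> smooth_on U g -> U x -> differentiable g x.
Proof.
apply: (@smooth_differentiable _ _ pair_basis (fun i => @pair_entry i)).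
  move=> [[] i] [h1 h2]; rewrite /pair_entry/= (le_trans (mx_norm_coord _ _ _))//.
    by rewrite [leRHS]prod_normE/= le_max lexx.
  by rewrite [leRHS]prod_normE/= le_max lexx orbT.
exact: pair_entry_sum.
Qed.

(** The outer map is smooth, hence differentiable, while the inner one needs a
    single directional derivative; this is the form needed for curves. *)
Lemma is_derive_smooth_comp V n (U : set E) (F : E -> 'rV[R]_n) (f : V -> E) x v df :
  open U -> smooth_on U F -> U (f x) -> is_derive x v f df ->
  is_derive x v (fun y => F (f y)) ('D_df F (f x)).
Proof.
move=> oU sF Ux hf; apply: is_derive_row => j.
have [_ e] := is_derive_coord 0 j (smooth_is_derive df sF Ux).
rewrite -e.
have dg : differentiable (fun y : E => F y 0 j : R^o) (f x).
  by apply: (smooth_differentiable_pair oU) => //; exact: smooth_coord.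
exact: (is_derive_comp_diff dg hf).
Qed.

Lemma differentiable_derive_linear V n (F : V -> 'rV[R]_n) x (s : R) u v :
  (forall w, derivable F x w) ->
  (forall j, differentiable (fun y => F y 0 j : R^o) x) ->
  'D_(s *: u + v) F x = s *: 'D_u F x + 'D_v F x.
Proof.
move=> dF dg; apply/rowP => j.
have e w : ('D_w F x) 0 j = 'd (fun y => F y 0 j : R^o) x w.
  have [_ <-] := is_derive_coord 0 j (derivableP (dF w)).
  by rewrite deriveE.
rewrite [RHS]mxE [X in _ = X + _]mxE; apply: (etrans (e _)); rewrite linearP.
by congr (s * _ + _); exact: (esym (e _)).
Qed.

Lemma smooth_derive_linear_pair n (U : set E) (F : E -> 'rV[R]_n) x (s : R) u v :
  open U -> smooth_on U F -> U x ->
  'D_(s *: u + v) F x = s *: 'D_u F x + 'D_v F x.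
Proof.
move=> oU sF Ux; apply: differentiable_derive_linear => [w|j].
  by case: (smooth_is_derive w sF Ux).
by apply: (smooth_differentiable_pair oU) => //; exact: smooth_coord.
Qed.

Lemma smooth_derive_linear m n (U : set 'rV[R]_m) (F : 'rV[R]_m -> 'rV[R]_n) x (s : R) u v :
  open U -> smooth_on U F -> U x ->
  'D_(s *: u + v) F x = s *: 'D_u F x + 'D_v F x.
Proof.
move=> oU sF Ux; apply: differentiable_derive_linear => [w|j].
  by case: (smooth_is_derive w sF Ux).
by apply: (smooth_differentiable_rV oU) => //; exact: smooth_coord.
Qed.

Lemma derive0_ball_cst V (g : V -> R) x (r : R) :
  (forall y, ball x r y -> forall v, is_derive y v g 0) ->
  forall y, ball x r y -> g y = g x.
Proof.
move=> d0 y xy; apply/eqP; rewrite -subr_eq0.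
have B (t : R) : 0 <= t <= 1 -> ball x r (x + t *: (y - x)).
  move=> /andP[t0 t1]; move: xy; rewrite -ball_normE /ball_/= => xy.
  rewrite opprD addrA subrr sub0r normrN normrZ ger0_norm// distrC.
  by rewrite (le_lt_trans _ xy)// ler_piMl.
have [|t t01] := @mean_value _ _ g x (y - x).
  by move=> t t01; case: (d0 _ (B t t01) (y - x)).
rewrite [x + (y - x)]addrC subrK => ->.
by case: (d0 _ (B t t01) (y - x)) => _ ->.
Qed.

End SmoothFunctions.

(** * Maps into the hyperbolic plane *)

Lemma is_derive_unique (R : realType) (V W : normedModType R) (f : V -> W) x v a b :
  is_derive x v f a -> is_derive x v f b -> a = b.
Proof. by move=> [_ <-] [_ <-]. Qed.

Lemma mink_continuous (R : realType) (T : topologicalType)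
    (k l : T -> 'rV[R]_3) x :
  {for x, continuous k} -> {for x, continuous l} ->
  {for x, continuous (fun y => mink (k y) (l y))}.
Proof.
move=> ck cl.
have co (f : T -> 'rV[R]_3) j : {for x, continuous f} -> {for x, continuous (fun y => f y 0 j)}.
  by move=> cf; exact: (@continuous_comp _ _ _ f (fun M : 'rV[R]_3 => M 0 j : R) x cf (@coord_continuous _ _ _ 0 j _)).
have m j : {for x, continuous (fun y => k y 0 j * l y 0 j)}.
  by apply: continuousM; exact: co.
by apply: continuousD; [apply: continuousD; [exact: continuousN|]|].
Qed.

Section MapsToHyperbolicPlane.
Context {R : realType}.
Implicit Types (a b c : 'rV[R]_3).

Lemma lcross0r a : lcross a 0 = 0.
Proof. by apply: row3P; rewrite !(mxE, lcrossE) /=; ring. Qed.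

(** Two tangent vectors at x have a cross product parallel to x. *)
Lemma lcross_tangent x b c : mink x x = -1 -> mink x b = 0 -> mink x c = 0 ->
  lcross b c = - mink x (lcross b c) *: x.
Proof.
move=> xx xb xc; have := lcross_lcross x x (lcross b c).
rewrite xx scaleN1r (lcross_lcross x b c) xb xc !scale0r subrr.
rewrite lcross0r => /eqP; rewrite eq_sym subr_eq0 => /eqP h.
by rewrite scaleNr -h opprK.
Qed.

Lemma mink_tangent3 x a b c : mink x x = -1 -> mink x a = 0 -> mink x b = 0 ->
  mink x c = 0 -> mink a (lcross b c) = 0.
Proof.
move=> xx xa xb xc.
by rewrite (lcross_tangent xx xb xc) minkZr (minkC a) xa mulr0.
Qed.

Lemma lcross0_collinear a b : lcross a b = 0 -> mink a a *: b = mink a b *: a.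
Proof.
move=> ab; have := lcross_lcross a a b; rewrite ab.
by rewrite lcross0r => /eqP; rewrite eq_sym subr_eq0 => /eqP.
Qed.

Variables (U : set 'rV[R]_2) (g : 'rV[R]_2 -> 'rV[R]_3).
Hypotheses (oU : open U) (sg : smooth_on U g).
Hypothesis hg : forall x, U x -> hyp (-1) (g x).

Let nU x : U x -> \forall y \near x, U y.
Proof. by move=> Ux; exact: open_nbhs_nbhs. Qed.

Let d1 x v : U x -> is_derive x v g ('D_v g x).
Proof. exact: smooth_is_derive. Qed.

Let d2 x v w : U x -> is_derive x v (fun y => 'D_w g y) ('D_v (fun y => 'D_w g y) x).
Proof. by move=> Ux; exact: (smooth_is_derive v (smooth_derive w sg)). Qed.

Lemma hyp_map_tangent x v : U x -> mink (g x) ('D_v g x) = 0.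
Proof.
move=> Ux; have h := is_derive_mink (d1 v Ux) (d1 v Ux).
have h0 : is_derive x v (fun y => mink (g y) (g y)) 0.
  apply: near_eq_is_derive (is_derive_cst (-1 : R) x v).
  by apply: filterS (nU Ux) => y Uy /=; rewrite (hyp_self (hg Uy)).
have := is_derive_unique h h0; rewrite (minkC ('D_v g x)) -mulr2n => /eqP.
by rewrite mulrn_eq0 => /eqP.
Qed.

Lemma hyp_map_second x v w : U x ->
  mink (g x) ('D_v (fun y => 'D_w g y) x) = - mink ('D_v g x) ('D_w g x).
Proof.
move=> Ux; have h := is_derive_mink (d1 v Ux) (d2 v w Ux).
have h0 : is_derive x v (fun y => mink (g y) ('D_w g y)) 0.
  apply: near_eq_is_derive (is_derive_cst (0 : R) x v).
  by apply: filterS (nU Ux) => y Uy /=; rewrite hyp_map_tangent.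
by have /eqP := is_derive_unique h h0; rewrite addrC addr_eq0 => /eqP.
Qed.

Lemma hyp_map_proj x v w : U x ->
  hyp_proj (-1) (g x) ('D_v (fun y => 'D_w g y) x) =
  'D_v (fun y => 'D_w g y) x - mink ('D_v g x) ('D_w g x) *: g x.
Proof.
by move=> Ux; rewrite /hyp_proj minkC hyp_map_second// mulN1r opprK.
Qed.

Definition area x u v : R := mink (g x) (lcross ('D_u g x) ('D_v g x)).

Lemma derive_row2 x s t : U x ->
  'D_(row2 s t) g x = s *: 'D_(row2 1 0) g x + t *: 'D_(row2 0 1) g x.
Proof.
move=> Ux; rewrite row2_basis (smooth_derive_linear _ _ _ oU sg Ux).
congr (_ + _); rewrite -[_ *: row2 0 1]addr0 (smooth_derive_linear _ _ _ oU sg Ux).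
by rewrite derive0 addr0.
Qed.

(** Tangent vectors with vanishing area are collinear, so that one combination of
    the two coordinate directions is killed by the differential. *)
Lemma area_rank1 x : U x -> area x (row2 1 0) (row2 0 1) = 0 ->
  exists2 u, u != 0 & 'D_u g x = 0.
Proof.
move=> Ux a0.
have c0 : lcross ('D_(row2 1 0) g x) ('D_(row2 0 1) g x) = 0.
  rewrite (lcross_tangent (hyp_self (hg Ux)) (hyp_map_tangent _ Ux) (hyp_map_tangent _ Ux)).
  by rewrite -/(area _ _ _) a0 oppr0 scale0r.
have := lcross0_collinear c0.
have := hyp_tangent_gt0 (hg Ux) (hyp_map_tangent (row2 1 0) Ux).
move: (fun s t => @derive_row2 x s t Ux).
move: ('D_(row2 1 0) g x) ('D_(row2 0 1) g x) => a b L aa ab.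
have [a_eq0|a_neq0] := eqVneq a 0.
  exists (row2 1 0); last by rewrite L a_eq0 scaler0 scale0r addr0.
  by apply/eqP => /row2_eq0[/eqP]; rewrite oner_eq0.
exists (row2 (- mink a b) (mink a a)).
  by apply/eqP => /row2_eq0[_ /eqP]; rewrite gt_eqF// aa.
by rewrite L ab scaleNr addNr.
Qed.

(** When all derivatives of g are collinear, N = g * D_w g satisfies D_v N = l N.
    Hence for every fixed c the quotient <N,c>^2 / <N,N> is constant; for c = g x it
    vanishes at x and therefore also at x0. *)
Lemma rank1_planar x0 w : U x0 ->
  (forall x, U x -> forall u v, lcross ('D_u g x) ('D_v g x) = 0) ->
  (forall x, U x -> forall u v, exists y, 'D_u (fun z => 'D_v g z) x =
     'D_y g x + mink ('D_u g x) ('D_v g x) *: g x) ->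
  (forall x, U x -> 'D_w g x != 0) ->
  forall r, ball x0 r `<=` U ->
  forall x, ball x0 r x -> mink (lcross (g x0) ('D_w g x0)) (g x) = 0.
Proof.
move=> Ux0 rk1 tg wn0 r rU.
pose N y := lcross (g y) ('D_w g y).
have NN y : mink (N y) (N y) = mink (g y) ('D_w g y) ^+ 2 - mink (g y) (g y) * mink ('D_w g y) ('D_w g y).
  by rewrite /N mink_lcross_lcross (minkC ('D_w g y) (g y)) expr2.
have NNE y : U y -> mink (N y) (N y) = mink ('D_w g y) ('D_w g y).
  by move=> Uy; rewrite NN (hyp_self (hg Uy)) hyp_map_tangent// expr0n/= mulN1r opprK add0r.
have NN0 y : U y -> 0 < mink (N y) (N y).
  move=> Uy; rewrite NNE//; apply: hyp_tangent_gt0 (wn0 _ Uy); [exact: hg Uy|].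
  exact: hyp_map_tangent.
have dN y v : U y -> exists l, is_derive y v N (l *: N y).
  move=> Uy; have [z zE] := tg _ Uy v w.
  exists (mink ('D_w g y) ('D_z g y) / mink ('D_w g y) ('D_w g y)).
  apply: is_derive_eq (is_derive_lcross (d1 v Uy) (d2 v w Uy)) _.
  rewrite zE rk1// add0r lcrossDr lcrossZr lcrossvv scaler0 addr0 /N -lcrossZr.
  congr (lcross _ _); have := lcross0_collinear (rk1 _ Uy w z).
  rewrite mulrC -scalerA => <-; rewrite scalerA mulVf ?scale1r//.
  by rewrite -NNE// gt_eqF// NN0.
move=> x xB.
pose c := g x.
(* The square over the norm is invariant under rescaling of N. *)
pose h y := mink (N y) c ^+ 2 / mink (N y) (N y).
have dh y : ball x0 r y -> forall v, is_derive y v h 0.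
  move=> /rU Uy v; have [l hN] := dN y v Uy.
  have dc : is_derive y v (fun=> c) 0 := is_derive_cst c y v.
  have m1 := is_derive_mink hN dc.
  have m2 := is_derive_mink hN hN.
  have nz : mink (N y) (N y) != 0 by rewrite gt_eqF// NN0.
  have m3 := is_derive_mul (is_derive_mul m1 m1) (@is_derive_inv R _ (fun y => mink (N y) (N y)) y v _ nz m2).
  apply: is_derive_eq m3 _.
  by rewrite !minkE; field.
have hx0 : h x = h x0 := derive0_ball_cst dh xB.
have Ux := rU _ xB.
have e0 : mink (N x) c = 0 by rewrite /N /c minkC mink_lcrossl.
have hx : h x = 0 by rewrite /h e0 expr0n mul0r.
have /eqP : h x0 = 0 by rewrite -hx0.
by rewrite mulf_eq0 invr_eq0 (gt_eqF (NN0 _ Ux0)) orbF sqrf_eq0 => /eqP.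
Qed.

End MapsToHyperbolicPlane.

(** * Moving frames *)

Section Transport.
Context {R : realType}.
Implicit Types (a b c d x v e f : 'rV[R]_3).

Lemma mink_ext a b : (forall d, mink a d = mink b d) -> a = b.
Proof.
move=> h; apply: row3P.
- by have := h (delta_mx 0 0); rewrite /mink !mxE/=; lra.
- by have := h (delta_mx 0 1); rewrite /mink !mxE/=; lra.
- by have := h (delta_mx 0 2%:R); rewrite /mink !mxE/=; lra.
Qed.

(** The linear map sending the orthogonal frame (x, e, x * e) to
    (x', e', x' * e'); it is a Lorentz transformation when <e,e> = <e',e'>. *)
Definition transport x e x' e' c : 'rV[R]_3 :=
  (mink e e)^-1 *: (mink e c *: e' + mink (lcross x e) c *: lcross x' e')
  - mink x c *: x'.

Lemma transport_base x e x' e' : mink x x = -1 -> mink x e = 0 ->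
  transport x e x' e' x = x'.
Proof.
move=> xx xe; rewrite /transport xx (minkC e) xe (minkC _ x) mink_lcrossl.
by rewrite !scale0r addr0 scaler0 sub0r scaleN1r opprK.
Qed.

Lemma tangent_decomposition x e v : mink x x = -1 -> mink x e = 0 ->
  mink e e != 0 -> mink x v = 0 ->
  v = (mink e v / mink e e) *: e + (mink x (lcross e v) / mink e e) *: lcross x e.
Proof.
move=> xx xe e0 xv; have h := frame_decomposition v xx xe.
rewrite xv mulr0 scale0r subr0 in h.
have -> : mink x (lcross e v) = mink (lcross x e) v.
  by rewrite mink_lcross_rot mink_lcross_rot minkC.
apply: (scalerI e0); rewrite h scalerDr !scalerA.
by congr (_ *: _ + _ *: _); field.
Qed.

Lemma lcross_frame x e (a b a' b' k : R) : mink x x = -1 -> mink x e = 0 ->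
  lcross (a *: e + b *: lcross x e) e
  + lcross x (a' *: e + b' *: lcross x e + k *: x) =
  a' *: lcross x e - b' *: e + (b * mink e e) *: x.
Proof.
move=> xx xe.
rewrite !(lcrossDl, lcrossDr, lcrossZl, lcrossZr) !lcrossvv.
have -> : lcross x (lcross x e) = - e.
  by rewrite lcross_lcross xx xe scale0r subr0 scaleN1r.
have -> : lcross (lcross x e) e = mink e e *: x.
  by rewrite lcrossC lcross_lcross (minkC e x) xe scale0r sub0r opprK.
by rewrite !scaler0 add0r addr0 scalerA scalerN addrC.
Qed.

(** The Leibniz rule for the pairing of a transported vector with d, both frames obeying
    the equations of [frame_equations] with the same coefficients a, b, a', b'.  The
    term 2 rho a' is the derivative of rho = <e,e>. *)
Lemma transport_derivative (rho p q k p' q' k' a b a' b' : R) : rho != 0 ->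
  (((a' * q + b' * k + (a * rho) * p) * q' + q * (a' * q' + b' * k' + (a * rho) * p'))
  + ((a' * k - b' * q + (b * rho) * p) * k' + k * (a' * k' - b' * q' + (b * rho) * p'))) / rho
  - (q * q' + k * k') * ((2 * rho * a') / rho ^+ 2)
  - ((a * q + b * k) * p' + p * (a * q' + b * k')) = 0.
Proof. by move=> rho0; field. Qed.

End Transport.

Section MovingFrames.
Context {R : realType} {V : normedModType R}.
Implicit Types (g e : V -> 'rV[R]_3) (x v : V) (dv dy c d : 'rV[R]_3).

(** Structure equations of the moving frame (g, e, g * e), where e has the
    derivative of a field D_w g along a totally geodesic surface. *)
Lemma frame_equations g e x v dv dy (a b a' b' : R) :
  mink (g x) (g x) = -1 -> mink (g x) (e x) = 0 -> mink (e x) (e x) != 0 ->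
  mink (g x) dv = 0 -> mink (g x) dy = 0 ->
  is_derive x v g dv -> is_derive x v e (dy + mink dv (e x) *: g x) ->
  a = mink (e x) dv / mink (e x) (e x) ->
  b = mink (g x) (lcross (e x) dv) / mink (e x) (e x) ->
  a' = mink (e x) dy / mink (e x) (e x) ->
  b' = mink (g x) (lcross (e x) dy) / mink (e x) (e x) ->
  [/\ is_derive x v g (a *: e x + b *: lcross (g x) (e x)),
      is_derive x v e (a' *: e x + b' *: lcross (g x) (e x) + (a * mink (e x) (e x)) *: g x) &
      is_derive x v (fun z => lcross (g z) (e z))
        (a' *: lcross (g x) (e x) - b' *: e x + (b * mink (e x) (e x)) *: g x)].
Proof.
move=> xx xe e0 xv xy d1 d2 aE bE a'E b'E.
have dvE : dv = a *: e x + b *: lcross (g x) (e x).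
  by rewrite aE bE; exact: tangent_decomposition.
have dyE : dy = a' *: e x + b' *: lcross (g x) (e x).
  by rewrite a'E b'E; exact: tangent_decomposition.
have mE : mink dv (e x) = a * mink (e x) (e x) by rewrite aE mulfVK// minkC.
rewrite mE in d2; rewrite dvE in d1; rewrite dyE in d2.
split=> //; apply: is_derive_eq (is_derive_lcross d1 d2) _.
exact: lcross_frame.
Qed.

(** Equal metrics and equal areas mean equal structure coefficients for both frames,
    so the map from one frame to the other does not change. *)
Lemma transport_is_derive0 g1 e1 g2 e2 x v dv1 dy1 dv2 dy2 c d :
  mink (g1 x) (g1 x) = -1 -> mink (g1 x) (e1 x) = 0 -> mink (e1 x) (e1 x) != 0 ->
  mink (g1 x) dv1 = 0 -> mink (g1 x) dy1 = 0 ->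
  is_derive x v g1 dv1 -> is_derive x v e1 (dy1 + mink dv1 (e1 x) *: g1 x) ->
  mink (g2 x) (g2 x) = -1 -> mink (g2 x) (e2 x) = 0 ->
  mink (g2 x) dv2 = 0 -> mink (g2 x) dy2 = 0 ->
  is_derive x v g2 dv2 -> is_derive x v e2 (dy2 + mink dv2 (e2 x) *: g2 x) ->
  mink (e1 x) (e1 x) = mink (e2 x) (e2 x) ->
  mink (e1 x) dv1 = mink (e2 x) dv2 -> mink (e1 x) dy1 = mink (e2 x) dy2 ->
  mink (g1 x) (lcross (e1 x) dv1) = mink (g2 x) (lcross (e2 x) dv2) ->
  mink (g1 x) (lcross (e1 x) dy1) = mink (g2 x) (lcross (e2 x) dy2) ->
  is_derive x v (fun y => mink (transport (g1 y) (e1 y) (g2 y) (e2 y) c) d) 0.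
Proof.
move=> xx1 xe1 n1 xv1 xy1 dg1 de1 xx2 xe2 xv2 xy2 dg2 de2 ee ev ey av ay.
have n2 : mink (e2 x) (e2 x) != 0 by rewrite -ee.
have [p1 {}de1 q1] := frame_equations xx1 xe1 n1 xv1 xy1 dg1 de1 erefl erefl erefl erefl.
have [p2 {}de2 q2] := frame_equations xx2 xe2 n2 xv2 xy2 dg2 de2 erefl erefl erefl erefl.
rewrite -ee -ev -ey -av -ay in p2 de2 q2.
have ex : mink (lcross (g1 x) (e1 x)) (e1 x) = 0 by rewrite minkC mink_lcrossr.
have gx : mink (e1 x) (g1 x) = 0 by rewrite minkC.
move: (_ / _) (_ / _) (_ / _) (_ / _) p1 de1 q1 p2 de2 q2.
move=> b' a' b a p1 de1 q1 p2 de2 q2.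
have dcst k : is_derive x v (fun=> k : 'rV[R]_3) 0 := is_derive_cst k x v.
have P1 := is_derive_mink p1 (dcst c); have P2 := is_derive_mink p2 (dcst d).
have E1 := is_derive_mink de1 (dcst c); have E2 := is_derive_mink de2 (dcst d).
have Q1 := is_derive_mink q1 (dcst c); have Q2 := is_derive_mink q2 (dcst d).
have RR := is_derive_mink de1 de1.
have I := @is_derive_inv R _ (fun y => mink (e1 y) (e1 y)) x v _ n1 RR.
have H := is_deriveB (is_derive_mul (is_deriveD (is_derive_mul E1 E2) (is_derive_mul Q1 Q2)) I)
     (is_derive_mul P1 P2).
have HE : (fun y => mink (transport (g1 y) (e1 y) (g2 y) (e2 y) c) d) =
  (fun y => (mink (e1 y) c * mink (e2 y) d +
    mink (lcross (g1 y) (e1 y)) c * mink (lcross (g2 y) (e2 y)) d) *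
    (mink (e1 y) (e1 y))^-1 - mink (g1 y) c * mink (g2 y) d).
  by apply/funext => y; rewrite /transport !minkE; ring.
rewrite HE; apply: is_derive_eq H _.
rewrite -[X in _ = X](transport_derivative (mink (g1 x) c) (mink (e1 x) c)
  (mink (lcross (g1 x) (e1 x)) c) (mink (g2 x) d) (mink (e2 x) d)
  (mink (lcross (g2 x) (e2 x)) d) a b a' b' n1).
by rewrite !minkE ex gx xe1 mink_lcrossr !fctE; ring.
Qed.

End MovingFrames.

Section TwoMaps.
Context {R : realType}.
Variables (U : set 'rV[R]_2) (g1 g2 : 'rV[R]_2 -> 'rV[R]_3).
Hypotheses (oU : open U) (sg1 : smooth_on U g1) (sg2 : smooth_on U g2).
Hypothesis hg1 : forall x, U x -> hyp (-1) (g1 x).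
Hypothesis hg2 : forall x, U x -> hyp (-1) (g2 x).

(** Freezing c = g1 x, the transported vector is g2 x at the point x itself and does
    not depend on the base point of the frames, which may be moved to x0. *)
Lemma transport_constant x0 w r :
  ball x0 r `<=` U ->
  (forall x, U x -> forall u v, mink ('D_u g1 x) ('D_v g1 x) = mink ('D_u g2 x) ('D_v g2 x)) ->
  (forall x, U x -> forall u v, area g1 x u v = area g2 x u v) ->
  (forall x, U x -> forall u v, exists y,
     'D_u (fun z => 'D_v g1 z) x = 'D_y g1 x + mink ('D_u g1 x) ('D_v g1 x) *: g1 x /\
     'D_u (fun z => 'D_v g2 z) x = 'D_y g2 x + mink ('D_u g2 x) ('D_v g2 x) *: g2 x) ->
  (forall x, U x -> 'D_w g1 x != 0) ->
  forall x, ball x0 r x ->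
  g2 x = transport (g1 x0) ('D_w g1 x0) (g2 x0) ('D_w g2 x0) (g1 x).
Proof.
move=> rU isom areaE tg wn0 x xB.
have Ux := rU _ xB.
have wn0' y : U y -> 'D_w g2 y != 0.
  move=> Uy; apply: contra (wn0 _ Uy) => /eqP e0.
  have [_ h] := hyp_tangent_pos (hg1 Uy) (hyp_map_tangent oU sg1 hg1 w Uy).
  by apply/eqP/h; rewrite isom// e0 mink0l.
have rho0 y : U y -> mink ('D_w g1 y) ('D_w g1 y) != 0.
  move=> Uy; rewrite gt_eqF// (hyp_tangent_gt0 (hg1 Uy)) ?wn0//.
  exact: (hyp_map_tangent oU sg1 hg1).
have T1 y v := hyp_map_tangent (x := y) oU sg1 hg1 v.
have T2 y v := hyp_map_tangent (x := y) oU sg2 hg2 v.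
apply: mink_ext => d; pose c := g1 x.
pose h y := mink (transport (g1 y) ('D_w g1 y) (g2 y) ('D_w g2 y) c) d.
have dh y : ball x0 r y -> forall v, is_derive y v h 0.
  move=> /rU Uy v; have [z [z1 z2]] := tg _ Uy v w.
  have D1 := smooth_is_derive v (smooth_derive w sg1) Uy; rewrite z1 in D1.
  have D2 := smooth_is_derive v (smooth_derive w sg2) Uy; rewrite z2 in D2.
  exact: (@transport_is_derive0 R _ g1 (fun z => 'D_w g1 z) g2 (fun z => 'D_w g2 z) y v
    _ _ _ _ c d (hyp_self (hg1 Uy)) (T1 _ w Uy) (rho0 _ Uy)
    (T1 _ v Uy) (T1 _ z Uy) (smooth_is_derive v sg1 Uy) D1
    (hyp_self (hg2 Uy)) (T2 _ w Uy) (T2 _ v Uy) (T2 _ z Uy)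
    (smooth_is_derive v sg2 Uy) D2
    (isom _ Uy w w) (isom _ Uy w v) (isom _ Uy w z) (areaE _ Uy w v) (areaE _ Uy w z)).
have hx : h x = h x0 := derive0_ball_cst dh xB.
rewrite -[RHS]/(h x0) -hx /h transport_base//; first exact: hyp_self (hg1 Ux).
exact: T1 Ux.
Qed.

End TwoMaps.

(** * The Codazzi identity *)

Section LagrangianPair.
Context {R : realType}.

Lemma second_pairing (p dvw duz dy dy' du dz : 'rV[R]_3) (m m' : R) :
  dvw = dy + m *: p -> duz = dy' + m' *: p ->
  mink p p = -1 -> mink p dy = 0 -> mink p dy' = 0 -> mink p du = 0 -> mink p dz = 0 ->
  mink dvw (lcross du dz + lcross p duz) =
  m * mink p (lcross du dz) + mink p (lcross dy' dy).
Proof.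
move=> -> -> pp py py' pu pz.
rewrite lcrossDr lcrossZr lcrossvv scaler0 addr0 !minkE.
rewrite (mink_tangent3 pp py pu pz) mink_lcrossl addr0 add0r addrC.
by rewrite (mink_lcross_rot dy).
Qed.

Lemma first_pairing (p dy dz : 'rV[R]_3) (m : R) :
  mink (dy + m *: p) (lcross p dz) = mink p (lcross dz dy).
Proof.
by rewrite !minkE mink_lcrossl mulr0 addr0 mink_lcross_rot.
Qed.

Variables (U : set 'rV[R]_2) (g1 g2 : 'rV[R]_2 -> 'rV[R]_3).
Hypotheses (oU : open U) (sg1 : smooth_on U g1) (sg2 : smooth_on U g2).
Hypothesis hg1 : forall x, U x -> hyp (-1) (g1 x).
Hypothesis hg2 : forall x, U x -> hyp (-1) (g2 x).
(* Total geodesy: up to the position vectors, the second derivatives are tangent,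
   with a common direction y for both factors. *)
Hypothesis tg : forall x, U x -> forall u v, exists y,
  'D_u (fun z => 'D_v g1 z) x = 'D_y g1 x + mink ('D_u g1 x) ('D_v g1 x) *: g1 x /\
  'D_u (fun z => 'D_v g2 z) x = 'D_y g2 x + mink ('D_u g2 x) ('D_v g2 x) *: g2 x.
Hypothesis lag : forall x, U x -> forall u v, area g1 x u v = area g2 x u v.
Hypothesis inj : forall x, U x -> forall v, 'D_v g1 x = 0 -> 'D_v g2 x = 0 -> v = 0.

Let T1 y v := hyp_map_tangent (x := y) oU sg1 hg1 v.
Let T2 y v := hyp_map_tangent (x := y) oU sg2 hg2 v.

Let second (g : 'rV[R]_2 -> 'rV[R]_3) x v w z := mink ('D_v (fun y => 'D_w g y) x) (lcross (g x) ('D_z g x)) : R.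

Lemma second_normal x v w z : U x -> second g1 x v w z - second g2 x v w z = 0.
Proof.
move=> Ux; have [y [e1 e2]] := tg Ux v w.
rewrite /second e1 e2 !first_pairing.
by apply/eqP; rewrite subr_eq0; apply/eqP; exact: (lag Ux z y).
Qed.

Lemma second_derivative g x u v w z : smooth_on U g -> U x ->
  is_derive x u (fun y => second g y v w z)
   (mink ('D_u (fun y => 'D_v (fun y => 'D_w g y) y) x) (lcross (g x) ('D_z g x)) +
    mink ('D_v (fun y => 'D_w g y) x) (lcross ('D_u g x) ('D_z g x) +
           lcross (g x) ('D_u (fun y => 'D_z g y) x))).
Proof.
move=> sg Ux; apply: is_derive_mink.
  exact: (smooth_is_derive u (smooth_derive v (smooth_derive w sg)) Ux).
apply: is_derive_lcross; first exact: smooth_is_derive.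
exact: (smooth_is_derive u (smooth_derive z sg) Ux).
Qed.

(** Differentiate <D_v D_w g1, g1 * D_z g1> - <D_v D_w g2, g2 * D_z g2> = 0 along u.
    Total geodesy replaces each second derivative by a tangent vector plus a
    multiple of the position vector; the tangential terms are areas and cancel
    between the factors.  The remaining third derivatives are symmetric in u and v. *)
Lemma codazzi x u v w z : U x ->
  (mink ('D_v g1 x) ('D_w g1 x) - mink ('D_v g2 x) ('D_w g2 x)) * area g1 x u z =
  (mink ('D_u g1 x) ('D_w g1 x) - mink ('D_u g2 x) ('D_w g2 x)) * area g1 x v z.
Proof.
move=> Ux.
have nU : \forall y \near x, U y by exact: open_nbhs_nbhs.
have collect (t1 t2 b1 b2 m1 m2 al1 al2 be1 be2 : R) :
    t1 + b1 - (t2 + b2) = 0 -> b1 = m1 * al1 + be1 -> b2 = m2 * al2 + be2 ->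
    al1 = al2 -> be1 = be2 -> t1 - t2 + (m1 - m2) * al1 = 0.
  by move=> <- -> -> -> ->; ring.
have key a b : exists k : R,
   k + (mink ('D_b g1 x) ('D_w g1 x) - mink ('D_b g2 x) ('D_w g2 x)) * area g1 x a z = 0 /\
   k = mink ('D_a (fun y => 'D_b (fun y => 'D_w g1 y) y) x) (lcross (g1 x) ('D_z g1 x))
      - mink ('D_a (fun y => 'D_b (fun y => 'D_w g2 y) y) x) (lcross (g2 x) ('D_z g2 x)).
  eexists; split; last reflexivity.
  have h := is_deriveB (second_derivative a b w z sg1 Ux) (second_derivative a b w z sg2 Ux).
  have h0 : is_derive x a ((fun y => second g1 y b w z) - (fun y => second g2 y b w z)) 0.
    apply: near_eq_is_derive (is_derive_cst (0 : R) x a).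
    by apply: filterS nU => y Uy; rewrite -[RHS]/(second g1 y b w z - second g2 y b w z) second_normal.
  have [y [y1 y2]] := tg Ux b w; have [y' [y1' y2']] := tg Ux a z.
  exact: (collect _ _ _ _ _ _ _ _ _ _ (is_derive_unique h h0)
    (second_pairing y1 y1' (hyp_self (hg1 Ux)) (T1 y Ux) (T1 y' Ux) (T1 a Ux) (T1 z Ux))
    (second_pairing y2 y2' (hyp_self (hg2 Ux)) (T2 y Ux) (T2 y' Ux) (T2 a Ux) (T2 z Ux))
    (lag Ux a z) (lag Ux y' y)).
have [k1 [e1 k1E]] := key u v; have [k2 [e2 k2E]] := key v u.
have k12 : k1 = k2.
  have c1 := smooth_derive_comm v u oU (smooth_derive w sg1) Ux.
  have c2 := smooth_derive_comm v u oU (smooth_derive w sg2) Ux.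
  apply: (etrans k1E); apply: esym; apply: (etrans k2E); apply: esym.
  exact: (congr2 (fun a b => mink a _ - mink b _) c1 c2).
have cancel (k k' A B : R) : k = k' -> k + A = 0 -> k' + B = 0 -> A = B.
  by move=> <- kA kB; apply: (addrI k); rewrite kA kB.
exact: (cancel _ _ _ _ k12 e1 e2).
Qed.

(** In two dimensions area is determined by one nonzero value, so the Codazzi identity
    with repeated arguments kills the difference of the metrics. *)
Lemma codazzi_isometric x u z : U x -> area g1 x u z != 0 ->
  forall v w, mink ('D_v g1 x) ('D_w g1 x) = mink ('D_v g2 x) ('D_w g2 x).
Proof.
move=> Ux uz.
pose D v w : R := mink ('D_v g1 x) ('D_w g1 x) - mink ('D_v g2 x) ('D_w g2 x).
pose A s t : R := area g1 x s t.
have cod a b w c : D b w * A a c = D a w * A b c := codazzi a b w c Ux.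
have {}uz : A u z != 0 := uz.
have Azz s : A s s = 0 by rewrite /A /area lcrossvv mink0r.
have Asym s t : A s t = - A t s by rewrite /A /area lcrossC minkE.
suff D0 v w : D v w = 0 by move=> v w; apply/eqP; rewrite -subr_eq0; apply/eqP/D0.
move: D A cod Azz Asym uz => D A cod Azz Asym uz.
have zu : A z u != 0 by rewrite Asym oppr_eq0.
have Dz : D z w = 0 by apply: (mulIf uz); rewrite (cod u z) Azz mul0r mulr0.
have Du : D u w = 0 by apply: (mulIf zu); rewrite (cod z u) Azz mul0r mulr0.
by apply: (mulIf uz); rewrite (cod u v) Du !mul0r.
Qed.

End LagrangianPair.

(** * Lorentz transformations and the two models *)

Section TransportAlgebra.
Context {R : realType}.
Implicit Types (a b c d p e n : 'rV[R]_3).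

Definition frame p e := [/\ hyp (-1) p, mink p e = 0 & 0 < mink e e].

Lemma frame_lcross p e : frame p e ->
  [/\ lcross (lcross p e) p = e, lcross e (lcross p e) = - (mink e e *: p) &
      mink (lcross p e) (lcross p e) = mink e e].
Proof.
move=> [/hyp_self pp pe _]; split.
- by rewrite lcrossC lcross_lcross pp pe scale0r subr0 scaleN1r opprK.
- by rewrite lcross_lcross (minkC e p) pe scale0r sub0r.
- by rewrite mink_lcross_lcross pp pe; ring.
Qed.

Lemma frame_ext p e a b : frame p e -> mink p a = mink p b ->
  mink e a = mink e b -> mink (lcross p e) a = mink (lcross p e) b -> a = b.
Proof.
move=> [/hyp_self pp pe e0] ha hb hc.
have e1 : mink e e != 0 by rewrite gt_eqF.
apply: (scalerI e1); rewrite (frame_decomposition a pp pe) (frame_decomposition b pp pe).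
by rewrite ha hb hc.
Qed.

(** The multiplication table of the frame, which is why a map between frames of
    equal length respects the cross product. *)
Lemma frame_lcross_coords p e c d : frame p e ->
  [/\ mink p (lcross c d) =
      (mink e c * mink (lcross p e) d - mink e d * mink (lcross p e) c) / mink e e,
    mink e (lcross c d) = mink (lcross p e) d * mink p c - mink (lcross p e) c * mink p d &
    mink (lcross p e) (lcross c d) = mink p d * mink e c - mink p c * mink e d].
Proof.
move=> fr; have [F1 F2 _] := frame_lcross fr; have [_ _ e0] := fr.
have e1 : mink e e != 0 by rewrite gt_eqF.
split.
- apply: (mulfI e1); rewrite -[LHS]minkZl -[_ *: p]opprK -F2 minkNl mink_lcross_lcross.
  by field.
- by rewrite -{1}F1 mink_lcross_lcross.
- by rewrite mink_lcross_lcross.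
Qed.

Variables (p e p' e' : 'rV[R]_3).
Hypotheses (fr : frame p e) (fr' : frame p' e') (ee : mink e e = mink e' e').

Let T := transport p e p' e'.

Lemma transportP (k : R) a b : T (k *: a + b) = k *: T a + T b.
Proof.
rewrite /T /transport; apply: mink_ext => d; rewrite !minkE; ring.
Qed.

Lemma transport0 : T 0 = 0.
Proof. by rewrite /T /transport !minkE !scale0r addr0 scaler0 subr0. Qed.

Lemma transport_coords c :
  [/\ mink p' (T c) = mink p c, mink e' (T c) = mink e c &
      mink (lcross p' e') (T c) = mink (lcross p e) c].
Proof.
have [/hyp_self pp pe e0] := fr; have [/hyp_self pp' pe' e0'] := fr'.
have [_ _ GG] := frame_lcross fr; have [_ _ GG'] := frame_lcross fr'.
have e'0 : mink e' e' != 0 by rewrite gt_eqF.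
have ep' : mink e' p' = 0 by rewrite minkC.
have Gp : mink (lcross p' e') p' = 0 by rewrite minkC mink_lcrossl.
have Ge : mink (lcross p' e') e' = 0 by rewrite minkC mink_lcrossr.
split; rewrite /T /transport ee !minkE ?pp' ?pe' ?ep' ?Gp ?Ge ?mink_lcrossl
  ?mink_lcrossr ?GG'.
- by ring.
- by field.
- by field.
Qed.

Lemma transport_mink c d : mink (T c) (T d) = mink c d.
Proof.
have [/hyp_self pp pe e0] := fr.
have [h1 h2 h3] := transport_coords d.
have e1 : mink e e != 0 by rewrite gt_eqF.
have -> : T c = (mink e e)^-1 *: (mink e c *: e' + mink (lcross p e) c *: lcross p' e')
  - mink p c *: p' by [].
move: (T d) h1 h2 h3 => Td h1 h2 h3; rewrite !minkE h1 h2 h3.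
apply: (mulfI e1); rewrite -[RHS]minkZl (frame_decomposition c pp pe) !minkE.
by field.
Qed.

Lemma transport_lcross c d : T (lcross c d) = lcross (T c) (T d).
Proof.
have [c1 c2 c3] := transport_coords c; have [d1 d2 d3] := transport_coords d.
have [k1 k2 k3] := transport_coords (lcross c d).
have [l1 l2 l3] := frame_lcross_coords c d fr.
have [m1 m2 m3] := frame_lcross_coords (T c) (T d) fr'.
apply: (frame_ext fr').
- by rewrite k1 l1 m1 c2 c3 d2 d3 ee.
- by rewrite k2 l2 m2 c1 c3 d1 d3.
- by rewrite k3 l3 m3 c1 c2 d1 d2.
Qed.

Lemma transport_hyp c : hyp (-1) c -> hyp (-1) (T c).
Proof.
have [hp pe e0] := fr; have [hp' _ _] := fr'.
move=> hc; apply: (hyp_of_mink_neg hp').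
  by rewrite transport_mink hyp_self.
by have [-> _ _] := transport_coords c; exact: hyp_mink_neg.
Qed.

End TransportAlgebra.

Section TransportInverse.
Context {R : realType}.
Variables (p e p' e' : 'rV[R]_3).
Hypotheses (fr : frame p e) (fr' : frame p' e') (ee : mink e e = mink e' e').

Lemma transportK c : transport p' e' p e (transport p e p' e' c) = c.
Proof.
have [c1 c2 c3] := transport_coords fr fr' ee c.
have [d1 d2 d3] := transport_coords fr' fr (esym ee) (transport p e p' e' c).
by apply: (frame_ext fr); [rewrite d1|rewrite d2|rewrite d3].
Qed.

End TransportInverse.

Section Models.
Context {R : realType}.
Implicit Types (a b c n p e : 'rV[R]_3).
Notation E := ('rV[R]_3 * 'rV[R]_3)%type.

(** Cramer's rule: the determinant of a, b, c times n is a combination of the products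
    of n with a, b, c. *)
Lemma coplanar_det0 n a b c : n != 0 -> mink n a = 0 -> mink n b = 0 ->
  mink n c = 0 -> mink a (lcross b c) = 0.
Proof.
move=> n0 na nb nc.
have h : mink a (lcross b c) *: n =
   mink n a *: lcross b c + mink n b *: lcross c a + mink n c *: lcross a b.
  by apply: row3P; rewrite /mink !(mxE, lcrossE) /=; ring.
move: h; rewrite na nb nc !scale0r !addr0 => /eqP.
by rewrite scaler_eq0 (negPf n0) orbF => /eqP.
Qed.

(** A plane through the origin is spanned by any frame in it, so its normal is
    proportional to p * e. *)
Lemma plane_normal p e n : frame p e -> n != 0 -> mink n p = 0 -> mink n e = 0 ->
  forall q, (mink n q = 0) <-> (mink (lcross p e) q = 0).
Proof.
move=> fr n0 np ne q; have [/hyp_self pp pe e0] := fr.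
have e1 : mink e e != 0 by rewrite gt_eqF.
have := frame_decomposition n pp pe.
rewrite (minkC e) (minkC p) np ne scale0r add0r mulr0 scale0r subr0.
set G := lcross p e; set k := mink G n => h.
have k0 : k != 0.
  apply: contraNneq n0 => k0; move/eqP: h.
  by rewrite k0 scale0r scaler_eq0 (negPf e1).
have hq : mink e e * mink n q = k * mink G q by rewrite -!minkZl h.
split=> h0; move: hq; rewrite h0 mulr0 => /eqP.
  by rewrite eq_sym mulf_eq0 (negPf k0) => /eqP.
by rewrite mulf_eq0 (negPf e1) => /eqP.
Qed.

Definition planes n1 n2 : set E := [set q | mink n1 q.1 = 0 /\ mink n2 q.2 = 0].

Definition graph p e p' e' : set E := [set q | q.2 = transport p e p' e' q.1].

(** The linear sets in which a totally geodesic Lagrangian surface lies. *)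
Definition model (Q : set E) :=
  (exists n1 n2, [/\ 0 < mink n1 n1, 0 < mink n2 n2 & Q = planes n1 n2]) \/
  (exists p e p' e', [/\ frame p e, frame p' e', mink e e = mink e' e' & Q = graph p e p' e']).

End Models.

(** * Uniqueness of the model *)

Section ModelOfSurface.
Context {R : realType}.

Lemma transport_adjoint (p e p' e' c d : 'rV[R]_3) : frame p e -> frame p' e' ->
  mink e e = mink e' e' ->
  mink (transport p e p' e' c) d = mink c (transport p' e' p e d).
Proof.
move=> fr fr' ee.
by rewrite -{1}(transportK fr' fr (esym ee) d) transport_mink.
Qed.

Variables (U : set 'rV[R]_2) (oU : open U).

Let nU x : U x -> \forall y \near x, U y.
Proof. by move=> Ux; exact: open_nbhs_nbhs. Qed.

Lemma plane_tangent (g : 'rV[R]_2 -> 'rV[R]_3) n x v : smooth_on U g ->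
  (forall x, U x -> mink n (g x) = 0) -> U x -> mink n ('D_v g x) = 0.
Proof.
move=> sg ng Ux.
have h := is_derive_mink (is_derive_cst n x v) (smooth_is_derive v sg Ux).
have h0 : is_derive x v (fun y => mink (cst n y) (g y)) 0.
  apply: near_eq_is_derive (is_derive_cst (0 : R) x v).
  by apply: filterS (nU Ux) => y Uy /=; rewrite ng.
by have := is_derive_unique h h0; rewrite mink0l add0r.
Qed.

Lemma graph_tangent (g1 g2 : 'rV[R]_2 -> 'rV[R]_3) p e p' e' x v :
  smooth_on U g1 -> smooth_on U g2 ->
  frame p e -> frame p' e' -> mink e e = mink e' e' ->
  (forall x, U x -> g2 x = transport p e p' e' (g1 x)) -> U x ->
  'D_v g2 x = transport p e p' e' ('D_v g1 x).
Proof.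
move=> sg1 sg2 fr fr' ee gE Ux; apply: mink_ext => d.
have h2 := is_derive_mink (smooth_is_derive v sg2 Ux) (is_derive_cst d x v).
have h1 := is_derive_mink (smooth_is_derive v sg1 Ux)
  (is_derive_cst (transport p' e' p e d) x v).
have h : is_derive x v (fun y => mink (g2 y) (cst d y))
   (mink ('D_v g1 x) (transport p' e' p e d) + mink (g1 x) 0).
  apply: near_eq_is_derive h1; apply: filterS (nU Ux) => y Uy /=.
  by rewrite gE// transport_adjoint.
have := is_derive_unique h2 h; rewrite !mink0r !addr0 => ->.
by rewrite transport_adjoint.
Qed.

Variables (g1 g2 : 'rV[R]_2 -> 'rV[R]_3).
Hypotheses (sg1 : smooth_on U g1) (sg2 : smooth_on U g2).
Hypothesis hg1 : forall x, U x -> hyp (-1) (g1 x).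
Hypothesis hg2 : forall x, U x -> hyp (-1) (g2 x).
Hypothesis inj : forall x, U x -> forall v, 'D_v g1 x = 0 -> 'D_v g2 x = 0 -> v = 0.

Lemma mink_pos_neq0 (n : 'rV[R]_3) : 0 < mink n n -> n != 0.
Proof. by apply: contraTneq => ->; rewrite mink0l ltxx. Qed.

Lemma plane_area0 (g : 'rV[R]_2 -> 'rV[R]_3) n x u v : smooth_on U g -> n != 0 ->
  (forall x, U x -> mink n (g x) = 0) -> U x -> area g x u v = 0.
Proof.
move=> sg n0 ng Ux; apply: (coplanar_det0 n0); first exact: ng.
  exact: plane_tangent.
exact: plane_tangent.
Qed.

(** If g1 had zero derivative, a direction killed by g2 would contradict the
    immersion. *)
Lemma first_nonconstant x : U x -> area g2 x (row2 1 0) (row2 0 1) = 0 ->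
  exists w, 'D_w g1 x != 0.
Proof.
move=> Ux a0; have [u u0 Du] := area_rank1 oU sg2 hg2 Ux a0.
exists u; apply: contraNneq u0 => Du1; apply/eqP; exact: (inj Ux Du1 Du).
Qed.

Lemma second_nonconstant x : U x -> area g1 x (row2 1 0) (row2 0 1) = 0 ->
  exists w, 'D_w g2 x != 0.
Proof.
move=> Ux a0; have [u u0 Du] := area_rank1 oU sg1 hg1 Ux a0.
exists u; apply: contraNneq u0 => Du2; apply/eqP; exact: (inj Ux Du Du2).
Qed.

Lemma frame_of_derivative (g : 'rV[R]_2 -> 'rV[R]_3) x w : smooth_on U g ->
  (forall x, U x -> hyp (-1) (g x)) -> U x -> 'D_w g x != 0 -> frame (g x) ('D_w g x).
Proof.
move=> sg hg Ux w0; have t := hyp_map_tangent oU sg hg w Ux.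
by split=> //; [exact: hg|exact: hyp_tangent_gt0 (hg _ Ux) t w0].
Qed.

(** The plane of each factor is spanned by the position vector and one nonzero
    derivative, so it can be read off the surface. *)
Lemma planes_eq x n1 n2 m1 m2 : U x ->
  0 < mink n1 n1 -> 0 < mink n2 n2 -> 0 < mink m1 m1 -> 0 < mink m2 m2 ->
  (forall x, U x -> planes n1 n2 (g1 x, g2 x)) ->
  (forall x, U x -> planes m1 m2 (g1 x, g2 x)) -> planes n1 n2 = planes m1 m2.
Proof.
move=> Ux /mink_pos_neq0 n1p /mink_pos_neq0 n2p /mink_pos_neq0 m1p /mink_pos_neq0 m2p hn hm.
have hn1 y (Uy : U y) := (hn y Uy).1; have hn2 y (Uy : U y) := (hn y Uy).2.
have hm1 y (Uy : U y) := (hm y Uy).1; have hm2 y (Uy : U y) := (hm y Uy).2.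
have [w1 w10] := first_nonconstant Ux (plane_area0 _ _ sg2 n2p hn2 Ux).
have [w2 w20] := second_nonconstant Ux (plane_area0 _ _ sg1 n1p hn1 Ux).
have f1 := frame_of_derivative sg1 hg1 Ux w10.
have f2 := frame_of_derivative sg2 hg2 Ux w20.
have N1 := plane_normal f1 n1p (hn1 _ Ux) (plane_tangent w1 sg1 hn1 Ux).
have M1 := plane_normal f1 m1p (hm1 _ Ux) (plane_tangent w1 sg1 hm1 Ux).
have N2 := plane_normal f2 n2p (hn2 _ Ux) (plane_tangent w2 sg2 hn2 Ux).
have M2 := plane_normal f2 m2p (hm2 _ Ux) (plane_tangent w2 sg2 hm2 Ux).
apply/seteqP; split=> q [q1 q2]; split.
- by apply/M1/N1.
- by apply/M2/N2.
- by apply/N1/M1.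
- by apply/N2/M2.
Qed.

(** A factor in a plane kills some direction, and on a graph the other factor kills
    it too. *)
Lemma planes_not_graph x n1 n2 p e p' e' : U x ->
  0 < mink n1 n1 -> frame p e -> frame p' e' -> mink e e = mink e' e' ->
  (forall x, U x -> planes n1 n2 (g1 x, g2 x)) ->
  (forall x, U x -> graph p e p' e' (g1 x, g2 x)) -> False.
Proof.
move=> Ux /mink_pos_neq0 n1p fr fr' ee hn hm.
have hn1 y (Uy : U y) := (hn y Uy).1.
have [u u0 Du] := area_rank1 oU sg1 hg1 Ux (plane_area0 _ _ sg1 n1p hn1 Ux).
move/eqP: u0; apply; apply: (inj Ux Du).
rewrite (graph_tangent u sg1 sg2 fr fr' ee hm Ux) Du.
exact: transport0.
Qed.

(** A Lorentz transformation that respects the cross product is determined by two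
    independent vectors, here the position and one derivative of the first factor. *)
Lemma graph_eq x p e p' e' q f q' f' : U x ->
  frame p e -> frame p' e' -> mink e e = mink e' e' ->
  frame q f -> frame q' f' -> mink f f = mink f' f' ->
  (forall x, U x -> graph p e p' e' (g1 x, g2 x)) ->
  (forall x, U x -> graph q f q' f' (g1 x, g2 x)) ->
  graph p e p' e' = graph q f q' f'.
Proof.
move=> Ux fp fp' ee fq fq' ff hp hq.
have [w w0] : exists w, 'D_w g1 x != 0.
  exists (row2 1 0); apply/eqP => h.
  have : row2 1 0 = 0 :> 'rV[R]_2.
    apply: (inj Ux h); rewrite (graph_tangent _ sg1 sg2 fp fp' ee hp Ux) h.
    exact: transport0.
  by move=> /row2_eq0[/eqP]; rewrite oner_eq0.
have f1 := frame_of_derivative sg1 hg1 Ux w0.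
have Tb : transport p e p' e' (g1 x) = transport q f q' f' (g1 x).
  by rewrite -[LHS](hp _ Ux) -[RHS](hq _ Ux).
have Te : transport p e p' e' ('D_w g1 x) = transport q f q' f' ('D_w g1 x).
  by rewrite -(graph_tangent w sg1 sg2 fp fp' ee hp Ux) -(graph_tangent w sg1 sg2 fq fq' ff hq Ux).
suff TT c : transport p e p' e' c = transport q f q' f' c.
  by apply/seteqP; split=> z /=; rewrite /graph /= TT.
move: f1 Tb Te; move: (g1 x) ('D_w g1 x) => a b [/hyp_self aa ab b0] Tb Te.
have b1 : mink b b != 0 by rewrite gt_eqF.
have cE : c = (mink b c / mink b b) *: b + ((mink (lcross a b) c / mink b b) *: lcross a b
   + ((- mink a c) *: a + 0)).
  apply: (scalerI b1); rewrite (frame_decomposition c aa ab) addr0 !scalerDr !scalerA.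
  by rewrite mulrN scaleNr addrA; congr (_ *: _ + _ *: _ - _); field.
rewrite cE !transportP !transport0 Tb Te !transport_lcross//.
by rewrite Tb Te.
Qed.

Lemma model_unique x Q Q' : U x -> model Q -> model Q' ->
  (forall x, U x -> Q (g1 x, g2 x)) -> (forall x, U x -> Q' (g1 x, g2 x)) -> Q = Q'.
Proof.
move=> Ux [[n1 [n2 [n1p n2p ->]]]|[p [e [p' [e' [fp fp' ee ->]]]]]]
  [[m1 [m2 [m1p m2p ->]]]|[q [f [q' [f' [fq fq' ff ->]]]]]] hQ hQ'.
- exact: (planes_eq Ux).
- by have := planes_not_graph Ux n1p fq fq' ff hQ hQ'.
- by have := planes_not_graph Ux m1p fp fp' ee hQ' hQ.
- exact: (graph_eq Ux).
Qed.

End ModelOfSurface.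

(** * Existence of the model near a point *)

Section LocalModel.
Context {R : realType}.
Variables (U : set 'rV[R]_2) (g1 g2 : 'rV[R]_2 -> 'rV[R]_3).
Hypotheses (oU : open U) (sg1 : smooth_on U g1) (sg2 : smooth_on U g2).
Hypothesis hg1 : forall x, U x -> hyp (-1) (g1 x).
Hypothesis hg2 : forall x, U x -> hyp (-1) (g2 x).
(* Total geodesy: up to the position vectors, the second derivatives are tangent,
   with a common direction y for both factors. *)
Hypothesis tg : forall x, U x -> forall u v, exists y,
  'D_u (fun z => 'D_v g1 z) x = 'D_y g1 x + mink ('D_u g1 x) ('D_v g1 x) *: g1 x /\
  'D_u (fun z => 'D_v g2 z) x = 'D_y g2 x + mink ('D_u g2 x) ('D_v g2 x) *: g2 x.
Hypothesis lag : forall x, U x -> forall u v, area g1 x u v = area g2 x u v.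
Hypothesis inj : forall x, U x -> forall v, 'D_v g1 x = 0 -> 'D_v g2 x = 0 -> v = 0.

Let gram (g : 'rV[R]_2 -> 'rV[R]_3) x u v : R := mink ('D_u g x) ('D_v g x).

Let gram_near (g : 'rV[R]_2 -> 'rV[R]_3) x u v : smooth_on U g -> U x ->
  {for x, continuous (fun y => gram g y u v)}.
Proof.
move=> sg Ux; apply: mink_continuous.
  exact: (smooth_continuous (smooth_derive u sg) Ux).
exact: (smooth_continuous (smooth_derive v sg) Ux).
Qed.

(** The area form squared is the Gram determinant.  It serves to make the nonvanishing of
    the area an open condition on first derivatives. *)
Lemma area_sqr (g : 'rV[R]_2 -> 'rV[R]_3) x u v : smooth_on U g ->
  (forall x, U x -> hyp (-1) (g x)) -> U x ->
  area g x u v * area g x u v = gram g x u u * gram g x v v - gram g x u v * gram g x u v.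
Proof.
move=> sg hg Ux; rewrite /gram /area.
have pp := hyp_self (hg _ Ux).
have := hyp_map_tangent oU sg hg v Ux; have := hyp_map_tangent oU sg hg u Ux.
move: (g x) ('D_u g x) ('D_v g x) pp => p a b pp pa pb.
have := mink_lcross_lcross a b a b.
rewrite {1 2}(lcross_tangent pp pa pb) !minkE pp (minkC b a) => h.
by lra.
Qed.

Lemma continuous_neq0_near (T : topologicalType) (k : T -> R) x :
  {for x, continuous k} -> k x != 0 -> \forall y \near x, k y != 0.
Proof. by move=> ck k0; exact: (cvgr_neq0 _ ck k0). Qed.

Lemma ball_of_near (P : set 'rV[R]_2) x : (\forall y \near x, P y) ->
  exists2 r : R, 0 < r & ball x r `<=` P.
Proof. by move=> /nbhs_ballP[r r0 rP]; exists r. Qed.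

Lemma near_derive_neq0 (g : 'rV[R]_2 -> 'rV[R]_3) x w : smooth_on U g ->
  (forall x, U x -> hyp (-1) (g x)) -> U x -> 'D_w g x != 0 ->
  \forall y \near x, 'D_w g y != 0.
Proof.
move=> sg hg Ux w0.
have [_ _ ww] := frame_of_derivative oU sg hg Ux w0.
have : gram g x w w != 0 by rewrite gt_eqF.
move=> /(continuous_neq0_near (@gram_near g x w w sg Ux)); apply: filterS => y.
by apply: contraNneq => h; rewrite /gram h mink0l.
Qed.

(** A direction killed by g1 has positive length in the second factor. *)
Lemma gram_neq_of_area0 x : U x -> area g1 x (row2 1 0) (row2 0 1) = 0 ->
  exists u v, gram g1 x u v - gram g2 x u v != 0.
Proof.
move=> Ux a0; have [u u0 Du] := area_rank1 oU sg1 hg1 Ux a0.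
exists u, u; apply: contraNneq u0 => h; apply/eqP; apply: (inj Ux Du).
have [_ hz] := hyp_tangent_pos (hg2 Ux) (hyp_map_tangent oU sg2 hg2 u Ux).
apply: hz; move: h; rewrite /gram Du mink0l sub0r => /eqP.
by rewrite oppr_eq0 => /eqP.
Qed.

Lemma planar_near (g : 'rV[R]_2 -> 'rV[R]_3) x w : smooth_on U g ->
  (forall x, U x -> hyp (-1) (g x)) ->
  (forall x, U x -> forall u v, exists y, 'D_u (fun z => 'D_v g z) x =
     'D_y g x + mink ('D_u g x) ('D_v g x) *: g x) ->
  U x -> (\forall y \near x, forall u v, area g y u v = 0) -> 'D_w g x != 0 ->
  exists n, 0 < mink n n /\ \forall y \near x, mink n (g y) = 0.
Proof.
move=> sg hg tgg Ux a0 w0.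
have fr := frame_of_derivative oU sg hg Ux w0.
exists (lcross (g x) ('D_w g x)); split.
  by have [_ _ ->] := frame_lcross fr; case: fr.
have nU : \forall y \near x, U y by exact: open_nbhs_nbhs.
have [r r0 rP] := ball_of_near (filterI nU (filterI a0 (near_derive_neq0 sg hg Ux w0))).
have BU : ball x r `<=` U by move=> y /rP[].
apply/nbhs_ballP; exists r => //.
have ob : open (ball x r) by exact: ball_open.
have xB : ball x r x by exact: ballxx.
apply: (@rank1_planar R (ball x r) g ob (smooth_subset BU sg) (fun y h => hg _ (BU y h))
  x w xB _ _ _ r (fun y h => h)).
- move=> y yB u v.
  have Uy := BU _ yB; have [_ [h _]] := rP _ yB.
  rewrite (lcross_tangent (hyp_self (hg _ Uy)) (hyp_map_tangent oU sg hg _ Uy)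
    (hyp_map_tangent oU sg hg _ Uy)).
  by rewrite -/(area g y u v) h oppr0 scale0r.
- by move=> y /BU; exact: tgg.
- by move=> y /rP[_ []].
Qed.

(** Near x the area is nonzero if it is so at x.  If the area vanishes at x, the
    two metrics differ at x, hence near x, and [codazzi_isometric] makes the area
    vanish near x as well. *)
Lemma local_model x : U x -> exists2 Q, model Q &
  \forall y \near x, Q (g1 y, g2 y).
Proof.
move=> Ux.
have nU : \forall y \near x, U y by exact: open_nbhs_nbhs.
have [a0|a0] := eqVneq (area g1 x (row2 1 0) (row2 0 1)) 0.
  have [u [v uv]] := gram_neq_of_area0 Ux a0.
  have cuv : {for x, continuous (fun y => gram g1 y u v - gram g2 y u v)}.
    apply: continuousB; exact: gram_near.
  have nz : \forall y \near x, forall s t, area g1 y s t = 0.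
    have := continuous_neq0_near cuv uv; move: nU; apply: filterS2 => y Uy hy s t.
    apply/eqP; apply: contraNT hy => st.
    rewrite subr_eq0; apply/eqP.
    exact: (codazzi_isometric oU sg1 sg2 hg1 hg2 tg lag Uy st).
  have nz2 : \forall y \near x, forall s t, area g2 y s t = 0.
    move: nz; move: nU; apply: filterS2 => y Uy hy s t.
    exact: (etrans (esym (lag Uy s t)) (hy s t)).
  have a20 : area g2 x (row2 1 0) (row2 0 1) = 0 := etrans (esym (lag Ux _ _)) a0.
  have [w1 w10] := first_nonconstant oU sg2 hg2 inj Ux a20.
  have [w2 w20] := second_nonconstant oU sg1 hg1 inj Ux a0.
  have tg1 y : U y -> forall s t, exists z, 'D_s (fun z => 'D_t g1 z) y =
     'D_z g1 y + mink ('D_s g1 y) ('D_t g1 y) *: g1 y.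
    by move=> Uy s t; have [z [zE _]] := tg Uy s t; exists z.
  have tg2 y : U y -> forall s t, exists z, 'D_s (fun z => 'D_t g2 z) y =
     'D_z g2 y + mink ('D_s g2 y) ('D_t g2 y) *: g2 y.
    by move=> Uy s t; have [z [_ zE]] := tg Uy s t; exists z.
  have [n1 [n1p h1]] := planar_near sg1 hg1 tg1 Ux nz w10.
  have [n2 [n2p h2]] := planar_near sg2 hg2 tg2 Ux nz2 w20.
  exists (planes n1 n2); first by left; exists n1, n2.
  by move: h1 h2; apply: filterS2 => y.
pose d y := gram g1 y (row2 1 0) (row2 1 0) * gram g1 y (row2 0 1) (row2 0 1)
    - gram g1 y (row2 1 0) (row2 0 1) * gram g1 y (row2 1 0) (row2 0 1).
have dE y (Uy : U y) := area_sqr (row2 1 0) (row2 0 1) sg1 hg1 Uy : _ = d y.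
have d0 : d x != 0 := eq_ind _ (fun z : R => z != 0) (mulf_neq0 a0 a0) _ (dE x Ux).
have cd : {for x, continuous d}.
  by apply: continuousB; apply: continuousM; exact: gram_near.
have nz : \forall y \near x, area g1 y (row2 1 0) (row2 0 1) != 0.
  have := continuous_neq0_near cd d0; move: nU; apply: filterS2 => y Uy.
  by apply: contraNneq => h; apply/eqP; apply: (etrans (esym (dE y Uy))); rewrite h mul0r.
have isom y : U y -> area g1 y (row2 1 0) (row2 0 1) != 0 ->
   forall s t, gram g1 y s t = gram g2 y s t.
  by move=> Uy ay s t; exact: (codazzi_isometric oU sg1 sg2 hg1 hg2 tg lag Uy ay).
pose w : 'rV[R]_2 := row2 1 0.
have wn0 y : area g1 y (row2 1 0) (row2 0 1) != 0 -> 'D_w g1 y != 0.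
  apply: contraNneq => h; rewrite /area -/w h.
  by rewrite lcrossC lcross0r oppr0 mink0r.
have [r r0 rP] := ball_of_near (filterI nU nz).
have BU : ball x r `<=` U by move=> y /rP[].
have ob : open (ball x r) by exact: ball_open.
have xB : ball x r x by exact: ballxx.
have f1 := frame_of_derivative oU sg1 hg1 Ux (wn0 x a0).
have f2 : frame (g2 x) ('D_w g2 x).
  apply: (frame_of_derivative oU sg2 hg2 Ux); apply/eqP => h.
  have g0 : gram g1 x w w = 0 by apply: (etrans (isom _ Ux a0 w w)); rewrite /gram h mink0l.
  by case: (f1) => _ _; rewrite -[X in 0 < X]/(gram g1 x w w) g0 ltxx.
exists (graph (g1 x) ('D_w g1 x) (g2 x) ('D_w g2 x)).
  right; exists (g1 x), ('D_w g1 x), (g2 x), ('D_w g2 x); split => //.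
  exact: (isom _ Ux a0 w w).
apply/nbhs_ballP; exists r => // y yB.
apply: (@transport_constant R (ball x r) g1 g2 ob (smooth_subset BU sg1)
  (smooth_subset BU sg2) (fun y h => hg1 (BU y h)) (fun y h => hg2 (BU y h))
  x w r (fun y h => h) _ _ _ _ y yB).
- by move=> z zB; have [Uz az] := rP _ zB; exact: isom.
- by move=> z /BU; exact: lag.
- by move=> z /BU; exact: tg.
- by move=> z /rP[_]; exact: wn0.
Qed.

End LocalModel.

(** * Parametrizations of surfaces in the product *)

Section Parametrizations.
Context {R : realType}.
Notation E := ('rV[R]_3 * 'rV[R]_3)%type.

Lemma hyp_J1 (p v : 'rV[R]_3) : hyp_J (-1) p v = lcross p v.
Proof. by rewrite /hyp_J opprK sqrtr1 scale1r. Qed.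

Lemma pairP (p q : E) : p.1 = q.1 -> p.2 = q.2 -> p = q.
Proof. by case: p q => [? ?] [? ?] /= -> ->. Qed.

Lemma HH_tangent_eq0 (p d : E) : HH p -> HH_tangent p d -> ip d d = 0 -> d = 0.
Proof.
move=> [h1 h2] [T1 T2]; have [p1 z1] := hyp_tangent_pos h1 T1.
have [p2 z2] := hyp_tangent_pos h2 T2.
move=> /eqP; rewrite /ip paddr_eq0// => /andP[/eqP e1 /eqP e2].
by apply: pairP; [exact: z1|exact: z2].
Qed.

Lemma ip_HH_J (p a b : E) : ip (HH_J p a) b =
  mink p.1 (lcross a.1 b.1) - mink p.2 (lcross a.2 b.2).
Proof.
rewrite /ip /HH_J /= !hyp_J1 minkNl (minkC _ b.1) (minkC _ b.2).
by rewrite (mink_lcross_rot b.1) (mink_lcross_rot b.2).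
Qed.

Variables (U : set 'rV[R]_2) (f : 'rV[R]_2 -> E).
Hypotheses (oU : open U) (sf : smooth_on U f) (hf : forall x, U x -> HH (f x)).

Definition proj1 y := (f y).1.
Definition proj2 y := (f y).2.

Lemma smooth_proj1 : smooth_on U proj1. Proof. exact: smooth_fst. Qed.
Lemma smooth_proj2 : smooth_on U proj2. Proof. exact: smooth_snd. Qed.
Lemma hyp_proj1 x : U x -> hyp (-1) (proj1 x). Proof. by move=> /hf[]. Qed.
Lemma hyp_proj2 x : U x -> hyp (-1) (proj2 x). Proof. by move=> /hf[]. Qed.

Lemma derive_proj1 x v : U x -> ('D_v f x).1 = 'D_v proj1 x.
Proof. by move=> Ux; case: (is_derive_fst (smooth_is_derive v sf Ux)). Qed.

Lemma derive_proj2 x v : U x -> ('D_v f x).2 = 'D_v proj2 x.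
Proof. by move=> Ux; case: (is_derive_snd (smooth_is_derive v sf Ux)). Qed.

Let nU x : U x -> \forall y \near x, U y.
Proof. by move=> Ux; exact: open_nbhs_nbhs. Qed.

Lemma derive_tangent x v : U x -> HH_tangent (f x) ('D_v f x).
Proof.
move=> Ux; split.
  have := hyp_map_tangent oU smooth_proj1 hyp_proj1 v Ux.
  exact: (etrans (congr1 (mink (f x).1) (derive_proj1 v Ux))).
have := hyp_map_tangent oU smooth_proj2 hyp_proj2 v Ux.
exact: (etrans (congr1 (mink (f x).2) (derive_proj2 v Ux))).
Qed.

Lemma derive2_proj1 x v w : U x ->
  ('D_v (fun y => 'D_w f y) x).1 = 'D_v (fun y => 'D_w proj1 y) x.
Proof.
move=> Ux; have [_ <-] := is_derive_fst (smooth_is_derive v (smooth_derive w sf) Ux).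
apply: near_eq_derive; apply: filterS (nU Ux) => y; exact: derive_proj1.
Qed.

Lemma derive2_proj2 x v w : U x ->
  ('D_v (fun y => 'D_w f y) x).2 = 'D_v (fun y => 'D_w proj2 y) x.
Proof.
move=> Ux; have [_ <-] := is_derive_snd (smooth_is_derive v (smooth_derive w sf) Ux).
apply: near_eq_derive; apply: filterS (nU Ux) => y; exact: derive_proj2.
Qed.

Lemma derive_linear_proj x (s : R) u v : U x ->
  'D_(s *: u + v) f x = s *: 'D_u f x + 'D_v f x.
Proof.
move=> Ux; apply: pairP.
  apply: (etrans (derive_proj1 _ Ux)).
  apply: (etrans (smooth_derive_linear s u v oU smooth_proj1 Ux)).
  by rewrite -!derive_proj1.
apply: (etrans (derive_proj2 _ Ux)).
apply: (etrans (smooth_derive_linear s u v oU smooth_proj2 Ux)).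
by rewrite -!derive_proj2.
Qed.

Lemma HH_nabla1 x v w : U x -> (HH_nabla f x v w).1 =
  'D_v (fun y => 'D_w proj1 y) x - mink ('D_v proj1 x) ('D_w proj1 x) *: proj1 x.
Proof.
move=> Ux; rewrite -(hyp_map_proj oU smooth_proj1 hyp_proj1 v w Ux).
by rewrite /HH_nabla /HH_proj /= derive2_proj1.
Qed.

Lemma HH_nabla2 x v w : U x -> (HH_nabla f x v w).2 =
  'D_v (fun y => 'D_w proj2 y) x - mink ('D_v proj2 x) ('D_w proj2 x) *: proj2 x.
Proof.
move=> Ux; rewrite -(hyp_map_proj oU smooth_proj2 hyp_proj2 v w Ux).
by rewrite /HH_nabla /HH_proj /= derive2_proj2.
Qed.

Lemma ipC (a b : E) : ip a b = ip b a.
Proof. by rewrite /ip minkC (minkC a.2). Qed.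

Lemma ip_linear (s : R) (a b c : E) : ip (s *: a + b) c = s * ip a c + ip b c.
Proof. by rewrite /ip /= !minkE; ring. Qed.

Lemma tangent_part_tangent x a : U x -> exists y, tangent_part f x a = 'D_y f x.
Proof.
move=> Ux; rewrite /tangent_part /coord_frame.
have comb (s t : E) (k : R) : (exists y, s = 'D_y f x) -> (exists y, t = 'D_y f x) ->
    exists y, k *: s + t = 'D_y f x.
  by move=> [y ->] [z ->]; exists (k *: y + z); rewrite derive_linear_proj.
apply: (big_ind (fun z : E => exists y, z = 'D_y f x)); first by exists 0; rewrite derive0.
  by move=> s t hs ht; have := comb s t 1 hs ht; rewrite scale1r.
move=> i _; apply: (big_ind (fun z : E => exists y, z = 'D_y f x)); first by exists 0; rewrite derive0.
  by move=> s t hs ht; have := comb s t 1 hs ht; rewrite scale1r.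
move=> j _; have := comb ('D_(delta_mx 0 j) f x) 0 (invmx (first_form f x) i j * ip a ('D_(delta_mx 0 i) f x)).
rewrite addr0; apply; first by exists (delta_mx 0 j).
by exists 0; rewrite derive0.
Qed.

Lemma second_form0_tangent x v w : U x -> second_form f x v w = 0 ->
  exists y, HH_nabla f x v w = 'D_y f x.
Proof.
move=> Ux; rewrite /second_form => /eqP; rewrite subr_eq0 => /eqP ->.
exact: tangent_part_tangent.
Qed.

Hypothesis inj : forall x, U x -> injective (fun v : 'rV[R]_2 => 'D_v f x).

Lemma derive_kernel x v : U x -> 'D_v f x = 0 -> v = 0.
Proof. by move=> Ux h; apply: (inj Ux); rewrite derive0. Qed.

Lemma ip_tangent_eq0 x v : U x -> ip ('D_v f x) ('D_v f x) = 0 -> v = 0.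
Proof.
move=> Ux /(HH_tangent_eq0 (hf Ux) (derive_tangent v Ux)); exact: derive_kernel.
Qed.

Lemma derive_coord_sum x v : U x -> 'D_v f x = \sum_i v 0 i *: coord_frame f x i.
Proof.
move=> Ux; rewrite {1}[v]row_sum_delta.
elim/big_rec2: _ => [|i a b _ <-]; first exact: derive0.
by rewrite derive_linear_proj.
Qed.

Lemma ip_sum (I : finType) (k : I -> R) (a : I -> E) c :
  ip (\sum_i k i *: a i) c = \sum_i k i * ip (a i) c.
Proof.
elim/big_rec2: _ => [|i s t _ <-]; first by rewrite /ip !mink0l addr0.
exact: ip_linear.
Qed.

(** A row vector in the kernel of the Gram matrix is a tangent vector orthogonal to
    all tangent vectors. *)
Lemma first_form_unit x : U x -> first_form f x \in unitmx.
Proof.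
move=> Ux; rewrite -row_free_unit -kermx_eq0; apply/eqP/row_matrixP => i.
rewrite row0; have := row_sub i (kermx (first_form f x)).
move: (row i _) => u /sub_kermxP uG; apply: (ip_tangent_eq0 Ux).
have h j : ip ('D_u f x) (coord_frame f x j) = 0.
  rewrite (derive_coord_sum u Ux) ip_sum.
  have e := congr1 (fun M : 'rV[R]_2 => M 0 j) uG; rewrite !mxE in e.
  apply: (etrans _ e); by apply: eq_bigr => k _; rewrite mxE.
rewrite {1}(derive_coord_sum u Ux) ip_sum big1// => j _.
by rewrite ipC h mulr0.
Qed.

Lemma tangent_part_id x y : U x -> tangent_part f x ('D_y f x) = 'D_y f x.
Proof.
move=> Ux; have Gu := first_form_unit Ux; rewrite /tangent_part.
have h i : ip ('D_y f x) (coord_frame f x i) = (y *m first_form f x) 0 i.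
  rewrite (derive_coord_sum y Ux) ip_sum mxE.
  by apply: eq_bigr => k _; rewrite mxE.
rewrite [RHS](derive_coord_sum y Ux) exchange_big/=; apply: eq_bigr => j _.
rewrite -scaler_suml; congr (_ *: _).
have -> : y 0 j = (y *m first_form f x *m invmx (first_form f x)) 0 j.
  by rewrite mulmxK.
by rewrite [RHS]mxE; apply: eq_bigr => i _; rewrite h mulrC.
Qed.

(** Together with [second_form0_tangent] this reduces total geodesy to the existence
    of a coordinate direction, without Gram matrices. *)
Lemma second_form0_of_tangent x v w y : U x -> HH_nabla f x v w = 'D_y f x ->
  second_form f x v w = 0.
Proof.
by move=> Ux h; rewrite /second_form h tangent_part_id// subrr.
Qed.

Lemma proj_inj x v : U x -> 'D_v proj1 x = 0 -> 'D_v proj2 x = 0 -> v = 0.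
Proof.
move=> Ux h1 h2; apply: (derive_kernel Ux); apply: pairP.
  exact: (etrans (derive_proj1 v Ux)).
exact: (etrans (derive_proj2 v Ux)).
Qed.

Lemma totally_geodesic_proj x u v : U x -> second_form f x u v = 0 -> exists y,
  'D_u (fun z => 'D_v proj1 z) x = 'D_y proj1 x + mink ('D_u proj1 x) ('D_v proj1 x) *: proj1 x /\
  'D_u (fun z => 'D_v proj2 z) x = 'D_y proj2 x + mink ('D_u proj2 x) ('D_v proj2 x) *: proj2 x.
Proof.
move=> Ux /(second_form0_tangent Ux)[y h]; exists y; split.
  have := congr1 fst h; rewrite HH_nabla1// derive_proj1// => /eqP.
  by rewrite subr_eq => /eqP.
have := congr1 snd h; rewrite HH_nabla2// derive_proj2// => /eqP.
by rewrite subr_eq => /eqP.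
Qed.

(** By [ip_HH_J] the vanishing of <J D_u f, D_v f> is the equality of the two areas. *)
Lemma lagrangian_area x u v : U x ->
  HH_J (f x) @` tangent_plane f x = normal_plane f x ->
  area proj1 x u v = area proj2 x u v.
Proof.
move=> Ux JN.
have : normal_plane f x (HH_J (f x) ('D_u f x)).
  by rewrite -JN; exists ('D_u f x) => //; exists u.
move=> [_ /(_ ('D_v f x))] /(_ (ex_intro2 _ _ v I erefl)).
rewrite ip_HH_J => /eqP; rewrite subr_eq0 => /eqP h.
have e1 : _ = area proj1 x u v := congr2 (fun a b => mink (f x).1 (lcross a b))
  (derive_proj1 u Ux) (derive_proj1 v Ux).
have e2 : _ = area proj2 x u v := congr2 (fun a b => mink (f x).2 (lcross a b))
  (derive_proj2 u Ux) (derive_proj2 v Ux).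
exact: (etrans (esym e1) (etrans h e2)).
Qed.

End Parametrizations.

(** * From charts to the whole surface *)

Section Surfaces.
Context {R : realType} {S : smooth_surface R}.
Variable Phi : S -> 'rV[R]_3 * 'rV[R]_3.
Notation E := ('rV[R]_3 * 'rV[R]_3)%type.

Implicit Types (c : @chart R S) (m : S).

Notation cod c := (@chart_cod R S c).
Notation param c := (Phi \o @chart_inv R S c).

Lemma chart_cod_open c : atlas c -> open (cod c).
Proof. by move=> /atlas_chart[]. Qed.

Lemma chart_cod_map c m : chart_dom c m -> cod c (chart_map c m).
Proof. by exists m. Qed.

Lemma chart_invK c m : atlas c -> chart_dom c m -> chart_inv c (chart_map c m) = m.
Proof. by move=> /atlas_chart[_ _ h _ _]; exact: h. Qed.

Lemma near_of_chart (P : set E) c m : atlas c -> chart_dom c m ->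
  (\forall y \near chart_map c m, P (param c y)) -> \forall m' \near m, P (Phi m').
Proof.
move=> ac dm h; have [od _ inv cm _] := atlas_chart ac.
have nd : \forall m' \near m, chart_dom c m' by exact: open_nbhs_nbhs.
have := cm _ dm _ h; rewrite /= => h'.
have {}h' : \forall m' \near m, P (param c (chart_map c m')) by exact: h'.
by move: h' nd; apply: filterS2 => m' + dm'; rewrite /= inv.
Qed.

Lemma near_in_chart (P : set E) c m : atlas c -> chart_dom c m ->
  (\forall m' \near m, P (Phi m')) -> \forall y \near chart_map c m, P (param c y).
Proof.
move=> ac dm h; have [_ _ inv _ ci] := atlas_chart ac.
have := ci _ (chart_cod_map dm); rewrite /prop_for /continuous_at inv// => cm.
exact: (cm _ h).
Qed.

Section Immersed.
Hypothesis imm : is_immersion Phi.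

Lemma param_smooth c : atlas c -> smooth_on (cod c) (param c).
Proof. by move=> ac; have [_ /(_ c ac)[]] := imm. Qed.

Lemma param_HH c x : HH (param c x).
Proof. by have [h _] := imm; exact: h. Qed.

Lemma param_inj c : atlas c -> forall x, cod c x ->
  injective (fun v : 'rV[R]_2 => 'D_v (param c) x).
Proof. by move=> ac; have [_ /(_ c ac)[]] := imm. Qed.

(** When a and b are coordinates on T along the surface, the points whose
    coordinates are attained form an open set cutting the surface out of T.  This open
    set is a union of fibres of (a, b), a fact used to transport it by an isometry. *)
Lemma range_open_part (T : set E) (a b : E -> R) :
  continuous a -> continuous b ->
  (forall m, T (Phi m)) ->
  (forall p q, T p -> T q -> a p = a q -> b p = b q -> p = q) ->
  (forall c x, atlas c -> cod c x ->
     differentiable (a \o param c) x /\ differentiable (b \o param c) x) ->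
  (forall c x v, atlas c -> cod c x ->
     'D_v (a \o param c) x = 0 -> 'D_v (b \o param c) x = 0 -> v = 0) ->
  exists2 V : set E, open V & range Phi = T `&` V /\
    (forall p q, a p = a q -> b p = b q -> V p -> V q).
Proof.
move=> ca cb TPhi abinj abdiff abrank.
exists [set p | exists m, a p = a (Phi m) /\ b p = b (Phi m)].
  rewrite openE => p [m [am bm]]; rewrite /interior.
  have [c ac dm] := atlas_cover m.
  have Ux := chart_cod_map dm.
  have [e e0 eP] := @open_image R (a \o param c) (b \o param c) (cod c) _
    (chart_cod_open ac) Ux (fun y Uy => abdiff c y ac Uy)
    (fun y Uy v => abrank c y v ac Uy).
  have aE : (a \o param c) (chart_map c m) = a p by rewrite /= chart_invK.
  have bE : (b \o param c) (chart_map c m) = b p by rewrite /= chart_invK.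
  rewrite aE bE in eP.
  have na : \forall q \near p, `|a p - a q| < e by move/cvgrPdist_lt : (ca p); exact.
  have nb : \forall q \near p, `|b p - b q| < e by move/cvgrPdist_lt : (cb p); exact.
  move: na nb; apply: filterS2 => q qa qb.
  rewrite distrC in qa; rewrite distrC in qb.
  have [y [_ ya yb]] := eP _ _ qa qb.
  by exists (chart_inv c y); rewrite -ya -yb.
split.
  apply/seteqP; split=> [p [m _ <-]|p [Tp [m [am bm]]]].
    by split; [exact: TPhi|exists m].
  by exists m => //; apply: abinj => //; exact: TPhi.
by move=> p q ab bb [m [am bm]]; exists m; rewrite -ab -bb.
Qed.

End Immersed.

Section Lagrangian.
Hypotheses (Phi_lag : is_lagrangian Phi) (Phi_tg : totally_geodesic Phi).

Let imm : is_immersion Phi := Phi_lag.1.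

Lemma exists_local_model m : exists2 Q, model Q & \forall m' \near m, Q (Phi m').
Proof.
have [c ac dm] := atlas_cover m.
have oU := chart_cod_open ac; have sf := param_smooth imm ac.
have hf : forall x, cod c x -> HH (param c x) by move=> x _; exact: param_HH.
have inj := param_inj imm ac.
have tg' x (Ux : cod c x) u v := totally_geodesic_proj oU sf hf Ux (Phi_tg u v ac Ux).
have lag' x (Ux : cod c x) u v := lagrangian_area sf u v Ux (Phi_lag.2 c x ac Ux).
have inj' x (Ux : cod c x) v := @proj_inj R (cod c) (param c) sf inj x v Ux.
have [Q mQ hQ] := local_model oU (smooth_proj1 oU sf) (smooth_proj2 oU sf)
  (hyp_proj1 hf) (hyp_proj2 hf) tg' lag' inj' (chart_cod_map dm).
exists Q => //; apply: (near_of_chart ac dm).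
by apply: filterS hQ => y; rewrite /proj1 /proj2 -surjective_pairing.
Qed.

Lemma local_model_unique m Q Q' : model Q -> model Q' ->
  (\forall m' \near m, Q (Phi m')) -> (\forall m' \near m, Q' (Phi m')) -> Q = Q'.
Proof.
move=> mQ mQ' hQ hQ'.
have [c ac dm] := atlas_cover m.
have Ux := chart_cod_map dm.
have nU : \forall y \near chart_map c m, cod c y.
  by apply: open_nbhs_nbhs; split=> //; exact: chart_cod_open.
have [r r0 rP] := ball_of_near (filterI nU (filterI (near_in_chart ac dm hQ) (near_in_chart ac dm hQ'))).
pose B := ball (chart_map c m) r.
have oB : open B by exact: ball_open.
have BU : B `<=` cod c by move=> y /rP[].
have sf := smooth_subset BU (param_smooth imm ac).
have hf : forall x, B x -> HH (param c x) by move=> x _; exact: param_HH.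
have inj x (Bx : B x) := param_inj imm ac (BU _ Bx).
have inj' x (Bx : B x) v := @proj_inj R B (param c) sf inj x v Bx.
apply: (model_unique oB (smooth_proj1 oB sf) (smooth_proj2 oB sf)
  (hyp_proj1 hf) (hyp_proj2 hf) inj' (ballxx _ r0) mQ mQ').
- by move=> x /rP[_ []]; rewrite /proj1 /proj2 -surjective_pairing.
- by move=> x /rP[_ []]; rewrite /proj1 /proj2 -surjective_pairing.
Qed.

(** The points near which Phi stays in Q form an open set; it is closed because the
    model near a limit point agrees with Q on a piece of the surface. *)
Lemma global_model m0 : connected [set: S] ->
  exists2 Q, model Q & forall m, Q (Phi m).
Proof.
move=> cS; have [Q mQ hQ] := exists_local_model m0; exists Q => // m.
pose B : set S := interior [set m' | Q (Phi m')].
have oB : open B by exact: open_interior.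
have cB : closed B.
  rewrite -[B]setCK; apply: open_closedC; rewrite openE => m1 nB1.
  have [Q' mQ' hQ'] := exists_local_model m1; rewrite /interior.
  have : \forall m' \near m1, \forall m'' \near m', Q' (Phi m'') by exact: nbhs_interior.
  apply: filterS => m' hm' Bm'; apply: nB1.
  by rewrite /B /interior /= (local_model_unique mQ mQ' Bm' hm').
have BT : B = [set: S].
  apply: cS; first by exists m0.
    by exists B; rewrite ?setTI.
  by exists B; rewrite ?setTI.
have : B m by rewrite BT.
by move=> /nbhs_singleton.
Qed.

End Lagrangian.
End Surfaces.

(** * Geodesics of the hyperbolic plane *)

Section Geodesics.
Context {R : realType}.
Implicit Types (p e n q d A B : 'rV[R]_3).

(** The curves with second derivative equal to the position; this family is closed under
    differentiation, which makes smoothness an induction. *)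
Definition exp_curve A B (t : R) : 'rV[R]_3 := expR t *: A + expR (- t) *: B.

Lemma is_derive_exp_curve A B (t v : R) :
  is_derive (t : R^o) (v : R^o) (exp_curve A B : R^o -> 'rV[R]_3) (exp_curve (v *: A) (- (v *: B)) t).
Proof.
have h1 : is_derive (t : R^o) (1 : R^o) (expR : R^o -> R^o) (expR t).
  exact: is_derive_expR.
have h2 : is_derive (t : R^o) (1 : R^o) ((fun s => expR (- s)) : R^o -> R^o) (- expR (- t)).
  have hN : is_derive (t : R^o) (1 : R^o) ((fun s => - s) : R^o -> R^o) (- 1).
    exact: is_deriveN (is_derive_id _ _).
  apply: is_derive_eq (@is_derive1_comp R expR (fun s => - s) t _ _ (is_derive_expR (- t)) hN) _.
  by rewrite ?mulrN1 ?mulN1r.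
have cst C : is_derive (t : R^o) (1 : R^o) ((fun=> C) : R^o -> 'rV[R]_3) 0.
  exact: is_derive_cst.
have h := is_deriveD (is_derive_scalev h1 (cst A)) (is_derive_scalev h2 (cst B)).
have h' : is_derive (t : R^o) (1 : R^o) (exp_curve A B : R^o -> 'rV[R]_3)
    (expR t *: A - expR (- t) *: B).
  by apply: is_derive_eq h _; rewrite !scaler0 !addr0 scaleNr.
case: h' => d1 d2; have := deriveZdir v d1.
rewrite d2 [v *: (1 : R^o)]mulr1 => h'; apply: is_derive_eq h' _.
by rewrite /exp_curve scalerBr !scalerN !scalerA ![v * _]mulrC.
Qed.

(** The curve cosh(t) p + sinh(t) e. *)
Definition geodesic p e : R -> 'rV[R]_3 :=
  exp_curve (2^-1 *: (p + e)) (2^-1 *: (p - e)).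

Lemma exp_curve_smooth A B : smooth_on setT (exp_curve A B : R^o -> 'rV[R]_3).
Proof.
have ct A' B' (t : R^o) : {for t, continuous (exp_curve A' B' : R^o -> 'rV[R]_3)}.
  have [h _] := is_derive_exp_curve A' B' t 1.
  exact/differentiable_continuous/derivable1_diffP.
move=> k; elim: k A B => [|k IH] A B; split; try by move=> t _; exact: ct.
  by [].
move=> v; split=> [t _|]; first by case: (is_derive_exp_curve A B t v).
have -> : (fun t : R^o => 'D_v (exp_curve A B : R^o -> 'rV[R]_3) t) = exp_curve (v *: A) (- (v *: B)).
  by apply/funext => t; case: (is_derive_exp_curve A B t v).
exact: IH.
Qed.

Lemma derive1_exp_curve A B : derive1 (exp_curve A B) = exp_curve A (- B).
Proof.
apply/funext => t; rewrite derive1E.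
by have [_ ->] := is_derive_exp_curve A B t 1; rewrite !scale1r.
Qed.

Lemma derive1_geodesic p e : derive1 (geodesic p e) = geodesic e p.
Proof.
by rewrite /geodesic derive1_exp_curve -scalerN opprB [p + e]addrC.
Qed.

Lemma geodesicE p e t : geodesic p e t =
  ((expR t + expR (- t)) / 2) *: p + ((expR t - expR (- t)) / 2) *: e.
Proof.
by apply/rowP => j; rewrite /geodesic /exp_curve !mxE; ring.
Qed.

Definition unit_frame p e := [/\ hyp (-1) p, mink p e = 0 & mink e e = 1].

Lemma geodesic_mink p e t : unit_frame p e ->
  mink (geodesic p e t) (geodesic p e t) = -1 /\
  mink (geodesic e p t) (geodesic e p t) = 1.
Proof.
move=> [/hyp_self pp pe e1]; rewrite !geodesicE !minkE (minkC e p) pe pp e1.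
have tt : expR t * expR (- t) = 1 by rewrite -expRD subrr expR0.
split; first by apply: (@etrans _ _ (- (expR t * expR (- t)))); [field|rewrite tt].
by apply: (@etrans _ _ (expR t * expR (- t))); [field|rewrite tt].
Qed.

Lemma geodesic_hyp p e t : unit_frame p e -> hyp (-1) (geodesic p e t).
Proof.
move=> fr; have [h _] := geodesic_mink t fr; have [hp pe e1] := fr.
apply: (hyp_of_mink_neg hp h).
rewrite geodesicE !minkE pe (hyp_self hp) mulr0 addr0 mulrN1 oppr_lt0.
by rewrite divr_gt0// addr_gt0// expR_gt0.
Qed.

Lemma unit_geodesic_geodesic p e : unit_frame p e -> unit_geodesic setT (geodesic p e).
Proof.
move=> fr; split.
- by split; [exact: openT | by move=> ? ? ? ? ? ? | exists 0].
- exact: exp_curve_smooth.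
- by move=> t _; exact: geodesic_hyp.
- by move=> t _; rewrite derive1_geodesic; have [_ ->] := geodesic_mink t fr.
- move=> t _; rewrite !derive1_geodesic /hyp_proj.
  by have [-> _] := geodesic_mink t fr; rewrite mulrNN mulr1 scale1r subrr.
Qed.

(** On the hyperbola a^2 - b^2 = 1 with a > 0 the parameter is ln (a + b). *)
Lemma geodesic_onto p e q : unit_frame p e -> hyp (-1) q ->
  mink (lcross p e) q = 0 -> exists t, q = geodesic p e t.
Proof.
move=> [hp pe e1] hq nq; have pp := hyp_self hp; have qq := hyp_self hq.
have pq := hyp_mink_neg hp hq.
have qE : q = mink e q *: e - mink p q *: p.
  have := frame_decomposition q pp pe.
  by rewrite nq e1 scale1r scale0r addr0 mul1r.
set b := mink e q in qE; set a := - mink p q.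
have a0 : 0 < a by rewrite oppr_gt0.
have ab : a ^+ 2 - b ^+ 2 = 1.
  move: qq; rewrite {1 2}qE !minkE pp e1 (minkC e p) pe /a; lra.
have abp : 0 < a + b.
  have [b0|b0] := lerP 0 b; first by rewrite ltr_wpDr.
  have : 0 < (a + b) * (a - b) by rewrite mulrC -subr_sqr ab.
  by rewrite pmulr_lgt0// subr_gt0 (lt_trans b0 a0).
exists (ln (a + b)); rewrite geodesicE expRN lnK ?posrE//.
have -> : (a + b)^-1 = a - b.
  by apply: (mulfI (lt0r_neq0 abp)); rewrite divff ?gt_eqF// mulrC -subr_sqr ab.
by rewrite {1}qE addrC -scaleNr; congr (_ *: _ + _ *: _); rewrite -/a; field.
Qed.

End Geodesics.

(** * Surfaces in a product of planes *)

Section ForwardProduct.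
Context {R : realType}.
Notation E := ('rV[R]_3 * 'rV[R]_3)%type.
Implicit Types (p e n q d : 'rV[R]_3).

Lemma mink_fun_continuous d : continuous (fun q => mink d q : R).
Proof.
by move=> q; apply: (@mink_continuous R 'rV[R]_3 (fun=> d) id q); [exact: cst_continuous|exact: cvg_id].
Qed.

Lemma smooth_mink (V : normedModType R) (U : set V) (g : V -> 'rV[R]_3) d :
  open U -> smooth_on U g -> smooth_on U (fun y => mink d (g y) : R^o).
Proof.
have lin : linear (fun q => mink d q : R^o).
  by move=> k a b; rewrite !minkE.
pose LM := GRing.isLinear.Build _ _ _ _ _ lin.
pose L : {linear 'rV[R]_3 -> R^o} := HB.pack (fun q => mink d q : R^o) LM.
move=> oU sg; apply: (@smooth_linear _ _ _ _ L _ _ oU _ sg).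
exact: mink_fun_continuous.
Qed.

Lemma derive_mink_cst (U : set 'rV[R]_2) (g : 'rV[R]_2 -> 'rV[R]_3) d x v :
  smooth_on U g -> U x -> 'D_v (fun y => mink d (g y) : R) x = mink d ('D_v g x).
Proof.
move=> sg Ux.
have [_ h] := is_derive_mink (is_derive_cst d x v) (smooth_is_derive v sg Ux).
by apply: (etrans h); rewrite mink0l add0r.
Qed.

(** The unit vector e is the normalized p * n, so that p * e is again along n. *)
Lemma unit_frame_of_normal p n : hyp (-1) p -> mink n p = 0 -> 0 < mink n n ->
  exists2 e, unit_frame p e & forall q, mink n q = 0 <-> mink (lcross p e) q = 0.
Proof.
move=> hp np nn; have pp := hyp_self hp.
pose s := (Num.sqrt (mink n n))^-1.
have s0 : s != 0 by rewrite invr_eq0 sqrtr_eq0 -ltNge.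
have ss : s * s * mink n n = 1.
  rewrite /s -invfM -expr2 sqr_sqrtr ?ltW// mulVf// gt_eqF//.
exists (s *: lcross p n).
  split=> //; first by rewrite minkZr mink_lcrossl mulr0.
  rewrite !minkE mink_lcross_lcross pp (minkC p n) np mulr0 sub0r mulN1r opprK.
  by rewrite mulrA.
move=> q; rewrite lcrossZr lcross_lcross pp (minkC p n) np scale0r subr0 scaleN1r.
rewrite minkZl minkNl mulrN; split=> [->|/eqP]; first by rewrite mulr0 oppr0.
by rewrite oppr_eq0 mulf_eq0 (negPf s0) => /eqP.
Qed.

(** On a geodesic the sinh coordinate <e,q> determines the cosh coordinate, which is
    positive. *)
Lemma geodesic_coord_inj p e q q' : unit_frame p e -> hyp (-1) q -> hyp (-1) q' ->
  mink (lcross p e) q = 0 -> mink (lcross p e) q' = 0 -> mink e q = mink e q' -> q = q'.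
Proof.
move=> [hp pe e1] hq hq' nq nq' eq; have pp := hyp_self hp.
have qq := hyp_self hq; have qq' := hyp_self hq'.
have pq := hyp_mink_neg hp hq; have pq' := hyp_mink_neg hp hq'.
have := frame_decomposition q pp pe; have := frame_decomposition q' pp pe.
rewrite nq nq' e1 !scale1r !scale0r !addr0 !mul1r eq => q'E qE.
move: qq; rewrite {1 2}qE !minkE pp e1 (minkC e p) pe => hh.
move: qq'; rewrite {1 2}q'E !minkE pp e1 (minkC e p) pe => hh'.
have e2 : (- mink p q) ^+ 2 = (- mink p q') ^+ 2 by rewrite !expr2; lra.
have e3 : - mink p q = - mink p q'.
  apply/eqP; rewrite -(@eqrXn2 _ 2)//; first exact/eqP.
    by rewrite oppr_ge0 ltW.
  by rewrite oppr_ge0 ltW.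
have {}e3 : mink p q = mink p q' := oppr_inj e3.
by rewrite e3 in qE; apply: (etrans qE (esym q'E)).
Qed.

Lemma geodesic_coord_tangent p e q d : unit_frame p e -> hyp (-1) q ->
  mink (lcross p e) d = 0 -> mink q d = 0 -> mink (lcross p e) q = 0 ->
  mink e d = 0 -> d = 0.
Proof.
move=> [hp pe e1] hq nd qd nq ed; have pp := hyp_self hp.
have := frame_decomposition d pp pe.
rewrite ed nd e1 scale1r !scale0r addr0 mul1r sub0r -scaleNr => dE.
have pq := hyp_mink_neg hp hq.
move: qd; rewrite dE minkZr (minkC q) => /eqP; rewrite mulf_eq0 (lt_eqF pq) orbF.
by move=> /eqP ->; rewrite scale0r.
Qed.

Variables (S : smooth_surface R) (Phi : S -> E).
Hypothesis imm : is_immersion Phi.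

Let HPhi m : HH (Phi m). Proof. by have [h _] := imm; exact: h. Qed.

Let oU c (ac : atlas c) := @chart_cod_open R S c ac.
Let sf c (ac : atlas c) := param_smooth imm ac.
Let hf c x (_ : chart_cod c x) : HH ((Phi \o @chart_inv R S c) x) := param_HH imm c x.

Lemma differentiable_proj1 c x d : atlas c -> chart_cod c x ->
  differentiable (fun y => mink d (proj1 (Phi \o @chart_inv R S c) y) : R) x.
Proof.
move=> ac Ux; apply: (smooth_differentiable_rV (oU ac)) => //.
exact: smooth_mink (oU ac) (smooth_proj1 (oU ac) (sf ac)).
Qed.

Lemma differentiable_proj2 c x d : atlas c -> chart_cod c x ->
  differentiable (fun y => mink d (proj2 (Phi \o @chart_inv R S c) y) : R) x.
Proof.
move=> ac Ux; apply: (smooth_differentiable_rV (oU ac)) => //.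
exact: smooth_mink (oU ac) (smooth_proj2 (oU ac) (sf ac)).
Qed.

Lemma mink1_continuous d : continuous (fun p : E => mink d p.1 : R).
Proof.
by move=> p; apply: (@continuous_comp _ _ _ fst (fun q => mink d q : R));
  [exact: cvg_fst|exact: mink_fun_continuous].
Qed.

Lemma mink2_continuous d : continuous (fun p : E => mink d p.2 : R).
Proof.
by move=> p; apply: (@continuous_comp _ _ _ snd (fun q => mink d q : R));
  [exact: cvg_snd|exact: mink_fun_continuous].
Qed.

Lemma range_planes n1 n2 (m0 : S) : 0 < mink n1 n1 -> 0 < mink n2 n2 ->
  (forall m, planes n1 n2 (Phi m)) -> is_geodesic_product Phi.
Proof.
move=> n1p n2p hPhi.
have [h1 h2] := hPhi m0; have [hp1 hp2] := HPhi m0.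
have [e1 f1 N1] := unit_frame_of_normal hp1 h1 n1p.
have [e2 f2 N2] := unit_frame_of_normal hp2 h2 n2p.
exists setT, setT, (geodesic (Phi m0).1 e1), (geodesic (Phi m0).2 e2).
split; try exact: unit_geodesic_geodesic.
have [V oV [VE _]] : exists2 V : set E, open V & range Phi = (HH `&` planes n1 n2) `&` V /\
    (forall p q : E, mink e1 p.1 = mink e1 q.1 -> mink e2 p.2 = mink e2 q.2 -> V p -> V q).
  have ROP := @range_open_part R S Phi (HH `&` planes n1 n2) (fun p : E => mink e1 p.1)
    (fun p : E => mink e2 p.2) (@mink1_continuous e1) (@mink2_continuous e2).
  apply: ROP.
  - by move=> m; split; [exact: HPhi|exact: hPhi].
  - move=> p q [[p1 p2] [/N1 pn1 /N2 pn2]] [[q1 q2] [/N1 qn1 /N2 qn2]] a b.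
    by apply: pairP; [exact: (geodesic_coord_inj f1)|exact: (geodesic_coord_inj f2)].
  - by move=> c x ac Ux; split; [exact: differentiable_proj1|exact: differentiable_proj2].
  - move=> c x v ac Ux.
    have g1 := smooth_proj1 (oU ac) (sf ac); have g2 := smooth_proj2 (oU ac) (sf ac).
    move=> /(etrans (esym (derive_mink_cst e1 v g1 Ux))) d1.
    move=> /(etrans (esym (derive_mink_cst e2 v g2 Ux))) d2.
    have t1 := hyp_map_tangent (oU ac) g1 (hyp_proj1 (@hf c)) v Ux.
    have t2 := hyp_map_tangent (oU ac) g2 (hyp_proj2 (@hf c)) v Ux.
    have [q1 q2] := HPhi (chart_inv c x); have [nq1 nq2] := hPhi (chart_inv c x).
    apply: (proj_inj (sf ac) (param_inj imm ac) Ux).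
      apply: (geodesic_coord_tangent f1 q1 _ t1 _ d1); last exact/N1.
      by apply/N1; apply: (plane_tangent (oU ac) v g1 _ Ux) => y _; have [] := hPhi (chart_inv c y).
    apply: (geodesic_coord_tangent f2 q2 _ t2 _ d2); last exact/N2.
    by apply/N2; apply: (plane_tangent (oU ac) v g2 _ Ux) => y _; have [] := hPhi (chart_inv c y).
exists V => //; rewrite VE; congr (_ `&` _).
apply/seteqP; split.
  move=> [q1 q2] [[/= k1 k2] [/= /N1 l1 /N2 l2]].
  have [t1 ->] := geodesic_onto f1 k1 l1; have [t2 ->] := geodesic_onto f2 k2 l2.
  by exists (t1, t2).
move=> _ [[t1 t2] _ <-]; split; split => /=; try exact: geodesic_hyp.
  by apply/N1; rewrite geodesicE !minkE (minkC _ (Phi m0).1) mink_lcrossl (minkC _ e1) mink_lcrossr !mulr0 addr0.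
by apply/N2; rewrite geodesicE !minkE (minkC _ (Phi m0).2) mink_lcrossl (minkC _ e2) mink_lcrossr !mulr0 addr0.
Qed.

End ForwardProduct.

(** * Surfaces in the graph of a Lorentz transformation *)

Section LinearIsometries.
Context {R : realType}.
Notation E := ('rV[R]_3 * 'rV[R]_3)%type.

Lemma smooth_cst (V W : normedModType R) (U : set V) (w : W) : smooth_on U (fun=> w).
Proof.
move=> k; elim: k w => [|k IH] w; split=> //.
- by move=> x _; exact: cst_continuous.
- by move=> x _; exact: cst_continuous.
move=> v; split=> [x _|]; first exact: derivable_cst.
have -> : (fun x : V => 'D_v (fun=> w : W) x) = (fun=> 0 : W).
  by apply/funext => x; exact: derive_cst.
exact: IH.
Qed.

Lemma derive_linear (V W : normedModType R) (L : {linear V -> W}) x v :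
  continuous L -> is_derive x v L (L v).
Proof. by move=> cL; apply: (is_derive_linear (f := id) cL). Qed.

Lemma smooth_linear_map (V W : normedModType R) (L : {linear V -> W}) U :
  continuous L -> smooth_on U L.
Proof.
move=> cL [|k]; split=> //; try by move=> x _; exact: cL.
move=> v; split=> [x _|]; first by case: (derive_linear x v cL).
have -> : (fun x : V => 'D_v L x) = (fun=> L v).
  by apply/funext => x; case: (derive_linear x v cL).
exact: smooth_cst.
Qed.

Section OneFactor.
Variables (p e p' e' : 'rV[R]_3).
Hypotheses (fr : frame p e) (fr' : frame p' e') (ee : mink e e = mink e' e').

Definition transport_map (q : E) : E := (transport p e p' e' q.1, q.2).

Lemma transport_continuous : continuous (transport p e p' e').
Proof.
move=> c; rewrite /transport.
have sc d w : {for c, continuous (fun q => mink d q *: w : 'rV[R]_3)}.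
  apply: continuousZl. exact: mink_fun_continuous.
have h := continuousB (continuousZr (k := (mink e e)^-1)
  (continuousD (sc e e') (sc (lcross p e) (lcross p' e')))) (sc p p').
exact: h.
Qed.

Lemma transport_map_linear : linear transport_map.
Proof. by move=> k a b; apply: pairP => //=; exact: transportP. Qed.

Lemma transport_map_continuous : continuous transport_map.
Proof.
move=> q.
have c1 : {for q, continuous (fun z : E => transport p e p' e' z.1)}.
  apply: (@continuous_comp _ _ _ fst (transport p e p' e')); first exact: cvg_fst.
  exact: transport_continuous.
have c2 : {for q, continuous (fun z : E => z.2)} by exact: cvg_snd.
exact: (cvg_pair c1 c2).
Qed.

Lemma transport_map_smooth : smooth_on setT transport_map.
Proof.
pose LM := GRing.isLinear.Build _ _ _ _ _ transport_map_linear.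
pose L : {linear E -> E} := HB.pack transport_map LM.
exact: (@smooth_linear_map _ _ L setT transport_map_continuous).
Qed.

Lemma derive_transport_map x v : 'D_v transport_map x = transport_map v.
Proof.
pose LM := GRing.isLinear.Build _ _ _ _ _ transport_map_linear.
pose L : {linear E -> E} := HB.pack transport_map LM.
by case: (@derive_linear _ _ L x v transport_map_continuous).
Qed.

Lemma transport_map_HH q : HH q -> HH (transport_map q).
Proof. by move=> [h1 h2]; split=> //=; exact: transport_hyp. Qed.

End OneFactor.

Lemma transport_map_holomorphic p e p' e' : frame p e -> frame p' e' ->
  mink e e = mink e' e' -> holomorphic_isometry (transport_map p e p' e').
Proof.
move=> fr fr' ee; split; last first.
  move=> q v _ _; rewrite !derive_transport_map; apply: pairP => //=.
  by rewrite !hyp_J1 transport_lcross.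
split.
- exists setT; split=> //; [exact: openT|exact: transport_map_smooth].
- exists (transport_map p' e' p e); split.
  + exists setT; split=> //; [exact: openT|exact: transport_map_smooth].
  + by move=> q; exact: transport_map_HH.
  + by move=> q; exact: (transport_map_HH fr' fr (esym ee)).
  + by move=> q _; apply: pairP => //=; exact: transportK.
  + by move=> q _; apply: pairP => //=; exact: (transportK fr' fr (esym ee)).
- by move=> q v w _ _ _; rewrite !derive_transport_map /ip /= transport_mink.
Qed.

Lemma diagonalE : diagonal_surface = [set q : E | hyp (-1) q.1 /\ q.2 = q.1].
Proof.
have s0 : 0 < Num.sqrt (2 : R) by rewrite sqrtr_gt0.
have s2 : Num.sqrt (2 : R) * Num.sqrt 2 = 2 by rewrite -expr2 sqr_sqrtr.
have c2 : (- 2^-1)^-1 = - 2 :> R by rewrite invrN invrK.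
apply/seteqP; split.
  move=> _ [x [xx x0] <-] /=; split=> //; split.
    rewrite minkZl minkZr xx c2 mulrA -invfM s2 mulrN mulVf//.
    by rewrite invrN invr1.
  by rewrite mxE mulr_gt0// invr_gt0.
move=> [q1 q2] [/= [xx x0] ->]; exists (Num.sqrt 2 *: q1).
  split; last by rewrite mxE mulr_gt0.
  by rewrite minkZl minkZr xx mulrA s2 c2 invrN invr1 mulrN1.
by rewrite !scalerA mulVf ?scale1r// gt_eqF.
Qed.

Lemma mink_delta1 (q : 'rV[R]_3) : mink (delta_mx 0 1) q = q 0 1.
Proof. by rewrite /mink !mxE /=; ring. Qed.

Lemma mink_delta2 (q : 'rV[R]_3) : mink (delta_mx 0 2%:R) q = q 0 2%:R.
Proof. by rewrite /mink !mxE /=; ring. Qed.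

Lemma hyp_coord_inj (q q' : 'rV[R]_3) : hyp (-1) q -> hyp (-1) q' ->
  q 0 1 = q' 0 1 -> q 0 2%:R = q' 0 2%:R -> q = q'.
Proof.
move=> hq hq' h1 h2; apply: row3P => //.
have := hyp_self hq; have := hyp_self hq'; case: hq hq' => _ q0 [_ q0'].
rewrite /mink h1 h2 => e e'.
have e2 : q 0 0 ^+ 2 = q' 0 0 ^+ 2 by rewrite !expr2; lra.
by apply/eqP; rewrite -(@eqrXn2 _ 2) ?ltW//; exact/eqP.
Qed.

Lemma hyp_tangent_coord (q d : 'rV[R]_3) : hyp (-1) q -> mink q d = 0 ->
  d 0 1 = 0 -> d 0 2%:R = 0 -> d = 0.
Proof.
move=> [_ q0] qd d1 d2; apply: row3P; rewrite ?mxE//.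
move/eqP: qd; rewrite /mink d1 d2 !mulr0 !addr0 oppr_eq0 mulf_eq0 gt_eqF//=.
by move/eqP.
Qed.

End LinearIsometries.

Section ForwardDiagonal.
Context {R : realType}.
Notation E := ('rV[R]_3 * 'rV[R]_3)%type.
Variables (S : smooth_surface R) (Phi : S -> E).
Hypothesis imm : is_immersion Phi.

Let HPhi m : HH (Phi m). Proof. by have [h _] := imm; exact: h. Qed.
Let oU c (ac : atlas c) := @chart_cod_open R S c ac.
Let sf c (ac : atlas c) := param_smooth imm ac.
Let hf c x (_ : chart_cod c x) : HH ((Phi \o @chart_inv R S c) x) := param_HH imm c x.

(** The coordinates 1 and 2 of the second factor are coordinates on the graph.  As the
    isometry (T, id) fixes the second factor, it fixes these coordinates, and the open
    set found for the graph also cuts out the image from the diagonal. *)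
Lemma range_graph p e p' e' : frame p e -> frame p' e' -> mink e e = mink e' e' ->
  (forall m, graph p e p' e' (Phi m)) -> is_diagonal_up_to_isometry Phi.
Proof.
move=> fr fr' ee hPhi.
exists (transport_map p e p' e'); split; first by left; exact: transport_map_holomorphic.
pose d1 : 'rV[R]_3 := delta_mx 0 1; pose d2 : 'rV[R]_3 := delta_mx 0 2%:R.
have [V oV [VE Vsat]] : exists2 V : set E, open V & range Phi = (HH `&` graph p e p' e') `&` V /\
    (forall p q : E, mink d1 p.2 = mink d1 q.2 -> mink d2 p.2 = mink d2 q.2 -> V p -> V q).
  have ROP := @range_open_part R S Phi (HH `&` graph p e p' e') (fun p : E => mink d1 p.2)
    (fun p : E => mink d2 p.2) (@mink2_continuous R d1) (@mink2_continuous R d2).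
  apply: ROP.
  - by move=> m; split; [exact: HPhi|exact: hPhi].
  - move=> q q' [[q1 q2] gq] [[q1' q2'] gq']; rewrite !mink_delta1 !mink_delta2 => a b.
    have e2 : q.2 = q'.2 by exact: hyp_coord_inj.
    apply: pairP => //; rewrite -(transportK fr fr' ee q.1) -(transportK fr fr' ee q'.1).
    by rewrite -[transport p e p' e' q.1]gq -[transport p e p' e' q'.1]gq' e2.
  - by move=> c x ac Ux; split; exact: differentiable_proj2.
  - move=> c x v ac Ux.
    have g1 := smooth_proj1 (oU ac) (sf ac); have g2 := smooth_proj2 (oU ac) (sf ac).
    move=> /(etrans (esym (derive_mink_cst d1 v g2 Ux))) k1.
    move=> /(etrans (esym (derive_mink_cst d2 v g2 Ux))) k2.
    rewrite mink_delta1 in k1; rewrite mink_delta2 in k2.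
    have t2 := hyp_map_tangent (oU ac) g2 (hyp_proj2 (@hf c)) v Ux.
    have [q1 q2] := HPhi (chart_inv c x).
    have z2 := hyp_tangent_coord q2 t2 k1 k2.
    apply: (proj_inj (sf ac) (param_inj imm ac) Ux) => //.
    rewrite -(transportK fr fr' ee ('D_v _ x)).
    have <- := graph_tangent (oU ac) v g1 g2 fr fr' ee (fun y _ => hPhi (chart_inv c y)) Ux.
    by rewrite z2 transport0.
exists V => //; rewrite VE diagonalE; apply/seteqP; split.
  move=> _ [q [[[q1 q2] gq] Vq] <-]; split.
    split; first by apply: (transport_map_HH fr fr' ee _).1; split.
    exact: gq.
  by apply: Vsat Vq.
move=> [q1 q2] [[/= hq ->] Vq].
exists (transport p' e' p e q1, q1); last by apply: pairP => //=; exact: (transportK fr' fr (esym ee)).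
split; last by apply: Vsat Vq.
split; first by split=> //=; exact: (transport_hyp fr' fr (esym ee)).
by rewrite /graph /= (transportK fr' fr (esym ee)).
Qed.

End ForwardDiagonal.

(** * Products of geodesics are totally geodesic *)

Section BackwardProduct.
Context {R : realType}.
Notation E := ('rV[R]_3 * 'rV[R]_3)%type.

Lemma lcross_spacelike (p d : 'rV[R]_3) : mink p p = -1 -> mink d d = 1 ->
  0 < mink (lcross p d) (lcross p d).
Proof.
move=> pp dd; rewrite mink_lcross_lcross pp dd (minkC d p) mulN1r opprK.
by rewrite ltr_wpDl// -expr2 sqr_ge0.
Qed.

(** The vector beta * beta' is constant, because beta'' is a multiple of beta. *)
Lemma unit_geodesic_planar (I : set R) (beta : R -> 'rV[R]_3) :
  unit_geodesic I beta ->
  exists2 n, 0 < mink n n & forall t, I t -> mink n (beta t) = 0.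
Proof.
move=> [[oI itvI [t0 It0]] sb hb b1 b2].
pose db : R^o -> 'rV[R]_3 := fun t => 'D_1 (beta : R^o -> 'rV[R]_3) t.
have dbE : derive1 beta = db by apply/funext => t; rewrite derive1E.
have sdb : smooth_on (I : set R^o) db by exact: smooth_derive.
pose N t := lcross (beta t) (db t).
exists (N t0).
  by apply: (lcross_spacelike (hyp_self (hb _ It0))); rewrite -dbE; exact: b1.
have dN (t : R) (v : R^o) : I t -> is_derive (t : R^o) v (N : R^o -> 'rV[R]_3) 0.
  move=> It.
  have h1 := smooth_is_derive v sb It; have h2 := smooth_is_derive v sdb It.
  apply: is_derive_eq (is_derive_lcross h1 h2) _.
  have e1 : 'D_v (beta : R^o -> 'rV[R]_3) t = v *: db t.
    have [d _] := smooth_is_derive (1 : R^o) sb It.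
    by have := deriveZdir v d; rewrite [v *: (1 : R^o)]mulr1 => -[].
  have e2 : exists k, 'D_v db t = k *: beta t.
    have [d _] := smooth_is_derive (1 : R^o) sdb It.
    have [_] := deriveZdir v d; rewrite [v *: (1 : R^o)]mulr1 => ->.
    have := b2 _ It; rewrite dbE derive1E /hyp_proj => /eqP; rewrite subr_eq0 => /eqP ->.
    by rewrite scalerA; eexists.
  have [k ->] := e2; rewrite e1 lcrossZl lcrossZr !lcrossvv !scaler0.
  exact: addr0.
move=> t It.
pose c := beta t.
pose h s := mink (N s) c.
have dh (s : R) (v : R^o) : I s -> is_derive (s : R^o) v (h : R^o -> R) 0.
  move=> Is; have cc : is_derive (s : R^o) v ((fun=> c) : R^o -> 'rV[R]_3) 0.
    exact: is_derive_cst.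
  by apply: is_derive_eq (is_derive_mink (dN s v Is) cc) _; rewrite mink0l mink0r addr0.
have seg (s : R) : 0 <= s <= 1 -> I (t0 + s *: (t - t0)).
  move=> /andP[s0 s1]; have [tt|tt] := leP t0 t.
    apply: (itvI _ _ It0 It); rewrite lerDl mulr_ge0 ?subr_ge0//=.
    by rewrite -lerBrDl ler_piMl// subr_ge0.
  apply: (itvI _ _ It It0); rewrite gerDl mulr_ge0_le0 ?subr_le0 ?(ltW tt)// andbT.
  rewrite -lerBlDl -[leLHS]mul1r ler_wnM2r// subr_le0; exact: ltW.
have [|s s01] := @mean_value R R^o (h : R^o -> R) t0 (t - t0).
  by move=> s s01; case: (dh _ (t - t0) (seg s s01)).
have [_ ->] := dh _ (t - t0) (seg s s01).
rewrite [t0 + (t - t0)]addrC subrK => /eqP; rewrite subr_eq0 => /eqP.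
have -> : h t = 0 by rewrite /h /N /c minkC mink_lcrossl.
by [].
Qed.

Lemma unit_geodesic_range (I1 I2 : set R) b1 b2 (q : E) :
  geodesic_product I1 I2 b1 b2 q ->
  exists t1 t2, [/\ I1 t1, I2 t2, q.1 = b1 t1 & q.2 = b2 t2].
Proof. by move=> [[t1 t2] [i1 i2] <-]; exists t1, t2. Qed.

Lemma mink_comb (d a b : 'rV[R]_3) (s t : R) :
  mink d (s *: a + t *: b) = s * mink d a + t * mink d b.
Proof. by rewrite !minkE. Qed.

Lemma plane_frame_zero (p n d : 'rV[R]_3) : frame p n -> mink p d = 0 -> mink n d = 0 ->
  mink (lcross p n) d = 0 -> d = 0.
Proof. by move=> fr h1 h2 h3; apply: (frame_ext fr); rewrite mink0r. Qed.

Lemma plane_frame_eq (p n a d : 'rV[R]_3) (m : R) : frame p n -> mink n p = 0 ->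
  mink p a = 0 -> mink n a = 0 -> mink p d = - m -> mink n d = 0 ->
  mink (lcross p n) a = mink (lcross p n) (d - m *: p) -> a = d - m *: p.
Proof.
move=> fr np pa na pd nd h; have [/hyp_self pp _ _] := fr.
apply: (frame_ext fr) => //; rewrite minkDr minkNr minkZr.
  by rewrite pa pd pp; ring.
by rewrite na nd np mulr0 subr0.
Qed.

Variables (S : smooth_surface R) (Phi : S -> E).
Hypothesis imm : is_immersion Phi.

Lemma derive_plane_form (U : set 'rV[R]_2) (g : 'rV[R]_2 -> 'rV[R]_3) d x :
  open U -> smooth_on U g -> U x -> plane_form (fun v => mink d ('D_v g x)).
Proof.
move=> oU sg Ux s t.
exact: (etrans (congr1 (mink d) (derive_row2 oU sg s t Ux)) (mink_comb _ _ _ _ _)).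
Qed.

(** In the frame of its plane, the covariant derivative of each factor has a single
    coordinate, along p * n; the differential of the surface reaches every pair of
    such coordinates. *)
Lemma planar_totally_geodesic n1 n2 : 0 < mink n1 n1 -> 0 < mink n2 n2 ->
  (forall m, planes n1 n2 (Phi m)) -> totally_geodesic Phi.
Proof.
move=> n1p n2p hPhi c x v w ac Ux.
have oU := chart_cod_open ac; have sf := param_smooth imm ac.
have hf y (_ : chart_cod c y) := param_HH imm c y.
have inj := param_inj imm ac.
pose g1 := proj1 (Phi \o chart_inv c); pose g2 := proj2 (Phi \o chart_inv c).
have sg1 : smooth_on (chart_cod c) g1 := smooth_proj1 oU sf.
have sg2 : smooth_on (chart_cod c) g2 := smooth_proj2 oU sf.
have hn1 y (_ : chart_cod c y) : mink n1 (g1 y) = 0 := (hPhi (chart_inv c y)).1.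
have hn2 y (_ : chart_cod c y) : mink n2 (g2 y) = 0 := (hPhi (chart_inv c y)).2.
have T1 y u (Uy : chart_cod c y) := plane_tangent oU u sg1 hn1 Uy.
have T2 y u (Uy : chart_cod c y) := plane_tangent oU u sg2 hn2 Uy.
have TT1 := plane_tangent oU v (smooth_derive w sg1) (fun y Uy => T1 y w Uy) Ux.
have TT2 := plane_tangent oU v (smooth_derive w sg2) (fun y Uy => T2 y w Uy) Ux.
have hg1 := hyp_proj1 hf; have hg2 := hyp_proj2 hf.
have H1 u := hyp_map_tangent oU sg1 hg1 u Ux.
have H2 u := hyp_map_tangent oU sg2 hg2 u Ux.
have HH1 := hyp_map_second oU sg1 hg1 v w Ux.
have HH2 := hyp_map_second oU sg2 hg2 v w Ux.
have fr1 : frame (g1 x) n1 by split=> //; [exact: hg1|rewrite minkC hn1].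
have fr2 : frame (g2 x) n2 by split=> //; [exact: hg2|rewrite minkC hn2].
pose d1 := lcross (g1 x) n1; pose d2 := lcross (g2 x) n2.
have inj' u : mink d1 ('D_u g1 x) = 0 -> mink d2 ('D_u g2 x) = 0 -> u = 0.
  move=> k1 k2; apply: (proj_inj sf inj Ux).
    exact: (plane_frame_zero fr1 (H1 u) (T1 x u Ux) k1).
  exact: (plane_frame_zero fr2 (H2 u) (T2 x u Ux) k2).
have N1 := HH_nabla1 oU sf hf v w Ux; have N2 := HH_nabla2 oU sf hf v w Ux.
have [y [y1 y2]] := plane_inj_surj (derive_plane_form d1 oU sg1 Ux)
  (derive_plane_form d2 oU sg2 Ux) inj'
  (mink d1 (HH_nabla (Phi \o chart_inv c) x v w).1)
  (mink d2 (HH_nabla (Phi \o chart_inv c) x v w).2).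
have E1 := plane_frame_eq fr1 (hn1 x Ux) (H1 y) (T1 x y Ux) HH1 TT1
  (etrans y1 (congr1 (mink d1) N1)).
have E2 := plane_frame_eq fr2 (hn2 x Ux) (H2 y) (T2 x y Ux) HH2 TT2
  (etrans y2 (congr1 (mink d2) N2)).
apply: (second_form0_of_tangent oU sf hf inj Ux (y := y)); apply: pairP.
  exact: (etrans N1 (etrans (esym E1) (esym (derive_proj1 sf y Ux)))).
exact: (etrans N2 (etrans (esym E2) (esym (derive_proj2 sf y Ux)))).
Qed.

Lemma product_totally_geodesic : is_geodesic_product Phi -> totally_geodesic Phi.
Proof.
move=> [I1 [I2 [b1 [b2 [u1 u2 [V oV VE]]]]]].
have [n1 n1p h1] := unit_geodesic_planar u1.
have [n2 n2p h2] := unit_geodesic_planar u2.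
apply: (planar_totally_geodesic n1p n2p) => m.
have : range Phi (Phi m) by exists m.
rewrite VE => -[/unit_geodesic_range[t1 [t2 [i1 i2 e1 e2]]] _].
by split; rewrite ?e1 ?e2; [exact: h1|exact: h2].
Qed.

End BackwardProduct.

(** * Isometric images of the diagonal are totally geodesic *)

Section VaryingDirection.
Context {R : realType}.
Notation E := ('rV[R]_3 * 'rV[R]_3)%type.

Lemma is_derive_bigsum (V W : normedModType R) (I : Type) (s : seq I)
    (f : I -> V -> W) (df : I -> W) x v :
  (forall i, is_derive x v (f i) (df i)) ->
  is_derive x v (fun y => \sum_(i <- s) f i y) (\sum_(i <- s) df i).
Proof.
move=> h; elim: s => [|i s IH].
  rewrite big_nil (_ : (fun y => _) = cst 0); first exact: is_derive_cst.
  by apply/funext => y; rewrite big_nil.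
rewrite big_cons (_ : (fun y => _) = f i + (fun y => \sum_(i <- s) f i y)).
  exact: is_deriveD.
by apply/funext => y; rewrite big_cons.
Qed.

Lemma derive_pair_basis n (U : set E) (G : E -> 'rV[R]_n) q w :
  open U -> smooth_on U G -> U q ->
  'D_w G q = \sum_i pair_entry i w *: 'D_(pair_basis i : E) G q.
Proof.
move=> oU sG Uq; rewrite {1}[w]pair_entry_sum.
elim/big_rec2: _ => [|i a b _ <-]; first exact: derive0.
exact: (smooth_derive_linear_pair _ _ _ oU sG Uq).
Qed.

Lemma is_derive_pair_entry (V : normedModType R) (X : V -> E) x v dX i :
  is_derive x v X dX -> is_derive x v (fun y => pair_entry i (X y) : R) (pair_entry i dX).
Proof.
move=> hX; rewrite /pair_entry; case: i => -[] j /=.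
  exact: is_derive_coord (is_derive_fst hX).
exact: is_derive_coord (is_derive_snd hX).
Qed.

(** Expanding the direction X in a basis reduces this to the product rule. *)
Lemma is_derive_varying (V : normedModType R) n (U : set E) (G : E -> 'rV[R]_n)
    (K X : V -> E) x v dK dX :
  open U -> smooth_on U G -> {for x, continuous K} -> U (K x) ->
  is_derive x v K dK -> is_derive x v X dX ->
  is_derive x v (fun y => 'D_(X y) G (K y))
    ('D_dX G (K x) + 'D_dK (fun q => 'D_(X x) G q) (K x)).
Proof.
move=> oU sG cK UK hK hX.
have nU : \forall y \near x, U (K y).
  by apply: cK; exact: open_nbhs_nbhs.
have nU' : \forall q \near K x, U q by exact: open_nbhs_nbhs.
pose D i := (fun q => 'D_(pair_basis i : E) G q).
have sD i : smooth_on U (D i) by exact: smooth_derive.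
have hD i : is_derive x v (fun y => D i (K y)) ('D_dK (D i) (K x)).
  exact: (is_derive_smooth_comp oU (sD i) UK hK).
have hH := is_derive_bigsum (index_enum _)
  (fun i => is_derive_scalev (is_derive_pair_entry i hX) (hD i)).
have hH' : is_derive x v (fun y => 'D_(X y) G (K y))
  (\sum_i (pair_entry i dX *: D i (K x) + pair_entry i (X x) *: 'D_dK (D i) (K x))).
  apply: near_eq_is_derive hH; apply: filterS nU => y UKy.
  exact: (esym (derive_pair_basis (X y) oU sG UKy)).
apply: is_derive_eq hH' _.
rewrite big_split/=; congr (_ + _); first exact: (esym (derive_pair_basis dX oU sG UK)).
have h2 : is_derive (K x) dK (fun q => 'D_(X x) G q)
   (\sum_i (pair_entry i (X x) *: 'D_dK (D i) (K x))).
  have h3 := is_derive_bigsum (index_enum _)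
    (fun i => is_deriveZ (pair_entry i (X x) : R) (smooth_is_derive dK (sD i) UK)).
  apply: near_eq_is_derive h3; apply: filterS nU' => q Uq.
  exact: (esym (derive_pair_basis (X x) oU sG Uq)).
by case: h2.
Qed.

End VaryingDirection.

Section CurvesInHH.
Context {R : realType}.
Notation E := ('rV[R]_3 * 'rV[R]_3)%type.

Lemma cayley_norm (a t m : R) : t * t * (m / 4) = a -> 1 - a != 0 ->
  (1 - a)^-1 * ((1 + a) * ((1 - a)^-1 * ((1 + a) * -1)) +
                t * ((1 - a)^-1 * (t * m))) = -1.
Proof.
move=> ta a0; rewrite (mulrCA t) (_ : t * (t * m) = 4 * a); last by rewrite -ta; field.
by field.
Qed.

(** A curve on the hyperboloid with prescribed velocity, from the Cayley transform: the
    rational curve ((1 + r) p + s c) / (1 - r) with r = s^2 <c,c> / 4. *)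
Lemma hyp_curve (p c : 'rV[R]_3) : hyp (-1) p -> mink p c = 0 ->
  exists k : R -> 'rV[R]_3, [/\ k 0 = p,
    is_derive (0 : R^o) (1 : R^o) (k : R^o -> 'rV[R]_3) c &
    \forall s \near (0 : R), hyp (-1) (k s)].
Proof.
move=> hp pc; have pp := hyp_self hp.
pose kap := mink c c / 4.
pose sg (s : R) : R := s * s * kap.
pose al (s : R) := 1 + sg s; pose be (s : R) := 1 - sg s.
have did : is_derive (0 : R^o) (1 : R^o) ((fun s => s) : R^o -> R^o) (1 : R^o).
  exact: is_derive_id.
have dcst (w : R) : is_derive (0 : R^o) (1 : R^o) ((fun=> w) : R^o -> R^o) (0 : R^o).
  exact: is_derive_cst.
have dsg : is_derive (0 : R^o) (1 : R^o) (sg : R^o -> R^o) (0 : R^o).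
  apply: is_derive_eq (is_derive_mul (is_derive_mul did did) (dcst kap)) _.
  by rewrite !(mulr0, mul0r, addr0).
have dal : is_derive (0 : R^o) (1 : R^o) (al : R^o -> R^o) (0 : R^o).
  by apply: is_derive_eq (is_deriveD (dcst 1) dsg) _; rewrite addr0.
have dbe : is_derive (0 : R^o) (1 : R^o) (be : R^o -> R^o) (0 : R^o).
  by apply: is_derive_eq (is_deriveB (dcst 1) dsg) _; rewrite subr0.
have sg0 : sg 0 = 0 by rewrite /sg !mul0r.
have be0 : be 0 = 1 by rewrite /be sg0 subr0.
have al0 : al 0 = 1 by rewrite /al sg0 addr0.
pose k s := (be s)^-1 *: (al s *: p + s *: c).
exists k; split.
- by rewrite /k be0 al0 invr1 !scale1r scale0r addr0.
- have be0' : be 0 != 0 by rewrite be0 oner_neq0.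
  have dbi := @is_derive_inv R R^o (be : R^o -> R) 0 1 0 be0' dbe.
  have dp (w : 'rV[R]_3) : is_derive (0 : R^o) (1 : R^o) ((fun=> w) : R^o -> 'rV[R]_3) 0.
    exact: is_derive_cst.
  have h := is_derive_scalev dbi
    (is_deriveD (is_derive_scalev dal (dp p)) (is_derive_scalev did (dp c))).
  apply: is_derive_eq h _.
  rewrite be0 oppr0 mul0r scale0r invr1 add0r !scale1r !scaler0 !addr0 scale0r.
  by rewrite add0r.
have cb : {for (0 : R^o), continuous (be : R^o -> R^o)}.
  by apply/differentiable_continuous/derivable1_diffP; case: dbe.
have nb : \forall s \near (0 : R^o), 0 < be s.
  have : (0 : R) < be 0 by rewrite be0.
  by move: cb; rewrite /prop_for /continuous_at => cb h; exact: (cvgr_gt _ cb _ h).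
have sg_ge0 (s : R) : 0 <= sg s.
  rewrite /sg mulr_ge0// -?expr2 ?sqr_ge0// divr_ge0//.
  by have [] := hyp_tangent_pos hp pc.
have neg (b a : R) : 0 < b -> 0 <= a -> b^-1 * ((1 + a) * -1) < 0.
  by move=> b0 a0; rewrite mulrN1 mulrN oppr_lt0 mulr_gt0 ?invr_gt0// ltr_wpDr.
apply: filterS nb => s bs.
have bn : be s != 0 by rewrite gt_eqF.
apply: (hyp_of_mink_neg hp).
  rewrite /k !minkE pp pc (minkC c p) pc !mulr0 addr0 add0r.
  exact: cayley_norm.
rewrite /k !minkE pp pc mulr0 addr0; exact: neg.
Qed.

Lemma HH_curve (p c : E) : HH p -> HH_tangent p c ->
  exists K : R^o -> E, [/\ K 0 = p, is_derive (0 : R^o) (1 : R^o) K c &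
    \forall s \near (0 : R^o), HH (K s)].
Proof.
move=> [p1 p2] [c1 c2].
have [k1 [z1 d1 h1]] := hyp_curve p1 c1; have [k2 [z2 d2 h2]] := hyp_curve p2 c2.
exists (fun s => (k1 s, k2 s)); split; first exact: pairP.
  exact: is_derive_pair.
by move: h1 h2; apply: filterS2.
Qed.

(** The second fundamental form of the product of hyperboloids in R^6. *)
Definition ambient_normal (p a c : E) : E :=
  (mink a.1 c.1 *: p.1, mink a.2 c.2 *: p.2).

Lemma is_derive_hyp_proj (k : R^o -> 'rV[R]_3) (a c : 'rV[R]_3) :
  mink (k 0) a = 0 -> is_derive (0 : R^o) (1 : R^o) k c ->
  is_derive (0 : R^o) (1 : R^o) (fun s => hyp_proj (-1) (k s) a) (mink a c *: k 0).
Proof.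
move=> ka dk; have dcst (w : 'rV[R]_3) :
    is_derive (0 : R^o) (1 : R^o) ((fun=> w) : R^o -> 'rV[R]_3) 0.
  exact: is_derive_cst.
have h := is_deriveD (dcst a) (is_derive_scalev (is_derive_mink (dcst a) dk) dk).
have -> : (fun s => hyp_proj (-1) (k s) a) =
    (fun=> a) \+ (fun s => mink a (k s) *: k s).
  by apply/funext => s; rewrite /hyp_proj mulN1r scaleNr opprK.
apply: is_derive_eq h _.
by rewrite mink0l (minkC a (k 0)) ka scale0r addr0 !add0r.
Qed.

Lemma HH_proj_tangent (q a : E) : HH q -> HH_tangent q (HH_proj q a).
Proof.
move=> [h1 h2]; split; rewrite /HH_proj/= /hyp_tangent/= /hyp_proj mulN1r scaleNr opprK.
  by rewrite minkDr minkZr (hyp_self h1) mulrN1 minkC subrr.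
by rewrite minkDr minkZr (hyp_self h2) mulrN1 minkC subrr.
Qed.

Lemma hyp_proj_id (q a : 'rV[R]_3) : mink q a = 0 -> hyp_proj (-1) q a = a.
Proof. by move=> h; rewrite /hyp_proj minkC h mulr0 scale0r subr0. Qed.

Lemma is_derive_HH_proj (K : R^o -> E) (p a c : E) :
  K 0 = p -> HH_tangent p a -> is_derive (0 : R^o) (1 : R^o) K c ->
  is_derive (0 : R^o) (1 : R^o) (fun s => HH_proj (K s) a) (ambient_normal p a c).
Proof.
move=> <- [a1 a2] dK; apply: is_derive_pair => /=.
  exact: (is_derive_hyp_proj a1 (is_derive_fst dK)).
exact: (is_derive_hyp_proj a2 (is_derive_snd dK)).
Qed.

End CurvesInHH.

Lemma skew_cycle0 (R : realType) (x y z : R) :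
  x + y = 0 -> z + x = 0 -> y + z = 0 -> x = 0.
Proof. lra. Qed.

Lemma mink_add_pair (R : realType) (a b c d u v : 'rV[R]_3) :
  mink (a + b) u + mink (c + d) v = mink a u + mink c v + (mink b u + mink d v).
Proof. by rewrite !minkDl addrACA. Qed.

Lemma linear_comb2 (R : realType) (W : lmodType R) (L : W -> R) s t a b :
  (forall k u v, L (k *: u + v) = k * L u + L v) -> L 0 = 0 ->
  L (s *: a + (t *: b + 0)) = s * L a + t * L b.
Proof. by move=> LL L0; rewrite !LL L0 addr0. Qed.

Lemma hyp_tangent_coord_eq (R : realType) (q a b : 'rV[R]_3) : hyp (-1) q ->
  mink q a = 0 -> mink q b = 0 -> a 0 1 = b 0 1 -> a 0 2%:R = b 0 2%:R -> a = b.
Proof.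
move=> hq qa qb e1 e2; apply/eqP; rewrite -subr_eq0; apply/eqP.
apply: (hyp_tangent_coord hq); first by rewrite minkDr minkNr qa qb subr0.
  by rewrite !mxE e1 subrr.
by rewrite !mxE e2 subrr.
Qed.

Section Isometries.
Context {R : realType}.
Notation E := ('rV[R]_3 * 'rV[R]_3)%type.
Variables (U : set E) (oU : open U) (HU : HH `<=` U).

Lemma HH_map_tangent (G : E -> 'rV[R]_3) p c : smooth_on U G ->
  (forall q, HH q -> hyp (-1) (G q)) -> HH p -> HH_tangent p c ->
  mink (G p) ('D_c G p) = 0.
Proof.
move=> sG hG hp Tc; have [K [Kp dK hK]] := HH_curve hp Tc.
have UK : U (K 0) by rewrite Kp; exact: HU.
have h1 := is_derive_smooth_comp oU sG UK dK.
have h2 := is_derive_mink h1 h1.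
have h0 : is_derive (0 : R^o) (1 : R^o) (fun y => mink (G (K y)) (G (K y))) 0.
  apply: near_eq_is_derive (is_derive_cst (-1 : R) (0 : R^o) (1 : R^o)).
  by apply: filterS hK => y hy /=; rewrite (hyp_self (hG _ hy)).
have := is_derive_unique h2 h0; rewrite Kp (minkC _ (G p)) -mulr2n => /eqP.
by rewrite mulrn_eq0 => /eqP.
Qed.

(** The flat second derivative of G along the product of hyperboloids depends on
    the extension of G; adding the derivative along the normal acceleration leaves
    the second derivative for the Levi-Civita connection. *)
Definition intrinsic_hessian (G : E -> 'rV[R]_3) p a c :=
  'D_(ambient_normal p a c) G p + 'D_c (fun q => 'D_a G q) p.

Lemma intrinsic_hessianC G p a c : smooth_on U G -> HH p ->
  intrinsic_hessian G p a c = intrinsic_hessian G p c a.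
Proof.
move=> sG hp.
have e : ambient_normal p a c = ambient_normal p c a.
  by rewrite /ambient_normal (minkC a.1) (minkC a.2).
exact: (congr2 +%R (congr1 (fun d => 'D_d G p) e)
  (smooth_derive_comm a c oU sG (HU hp))).
Qed.

(** Along a curve, a constant vector is kept tangent by projection, and the projection
    accounts for the normal term of [intrinsic_hessian]. *)
Lemma is_derive_projected (G : E -> 'rV[R]_3) (K : R^o -> E) p a c :
  smooth_on U G -> HH p -> K 0 = p -> HH_tangent p a ->
  is_derive (0 : R^o) (1 : R^o) K c ->
  is_derive (0 : R^o) (1 : R^o) (fun s => 'D_(HH_proj (K s) a) G (K s))
    (intrinsic_hessian G p a c).
Proof.
move=> sG hp Kp Ta dK.
have cK : {for (0 : R^o), continuous K}.
  by apply/differentiable_continuous/derivable1_diffP; case: dK.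
have UK : U (K 0) by rewrite Kp; exact: HU.
have h := is_derive_varying oU sG cK UK dK (is_derive_HH_proj Kp Ta dK).
apply: is_derive_eq h _; rewrite Kp.
have -> // : HH_proj p a = a.
by case: Ta => a1 a2; apply: pairP; rewrite /HH_proj /= hyp_proj_id.
Qed.

Variables (F1 F2 : E -> 'rV[R]_3).
Hypotheses (s1 : smooth_on U F1) (s2 : smooth_on U F2).
Hypothesis isom : forall p v w, HH p -> HH_tangent p v -> HH_tangent p w ->
  mink ('D_v F1 p) ('D_w F1 p) + mink ('D_v F2 p) ('D_w F2 p) = ip v w.

Definition hessian_pairing p a c b :=
  mink (intrinsic_hessian F1 p a c) ('D_b F1 p) +
  mink (intrinsic_hessian F2 p a c) ('D_b F2 p).

(** Differentiate the isometry equation for the projected constant fields a and b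
    along a curve with velocity c; their inner product is stationary. *)
Lemma hessian_pairing_skew p a b c :
  HH p -> HH_tangent p a -> HH_tangent p b -> HH_tangent p c ->
  hessian_pairing p a c b + hessian_pairing p b c a = 0.
Proof.
move=> hp Ta Tb Tc; have [K [Kp dK hK]] := HH_curve hp Tc.
have D1 x (Tx : HH_tangent p x) := is_derive_projected s1 hp Kp Tx dK.
have D2 x (Tx : HH_tangent p x) := is_derive_projected s2 hp Kp Tx dK.
have h := is_deriveD (is_derive_mink (D1 a Ta) (D1 b Tb))
                     (is_derive_mink (D2 a Ta) (D2 b Tb)).
have P x (Tx : HH_tangent p x) := is_derive_HH_proj Kp Tx dK.
have h' := is_deriveD
  (is_derive_mink (is_derive_fst (P a Ta)) (is_derive_fst (P b Tb)))
  (is_derive_mink (is_derive_snd (P a Ta)) (is_derive_snd (P b Tb))).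
have eqn : \forall s \near (0 : R^o),
   (fun s => mink (HH_proj (K s) a).1 (HH_proj (K s) b).1 +
             mink (HH_proj (K s) a).2 (HH_proj (K s) b).2) s =
   (fun s => mink ('D_(HH_proj (K s) a) F1 (K s)) ('D_(HH_proj (K s) b) F1 (K s)) +
             mink ('D_(HH_proj (K s) a) F2 (K s)) ('D_(HH_proj (K s) b) F2 (K s))) s.
  apply: filterS hK => s hs.
  exact: (esym (isom hs (HH_proj_tangent a hs) (HH_proj_tangent b hs))).
have e := is_derive_unique h (near_eq_is_derive eqn h').
have idp x (Tx : HH_tangent p x) : HH_proj (K 0) x = x.
  by rewrite Kp; case: Tx => x1 x2; apply: pairP; rewrite /HH_proj /= hyp_proj_id.
move: e; rewrite !(idp a) // !(idp b) // Kp.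
rewrite /hessian_pairing.
move: (intrinsic_hessian F1 p a c) (intrinsic_hessian F1 p b c)
  (intrinsic_hessian F2 p a c) (intrinsic_hessian F2 p b c)
  ('D_a F1 p) ('D_a F2 p) ('D_b F1 p) ('D_b F2 p) => A1 B1 A2 B2 a1 a2 b1 b2.
case: Ta Tb => Ta1 Ta2 [Tb1 Tb2].
rewrite /ambient_normal /= !minkZl !minkZr (minkC _ p.1) (minkC _ p.2) Ta1 Ta2 Tb1 Tb2.
by rewrite (minkC B1) (minkC B2) !mulr0 !addr0 addrACA.
Qed.

(** A trilinear form symmetric in one pair of arguments and skew in another is zero. *)
Lemma hessian_pairing0 p a b c :
  HH p -> HH_tangent p a -> HH_tangent p b -> HH_tangent p c ->
  hessian_pairing p a c b = 0.
Proof.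
move=> hp Ta Tb Tc.
have sym x y z : hessian_pairing p x y z = hessian_pairing p y x z.
  by rewrite /hessian_pairing (intrinsic_hessianC _ _ s1 hp) (intrinsic_hessianC _ _ s2 hp).
have e1 := hessian_pairing_skew hp Ta Tb Tc.
have e2 := hessian_pairing_skew hp Tb Tc Ta.
have e3 := hessian_pairing_skew hp Tc Ta Tb.
move: e1 e2 e3; rewrite (sym b a c) (sym c a b) (sym c b a).
move: (hessian_pairing p a c b) (hessian_pairing p b c a) (hessian_pairing p a b c) => x y z.
exact: skew_cycle0.
Qed.

Lemma HH_tangent_ext (p n b : E) : HH p -> HH_tangent p n -> HH_tangent p b ->
  (forall d, HH_tangent p d -> ip n d = ip b d) -> n = b.
Proof.
move=> hp [n1 n2] [b1 b2] P.
have Td : HH_tangent p (n - b).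
  by split; rewrite /hyp_tangent /= minkDr minkNr ?n1 ?n2 ?b1 ?b2 subr0.
apply/eqP; rewrite -subr_eq0; apply/eqP; apply: (HH_tangent_eq0 hp Td).
apply/eqP; move/eqP: (P _ Td); rewrite -subr_eq0; congr (_ == _).
by rewrite /ip /= !(minkDl, minkNl); ring.
Qed.

Section Pullback.
Variables (V : set 'rV[R]_2) (f : 'rV[R]_2 -> E).
Hypotheses (oV : open V) (sf : smooth_on V f) (hf : forall x, V x -> HH (f x)).

Lemma second_derive_nabla x v w : V x -> 'D_v (fun y => 'D_w f y) x =
  HH_nabla f x v w + ambient_normal (f x) ('D_w f x) ('D_v f x).
Proof.
move=> Vx; apply: pairP.
  have N := HH_nabla1 oV sf hf v w Vx.
  have D := derive2_proj1 oV sf v w Vx.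
  have m : mink ('D_w f x).1 ('D_v f x).1 =
           mink ('D_v (proj1 f) x) ('D_w (proj1 f) x).
    exact: (etrans (minkC _ _) (congr2 mink (derive_proj1 sf v Vx) (derive_proj1 sf w Vx))).
  exact: (etrans D (etrans (esym (subrK _ _))
    (esym (congr2 +%R N (congr1 ( *:%R^~ (f x).1) m))))).
have N := HH_nabla2 oV sf hf v w Vx.
have D := derive2_proj2 oV sf v w Vx.
have m : mink ('D_w f x).2 ('D_v f x).2 =
         mink ('D_v (proj2 f) x) ('D_w (proj2 f) x).
  exact: (etrans (minkC _ _) (congr2 mink (derive_proj2 sf v Vx) (derive_proj2 sf w Vx))).
exact: (etrans D (etrans (esym (subrK _ _))
  (esym (congr2 +%R N (congr1 ( *:%R^~ (f x).2) m))))).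
Qed.

Lemma derive_comp (G : E -> 'rV[R]_3) x v : smooth_on U G -> V x ->
  is_derive x v (fun y => G (f y)) ('D_('D_v f x) G (f x)).
Proof.
move=> sG Vx; exact: (is_derive_smooth_comp oU sG (HU (hf Vx)) (smooth_is_derive v sf Vx)).
Qed.

Lemma second_derive_comp (G : E -> 'rV[R]_3) x v w : smooth_on U G -> V x ->
  'D_v (fun y => 'D_w (fun z => G (f z)) y) x =
  'D_(HH_nabla f x v w) G (f x) + intrinsic_hessian G (f x) ('D_w f x) ('D_v f x).
Proof.
move=> sG Vx; have UK := HU (hf Vx).
have h := is_derive_varying oU sG (smooth_continuous sf Vx) UK
  (smooth_is_derive v sf Vx) (smooth_is_derive v (smooth_derive w sf) Vx).
have nV : \forall y \near x, V y by exact: open_nbhs_nbhs.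
have e : 'D_v (fun y => 'D_w (fun z => G (f z)) y) x =
         'D_v (fun y => 'D_('D_w f y) G (f y)) x.
  by apply: near_eq_derive; apply: filterS nV => y Vy; case: (derive_comp w sG Vy).
apply: (etrans e); have [_ {}h] := h; apply: (etrans h).
have k := congr1 (fun d => 'D_d G (f x)) (second_derive_nabla v w Vx).
have l := smooth_derive_linear_pair 1 (HH_nabla f x v w)
  (ambient_normal (f x) ('D_w f x) ('D_v f x)) oU sG UK.
rewrite !scale1r in l.
exact: (etrans (congr1 (+%R^~ _) (etrans k l)) (esym (addrA _ _ _))).
Qed.

Hypothesis inj : forall x, V x -> injective (fun v : 'rV[R]_2 => 'D_v f x).
Hypotheses (h1 : forall q, HH q -> hyp (-1) (F1 q)).
Hypotheses (h2 : forall q, HH q -> hyp (-1) (F2 q)).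
Hypothesis diag : forall x, V x -> F1 (f x) = F2 (f x).

(** The isometry carries the covariant derivative of f to that of F o f, since its
    intrinsic second derivative pairs to zero with every D_b F. *)
Lemma nabla_pairing x v w b : V x -> HH_tangent (f x) b ->
  mink ('D_v (fun y => 'D_w (fun z => F1 (f z)) y) x) ('D_b F1 (f x)) +
  mink ('D_v (fun y => 'D_w (fun z => F2 (f z)) y) x) ('D_b F2 (f x)) =
  ip (HH_nabla f x v w) b.
Proof.
move=> Vx Tb; have hp := hf Vx.
have Tv := derive_tangent oV sf hf v Vx; have Tw := derive_tangent oV sf hf w Vx.
have Tn : HH_tangent (f x) (HH_nabla f x v w) := HH_proj_tangent _ hp.
have I := isom hp Tn Tb; have S := hessian_pairing0 hp Tw Tb Tv.
have e1 := second_derive_comp v w s1 Vx; have e2 := second_derive_comp v w s2 Vx.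
apply: (etrans (congr2 (fun a c => mink a _ + mink c _) e1 e2)).
apply: etrans (etrans (congr2 +%R I S) (addr0 _)).
exact: mink_add_pair.
Qed.

Let g := fun y => F1 (f y).

Let g2E x v : V x -> 'D_v (fun y => F2 (f y)) x = 'D_v g x.
Proof.
move=> Vx; apply: near_eq_derive.
have nV : \forall y \near x, V y by exact: open_nbhs_nbhs.
by apply: filterS nV => y Vy; rewrite /g diag.
Qed.

Let gg2E x v w : V x -> 'D_v (fun z => 'D_w (fun y => F2 (f y)) z) x =
  'D_v (fun z => 'D_w g z) x.
Proof.
move=> Vx; apply: near_eq_derive.
have nV : \forall y \near x, V y by exact: open_nbhs_nbhs.
by apply: filterS nV => y Vy; exact: g2E.
Qed.

(** With g = F1 o f = F2 o f, the vector Z = D_v D_w g projects to a tangent vector of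
    the hyperbolic plane at g x.  The map u |-> D_u g is injective into that
    two-dimensional space, so the projection is D_y g for some y, and y is the
    direction sought. *)
Lemma diagonal_nabla x v w : V x -> exists y, HH_nabla f x v w = 'D_y f x.
Proof.
move=> Vx; have hp := hf Vx.
have D1 u : 'D_u g x = 'D_('D_u f x) F1 (f x) by case: (derive_comp u s1 Vx).
have D2 u : 'D_u g x = 'D_('D_u f x) F2 (f x).
  by apply: (etrans (esym (g2E u Vx))); case: (derive_comp u s2 Vx).
have Tf u := derive_tangent oV sf hf u Vx.
have Tg u : mink (g x) ('D_u g x) = 0.
  exact: (etrans (congr1 (mink _) (D1 u)) (HH_map_tangent s1 h1 hp (Tf u))).
have hg : hyp (-1) (g x) := h1 hp.
pose co (j : 'I_3) (d : 'rV[R]_3) := d 0 j.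
have pf j : plane_form (fun u => co j ('D_u g x)).
  move=> s t.
  have ds : row2 s t = s *: row2 1 0 + (t *: row2 0 1 + 0) :> 'rV[R]_2.
    by apply/rowP => i; rewrite !mxE; case: i => -[|[|//]] /= _; ring.
  pose L d := co j ('D_d F1 (f x)).
  have LL k a b : L (k *: a + b) = k * L a + L b.
    rewrite /L (smooth_derive_linear_pair k a b oU s1 (HU hp)) /co.
    by move: ('D_a F1 (f x)) ('D_b F1 (f x)) => a' b'; rewrite !mxE.
  have L0 : L 0 = 0 by rewrite /L derive0 /co mxE.
  have E u : co j ('D_u g x) = L ('D_u f x) := congr1 (co j) (D1 u).
  have L2 A B : L (s *: A + (t *: B + 0)) = s * L A + t * L B.
    exact: linear_comb2.
  have DL : 'D_(row2 s t) f x =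
      s *: 'D_(row2 1 0) f x + (t *: 'D_(row2 0 1) f x + 0).
    apply: (etrans (congr1 (fun d : 'rV[R]_2 => 'D_d f x) ds)).
    apply: (etrans (derive_linear_proj oV sf _ _ _ Vx)); apply: (congr1 (+%R _)).
    apply: (etrans (derive_linear_proj oV sf _ _ _ Vx)).
    exact: (congr1 (+%R _) (derive0 f x)).
  apply: (etrans (E _)); apply: (etrans (congr1 L DL)); apply: (etrans (L2 _ _)).
  exact: (congr2 (fun a b => s * a + t * b) (esym (E _)) (esym (E _))).
have inj' u : co 1 ('D_u g x) = 0 -> co 2%:R ('D_u g x) = 0 -> u = 0.
  move=> e1 e2; have g0 := hyp_tangent_coord hg (Tg u) e1 e2.
  apply: (ip_tangent_eq0 oV sf hf inj Vx).
  apply: (etrans (esym (isom hp (Tf u) (Tf u)))).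
  apply: (etrans (congr2 (fun a b => mink a a + mink b b)
    (etrans (esym (D1 u)) g0) (etrans (esym (D2 u)) g0))).
  by rewrite mink0l addr0.
pose Z := 'D_v (fun z => 'D_w g z) x.
pose ZT := Z + mink Z (g x) *: g x.
have gZT : mink (g x) ZT = 0.
  by rewrite minkDr minkZr (hyp_self hg) mulrN1 minkC subrr.
have [y [y1 y2]] := plane_inj_surj (pf 1) (pf 2%:R) inj' (co 1 ZT) (co 2%:R ZT).
have Dy : 'D_y g x = ZT.
  exact: (hyp_tangent_coord_eq hg (Tg y) gZT y1 y2).
exists y.
have P b : HH_tangent (f x) b -> ip (HH_nabla f x v w) b = ip ('D_y f x) b.
  move=> Tb; apply: (etrans (esym (nabla_pairing v w Vx Tb))).
  apply: etrans (isom hp (Tf y) Tb).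
  have k1 := HH_map_tangent s1 h1 hp Tb.
  have k2 : mink (g x) ('D_b F2 (f x)) = 0.
    exact: (etrans (congr1 (mink^~ _) (diag Vx)) (HH_map_tangent s2 h2 hp Tb)).
  have c1 : mink ZT ('D_b F1 (f x)) = mink Z ('D_b F1 (f x)).
    by rewrite minkDl minkZl k1 mulr0 addr0.
  have c2 : mink ZT ('D_b F2 (f x)) = mink Z ('D_b F2 (f x)).
    by rewrite minkDl minkZl k2 mulr0 addr0.
  apply: congr2.
    exact: (etrans (esym c1) (congr1 (mink^~ _) (etrans (esym Dy) (D1 y)))).
  apply: (etrans (congr1 (mink^~ _) (gg2E v w Vx))).
  exact: (etrans (esym c2) (congr1 (mink^~ _) (etrans (esym Dy) (D2 y)))).
have Tn : HH_tangent (f x) (HH_nabla f x v w) := HH_proj_tangent _ hp.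
exact: (HH_tangent_ext hp Tn (Tf y) P).
Qed.

End Pullback.
End Isometries.

Lemma diagonal_totally_geodesic (R : realType) (S : smooth_surface R)
    (Phi : S -> 'rV[R]_3 * 'rV[R]_3) :
  is_immersion Phi -> is_diagonal_up_to_isometry Phi -> totally_geodesic Phi.
Proof.
move=> imm [F [iF [W oW WE]]] c x v w ac Ux.
have {iF} [[U [oU HU sF]] [G [_ FHH _ _ _]] isoF] : HH_isometry F.
  by case: iF => -[].
have oV := chart_cod_open ac; have sf := param_smooth imm ac.
have hf y (_ : chart_cod c y) := param_HH imm c y.
have inj := param_inj imm ac.
have s1 := smooth_fst oU sF; have s2 := smooth_snd oU sF.
have isom p a b : HH p -> HH_tangent p a -> HH_tangent p b ->
    mink ('D_a (fun q => (F q).1) p) ('D_b (fun q => (F q).1) p) +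
    mink ('D_a (fun q => (F q).2) p) ('D_b (fun q => (F q).2) p) = ip a b.
  move=> hp Ta Tb; have Up := HU _ hp.
  have e1 d : ('D_d F p).1 = 'D_d (fun q => (F q).1) p.
    by case: (is_derive_fst (smooth_is_derive d sF Up)).
  have e2 d : ('D_d F p).2 = 'D_d (fun q => (F q).2) p.
    by case: (is_derive_snd (smooth_is_derive d sF Up)).
  apply: etrans (isoF p a b hp Ta Tb).
  exact: (esym (congr2 +%R (congr2 mink (e1 a) (e1 b)) (congr2 mink (e2 a) (e2 b)))).
have h1 q : HH q -> hyp (-1) (F q).1 by move=> /FHH[].
have h2 q : HH q -> hyp (-1) (F q).2 by move=> /FHH[].
have diag y : chart_cod c y -> (F (Phi (chart_inv c y))).1 = (F (Phi (chart_inv c y))).2.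
  move=> _; have : (F @` range Phi) (F (Phi (chart_inv c y))).
    by exists (Phi (chart_inv c y)) => //; exists (chart_inv c y).
  by rewrite WE diagonalE => -[[_ ->]].
have [y ny] := diagonal_nabla oU HU s1 s2 isom oV sf hf inj h1 h2 diag v w Ux.
exact: (second_form0_of_tangent oV sf hf inj Ux ny).
Qed.

(** * The classification *)

(** The empty surface is an empty open part of any product of geodesics. *)
Lemma geodesic_product_empty (R : realType) (S : smooth_surface R)
    (Phi : S -> 'rV[R]_3 * 'rV[R]_3) : (S -> False) -> is_geodesic_product Phi.
Proof.
move=> S0.
pose p : 'rV[R]_3 := delta_mx 0 0; pose e : 'rV[R]_3 := delta_mx 0 1.
have fr : unit_frame p e.
  split; last 2 first.
  - by rewrite /p /e /mink !mxE/=; ring.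
  - by rewrite /e /mink !mxE/=; ring.
  by split; rewrite /p ?/mink !mxE/= ?ltr01//; field.
exists setT, setT, (geodesic p e), (geodesic p e).
split; [exact: unit_geodesic_geodesic..|].
exists set0; first exact: open0.
by rewrite setI0; apply/seteqP; split=> // q [m _ _]; case: (S0 m).
Qed.

Theorem theorem4p2 (R : realType) (S : smooth_surface R)
    (Phi : S -> 'rV[R]_3 * 'rV[R]_3)
    (S_connected : connected [set: S])
    (Phi_lagrangian : is_lagrangian Phi) :
  totally_geodesic Phi <->
  (is_geodesic_product Phi \/ is_diagonal_up_to_isometry Phi).
Proof.
have [imm _] := Phi_lagrangian; split; last first.
  by case; [exact: product_totally_geodesic|exact: diagonal_totally_geodesic].
move=> tg; have [[m0 _]|S0] := pselect (exists m : S, True); last first.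
  by left; apply: geodesic_product_empty => m; apply: S0; exists m.
have [Q [[n1 [n2 [n1p n2p ->]]]|[p [e [p' [e' [fr fr' ee ->]]]]]] hQ] :=
  global_model Phi_lagrangian tg m0 S_connected.
  by left; exact: (range_planes imm m0 n1p n2p hQ).
by right; exact: (range_graph imm fr fr' ee hQ).
Qed.
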